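(* Let $\Sigma$ be a candidate marked Picard Farey symbol, with occurrence set $X$, normalized local groups $J_x\le K$, and distinguished cell $c_0$. Its local and face data determine at most one transition system (for $S,R,X,Y$) on $$\mathscr C_\Sigma=\bigsqcup_{x\in X}J_x\backslash K .$$ The candidate is valid precisely when these transitions make $\mathscr C_\Sigma$ a transitive finite right $G$-set with the prescribed action of $S,R,X,Y$. For a valid marked symbol put $H_\Sigma=\mathrm{Stab}_G(c_0)$; then $$[G:H_\Sigma]=|\mathscr C_\Sigma|=\sum_{x\in X}[K:J_x].$$ Conversely, every marked finite-index subgroup $H\le G$ (i.e. $H$ together with the base point $H\in H\backslash G$) yields a valid marked Picard Farey symbol, with occurrence set $H\backslash G/K$, placements $g_x$ representing the double cosets $x=Hg_xK$, and $J_x=g_x^{-1}Hg_x\cap K$, for which $$\bigsqcup_{x\in H\backslash G/K}J_x\backslash K\longrightarrow H\backslash G,\qquad J_xk\longmapsto Hg_xk,$$ is an isomorphism of pointed right $G$-sets. Consequently valid marked symbols modulo marked equivalence correspond (bijectively, via $\Sigma\mapsto H_\Sigma$) to finite-index subgroups of $G$, while valid unmarked symbols modulo unmarked equivalence correspond to conjugacy classes of finite-index subgroups of $G$.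
   Context: $G=\mathrm{PSL}_2(\mathbf Z[i])$ acts on hyperbolic 3-space $\mathbf H^3$ (upper half-space) and on its ideal boundary $\mathbf C\cup\{\infty\}\supset\mathbf P^1(\mathbf Q(i))$. Put $w=(1+i)/2$, let $\mathcal O$ be the ideal octahedron with vertices $\infty,0,1,i,1+i,w$, and let $K=\mathrm{Stab}_G(\mathcal O)$ (of order $12$). The translates $g\mathcal O$, $g\in G$, are the Gaussian Farey octahedra; they tessellate $\mathbf H^3$. Put $$S=\begin{pmatrix}0&-1\\1&0\end{pmatrix},\ R=\begin{pmatrix}0&i\\i&0\end{pmatrix},\ X=\begin{pmatrix}1&-1\\1&0\end{pmatrix},\ Y=\begin{pmatrix}-1&i\\i&0\end{pmatrix}.$$ The group $G$ has the presentation $\langle S,R,X,Y\mid S^2=R^2=(RS)^2=X^3=(RX)^2=Y^3=(X^{-1}Y)^2=(SY)^2=1\rangle$. The standard Picard cell $P_0$ is the convex hull of $0,\infty,P_1=(\tfrac12,0,\tfrac{\sqrt3}2),P_2=(\tfrac12,\tfrac12,\tfrac1{\sqrt2}),P_3=(0,\tfrac12,\tfrac{\sqrt3}2)$. The twelve cells $kP_0$, $k\in K$, tile $\mathcal O$; $X,Y\in K$; and $P_0$ meets $RP_0$ (resp. $SP_0$) along a facet contained in the face $F_R$ of $\mathcal O$ with vertices $0,1,\infty$ (resp. the face $F_S$ with vertices $i,0,\infty$). Each of the eight triangular faces $F$ of $\mathcal O$ carries its outward coorientation and induced boundary orientation; $\overline F$ denotes the same geometric face with opposite orientation and coorientation.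 Thus, for faces $F,F'$ of $\mathcal O$ and $q\in G$, the condition $qF=\overline{F'}$ means that $q$ carries the triangle $F$ to the triangle $F'$ and $q\mathcal O$ and $\mathcal O$ lie on opposite sides of $F'$. A *candidate marked Picard Farey symbol* $\Sigma$ consists of: (i) a finite set $X$ of occurrences (distinguished by context from the matrix $X$) and, for each $x\in X$, an element $g_x\in G$ giving the oriented octahedron $\mathcal O_x=g_x\mathcal O$, recorded by the ordered six-tuple $(g_x\infty,g_x0,g_x1,g_xi,g_x(1+i),g_xw)$; (ii) a subgroup $\widehat J_x\le\mathrm{Stab}_G(\mathcal O_x)$, with normalized form $J_x=g_x^{-1}\widehat J_xg_x\le K$; (iii) for each $J_x$-orbit of outward-cooriented faces, with representative $F$ (faces are written in normalized coordinates, i.e. as faces of $\mathcal O$), a paired outward-cooriented face $F'$ belonging to an occurrence $y$, and a source-to-target element $q\in G$ with $qF=\overline{F'}$ and $qJ_{x,F}q^{-1}=J_{y,F'}$, where $J_{x,F}=\{j\in J_x: jF=F\}$; (iv) the pairing is involutive: the reverse pairing is represented by $(F',F,q^{-1})$. Changing representatives by $j\in J_x$, $j'\in J_y$ replaces $(F,F',q)$ by $(jF,j'F',j'qj^{-1})$, and data are considered up to this change. The graph with vertex set $X$ and edges the paired face orbits is connected; (v) a distinguished occurrence and a distinguished cell $c_0$ in its fibre $J_x\backslash K$ (the marking). *Transition system.* The induced maps on $\mathscr C_\Sigma$ are: $X,Y$ act inside each occurrence through the adjacency of the cells $kP_0$, i.e. $J_xk\mapsto J_xkX$ and $J_xk\mapsto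 J_xkY$. For $\tau=R$ (resp. $\tau=S$), choose $k$ in its coset $J_xk$ so that the face $F=kF_R$ (resp. $F=kF_S$) is the stored representative of its $J_x$-orbit, with datum $(F,F',q)$ and target occurrence $y$; then $J_xk\mapsto J_y\ell$, where $\ell\in K$ is given by $\tau=\ell^{-1}qk$, i.e. $\ell=qk\tau^{-1}$. The candidate is *valid* if the induced maps $S,R,X,Y$ on $\mathscr C_\Sigma$ are total permutations, satisfy (as a right action) all eight relators of the presentation above, and act transitively. Two valid marked symbols are *marked equivalent* if their pointed $G$-sets $(\mathscr C_\Sigma,c_0)$ are isomorphic; after forgetting the distinguished cell, two valid symbols are *unmarked equivalent* if their $G$-sets $\mathscr C_\Sigma$ are isomorphic. *)

(* Defs.v *)
From HB Require Import structures.
From mathcomp Require Import all_boot all_order all_algebra.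
From mathcomp Require Import finmap.
From mathcomp Require Import boolp classical_sets functions cardinality reals.
From mathcomp Require Import complex.

Set Implicit Arguments.
Unset Strict Implicit.
Unset Printing Implicit Defensive.

Import Order.TTheory GRing.Theory Num.Theory.

Local Open Scope classical_set_scope.
Local Open Scope ring_scope.
Local Open Scope quotient_scope.
Local Open Scope complex_scope.

(* The library makes [R[i]] a ring only over a field [R]; over [int] we reuse its
   carrier, its additive structure and its multiplication. *)
Definition gaussInt : Type := int[i].
HB.instance Definition _ := GRing.Zmodule.copy gaussInt int[i].

Definition gauss1 : gaussInt := 1%:C.
Definition gauss_mul (x y : gaussInt) : gaussInt := ComplexField.mulc x y.

Lemma gauss_mul1 : left_id gauss1 gauss_mul.
Proof. by move=> [a b]; rewrite /gauss_mul /= !mul1r !mul0r subr0 addr0. Qed.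

Lemma gauss_mulDl : left_distributive gauss_mul +%R.
Proof.
move=> [a b] [c d] [e f].
rewrite -[LHS]/(((a + c) * e - (b + d) * f) +i* ((a + c) * f + (b + d) * e)).
rewrite !mulrDl opprD addrACA [in X in _ +i* X]addrACA.
by [].
Qed.

Lemma gauss1_neq0 : gauss1 != 0. Proof. by []. Qed.

HB.instance Definition _ := GRing.Zmodule_isComNzRing.Build gaussInt
  (@ComplexField.mulcA int) (@ComplexField.mulcC int)
  gauss_mul1 gauss_mulDl gauss1_neq0.

Definition gauss_i : gaussInt := 0 +i* 1.

Definition mx22 (A : Type) (a b c d : A) : 'M[A]_2 :=
  \matrix_(i < 2, j < 2)
    if i == 0 then (if j == 0 then a else b) else (if j == 0 then c else d).

Lemma det_mx22 (A : comNzRingType) (a b c d : A) :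
  \det (mx22 a b c d) = a * d - b * c.
Proof.
rewrite (expand_det_row _ ord0) !big_ord_recl big_ord0 addr0.
rewrite /cofactor !det_mx11 !mxE /= expr0 expr1 mul1r mulN1r.
by rewrite mulrN.
Qed.

Definition sl2 : Type := {A : 'M[gaussInt]_2 | \det A == 1}.
HB.instance Definition _ := SubChoice.on sl2.

Lemma sl2_det (A : sl2) : \det (val A) = 1. Proof. exact/eqP/(valP A). Qed.

Definition sl2_mk (A : 'M[gaussInt]_2) (detA : \det A = 1) : sl2 :=
  exist _ A (introT eqP detA).

Lemma sl2_one_subproof : \det (1%:M : 'M[gaussInt]_2) = 1.
Proof. exact: det1. Qed.
Definition sl2_one := sl2_mk sl2_one_subproof.

Lemma sl2_mul_subproof (A B : sl2) : \det (val A *m val B) = 1.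
Proof. by rewrite det_mulmx !sl2_det mulr1. Qed.
Definition sl2_mul (A B : sl2) := sl2_mk (sl2_mul_subproof A B).

Lemma sl2_inv_subproof (A : sl2) : \det (\adj (val A)) = 1.
Proof.
have := congr1 determinant (mul_mx_adj (val A)).
by rewrite det_mulmx sl2_det mul1r det1.
Qed.
Definition sl2_inv (A : sl2) := sl2_mk (sl2_inv_subproof A).

Lemma sl2_mulA : associative sl2_mul.
Proof. by move=> A B C; apply: val_inj; rewrite /= mulmxA. Qed.
Lemma sl2_mul1 : left_id sl2_one sl2_mul.
Proof. by move=> A; apply: val_inj; rewrite /= mul1mx. Qed.
Lemma sl2_1mul : right_id sl2_one sl2_mul.
Proof. by move=> A; apply: val_inj; rewrite /= mulmx1. Qed.
Lemma sl2_mulV : left_inverse sl2_one sl2_inv sl2_mul.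
Proof. by move=> A; apply: val_inj; rewrite /= mul_adj_mx sl2_det. Qed.
Lemma sl2_Vmul : right_inverse sl2_one sl2_inv sl2_mul.
Proof. by move=> A; apply: val_inj; rewrite /= mul_mx_adj sl2_det. Qed.

HB.instance Definition _ :=
  isGroup.Build sl2 sl2_mulA sl2_mul1 sl2_1mul sl2_mulV sl2_Vmul.

Definition sl2_sim (A B : sl2) : bool :=
  (val A == val B) || (val A == - val B).

Lemma sl2_simP (A B : sl2) :
  reflect (exists b : bool, val A = (-1) ^+ b *: val B) (sl2_sim A B).
Proof.
apply: (iffP orP) => [[/eqP ->|/eqP ->]|[[] ->]].
- by exists false; rewrite scale1r.
- by exists true; rewrite scaleN1r.
- by right; rewrite scaleN1r.
- by left; rewrite scale1r.
Qed.

Lemma sl2_sim_refl : reflexive sl2_sim.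
Proof. by move=> A; rewrite /sl2_sim eqxx. Qed.
Lemma sl2_sim_sym : symmetric sl2_sim.
Proof.
move=> A B; apply/sl2_simP/sl2_simP => -[b ->]; exists b;
by rewrite scalerA -signr_addb addbb scale1r.
Qed.
Lemma sl2_sim_trans : transitive sl2_sim.
Proof.
move=> B A C /sl2_simP[b eAB] /sl2_simP[c eBC]; apply/sl2_simP.
by exists (b (+) c); rewrite eAB eBC scalerA -signr_addb.
Qed.

Canonical sl2_equiv := EquivRel sl2_sim sl2_sim_refl sl2_sim_sym sl2_sim_trans.

Definition psl2 : Type := {eq_quot sl2_equiv}.
HB.instance Definition _ := Choice.on psl2.
HB.instance Definition _ : EqQuotient sl2 sl2_equiv psl2 := EqQuotient.on psl2.

Definition psl2_mul : psl2 -> psl2 -> psl2 := lift_op2 psl2 sl2_mul.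
Definition psl2_inv : psl2 -> psl2 := lift_op1 psl2 sl2_inv.
Definition psl2_one : psl2 := \pi_psl2 sl2_one.

Lemma psl2_pi_mul : {morph \pi_psl2 : A B / sl2_mul A B >-> psl2_mul A B}.
Proof.
move=> A B; unlock psl2_mul; apply/eqmodP.
have /sl2_simP[b eA] : sl2_sim A (repr (\pi_psl2 A)) by apply/eqmodP; rewrite reprK.
have /sl2_simP[c eB] : sl2_sim B (repr (\pi_psl2 B)) by apply/eqmodP; rewrite reprK.
apply/sl2_simP; exists (b (+) c) => /=.
by rewrite eA eB -scalemxAl -scalemxAr scalerA -signr_addb.
Qed.

Lemma psl2_pi_inv : {morph \pi_psl2 : A / sl2_inv A >-> psl2_inv A}.
Proof.
move=> A; unlock psl2_inv; apply/eqmodP.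
set B := repr _.
have /sl2_simP[b eA] : sl2_sim A B by apply/eqmodP; rewrite reprK.
apply/sl2_simP; exists b => /=.
have eB : val B *m \adj (val B) = 1%:M by rewrite mul_mx_adj sl2_det.
have eA' : \adj (val A) *m val A = 1%:M by rewrite mul_adj_mx sl2_det.
have eBA : val B = (-1) ^+ b *: val A.
  by rewrite eA scalerA -signr_addb addbb scale1r.
rewrite -[LHS]mulmx1 -eB mulmxA [X in _ *m X *m _]eBA.
by rewrite -scalemxAr eA' -scalemxAl mul1mx.
Qed.

Lemma psl2_mulA : associative psl2_mul.
Proof.
move=> x y z; rewrite -[x]reprK -[y]reprK -[z]reprK.
by rewrite -!psl2_pi_mul sl2_mulA.
Qed.
Lemma psl2_mul1 : left_id psl2_one psl2_mul.
Proof. by move=> x; rewrite -[x]reprK -psl2_pi_mul sl2_mul1. Qed.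
Lemma psl2_1mul : right_id psl2_one psl2_mul.
Proof. by move=> x; rewrite -[x]reprK -psl2_pi_mul sl2_1mul. Qed.
Lemma psl2_mulV : left_inverse psl2_one psl2_inv psl2_mul.
Proof. by move=> x; rewrite -[x]reprK -psl2_pi_inv -psl2_pi_mul sl2_mulV. Qed.
Lemma psl2_Vmul : right_inverse psl2_one psl2_inv psl2_mul.
Proof. by move=> x; rewrite -[x]reprK -psl2_pi_inv -psl2_pi_mul sl2_Vmul. Qed.

HB.instance Definition _ :=
  isGroup.Build psl2 psl2_mulA psl2_mul1 psl2_1mul psl2_mulV psl2_Vmul.

Inductive picard_gen := genS | genR | genX | genY.
HB.instance Definition _ := gen_eqMixin picard_gen.

Definition gen_mx (s : picard_gen) : 'M[gaussInt]_2 :=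
  match s with
  | genS => mx22 0 (-1) 1 0
  | genR => mx22 0 gauss_i gauss_i 0
  | genX => mx22 1 (-1) 1 0
  | genY => mx22 (-1) gauss_i gauss_i 0
  end.

Lemma gen_mx_det s : \det (gen_mx s) = 1.
Proof. by case: s; rewrite det_mx22; apply/eqP. Qed.

Definition gen_elt (s : picard_gen) : psl2 := \pi_psl2 (sl2_mk (gen_mx_det s)).

(* A letter (s, b) is s if b = false and s^-1 if b = true. *)
Definition picard_word := seq (picard_gen * bool).

Definition picard_relators : seq picard_word :=
  let S := (genS, false) in let R := (genR, false) in
  let X := (genX, false) in let Y := (genY, false) in
  let X' := (genX, true) in
  [:: [:: S; S]; [:: R; R]; [:: R; S; R; S]; [:: X; X; X]; [:: R; X; R; X];
      [:: Y; Y; Y]; [:: X'; Y; X'; Y]; [:: S; Y; S; Y]].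

Section Cosets.
Local Open Scope group_scope.
Variable G : groupType.
Implicit Types (H K : set G) (g : G).

Definition is_subgroup H : Prop := group_closed [in H].

Definition rcoset H g : set G := [set h * g | h in H].
Definition conj_set H g : set G := [set h ^ g | h in H].
Definition dcoset H g K : set G := [set h * g * k | h in H & k in K].

(* the cosets Hk with k in K, that is H\K when H is a subgroup of K *)
Definition rcosets H K : set (set G) := [set rcoset H k | k in K].
Definition dcosets H K : set (set G) := [set dcoset H g K | g in [set: G]].

Definition coset_space H : Type := set_type (rcosets H [set: G]).

Lemma coset_act_subproof H (c : coset_space H) g :
  rcoset (val c) g \in rcosets H [set: G].
Proof.
case: c => A /= /set_mem[k _ <-]; apply/mem_set; exists (k * g) => //.
by rewrite /rcoset image_comp; apply: eq_imagel => h _ /=; rewrite mulgA.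
Qed.
Definition coset_act H (c : coset_space H) g : coset_space H :=
  exist _ (rcoset (val c) g) (coset_act_subproof c g).

Definition finite_index_subgroup H : Prop :=
  is_subgroup H /\ finite_set (rcosets H [set: G]).

Definition conj_class H : set (set G) := [set conj_set H g | g in [set: G]].

Definition is_right_action (T : Type) (act : T -> G -> T) : Prop :=
  (forall c, act c 1 = c) /\ (forall c g h, act c (g * h) = act (act c g) h).

Definition transitive_action (T : Type) (act : T -> G -> T) : Prop :=
  forall c c', exists g, act c g = c'.

Definition stabilizer (T : Type) (act : T -> G -> T) (c : T) : set G :=
  [set g | act c g = c].

Definition gset_iso (T T' : Type) (act : T -> G -> T) (act' : T' -> G -> T')
    (f : T -> T') : Prop :=
  bijective f /\ forall c g, f (act c g) = act' (f c) g.

End Cosets.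

(* 0 if A is infinite *)
Definition ncard (T : choiceType) (A : set T) : nat := #|` fset_set A|%fset.

(* f induces a bijection from {a | P a} modulo E onto {b | Q b} *)
Definition bijective_modulo (A B : Type) (P : A -> Prop) (E : A -> A -> Prop)
    (f : A -> B) (Q : B -> Prop) : Prop :=
  [/\ forall a, P a -> Q (f a),
      forall a a', P a -> P a' -> (E a a' <-> f a = f a')
    & forall b, Q b -> exists2 a, P a & f a = b].

Section Geometry.
Variable R : realType.

(* (z, t) is the point z + t j of the upper half-space when t > 0; every subset
   of H^3 below is a set of points with t > 0. *)
Definition point : Type := (R[i] * R)%type.

(* the boundary sphere, with None for the point at infinity *)
Definition ideal_point : Type := option R[i].

Definition gauss_C (x : gaussInt) : R[i] := (complex.Re x)%:~R +i* (complex.Im x)%:~R.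
Definition sqnorm (z : R[i]) : R := complex.Re z ^+ 2 + complex.Im z ^+ 2.

(* the Poincare extension of z |-> (a z + b) / (c z + d) *)
Definition mx_act (A : 'M[gaussInt]_2) (p : point) : point :=
  let: (z, t) := p in
  let a := gauss_C (A 0 0) in let b := gauss_C (A 0 1) in
  let c := gauss_C (A 1 0) in let d := gauss_C (A 1 1) in
  let n := sqnorm (c * z + d) + sqnorm c * t ^+ 2 in
  (((a * z + b) * conjc (c * z + d) + a * conjc c * (t ^+ 2)%:C) / n%:C, t / n).

Lemma mx_actN A p : mx_act (- A) p = mx_act A p.
Proof.
have gN x : gauss_C (- x) = - gauss_C x.
  by case: x => x y; apply/eqP; rewrite eq_complex /= !mulrNz !eqxx.
have cN (z : R[i]) : conjc (- z) = - conjc z by case: z.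
have sN z : sqnorm (- z) = sqnorm z by case: z => x y; rewrite /sqnorm /= !sqrrN.
case: p => z t; rewrite /mx_act !mxE !gN !mulNr -!opprD !cN !sN.
by rewrite !(mulrN, mulNr) !opprK.
Qed.

Definition hact (g : psl2) (p : point) : point := mx_act (val (repr g)) p.

Lemma hact_pi (A : sl2) p : hact (\pi_psl2 A) p = mx_act (val A) p.
Proof.
have /orP[/eqP eA|/eqP eA] : sl2_sim (repr (\pi_psl2 A)) A.
- by apply/eqmodP; rewrite reprK.
- by rewrite /hact eA.
- by rewrite /hact eA mx_actN.
Qed.

Definition translate (g : psl2) (A : set point) : set point := hact g @` A.

(* A hyperbolic plane is the zero set in H^3 of
   a (|z|^2 + t^2) + 2 Re (b^* z) + c with |b|^2 - a c > 0; the two closed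
   half-spaces it bounds are given by the sign of this expression. *)
Record hplane := HPlane { hp_a : R; hp_b : R[i]; hp_c : R }.

Definition nondegenerate (h : hplane) : Prop :=
  hp_a h * hp_c h < sqnorm (hp_b h).

Definition side (h : hplane) (p : point) : R :=
  hp_a h * (sqnorm p.1 + p.2 ^+ 2) + 2 * complex.Re (conjc (hp_b h) * p.1) + hp_c h.

(* At infinity only the sign of a matters. *)
Definition ideal_side (h : hplane) (v : ideal_point) : R :=
  if v is Some z then hp_a h * sqnorm z + 2 * complex.Re (conjc (hp_b h) * z) + hp_c h
  else hp_a h.

(* hyperbolic convex hull of a set of ideal points: the intersection of the
   closed half-spaces of H^3 whose ideal boundary contains them *)
Definition hull (V : set ideal_point) : set point :=
  [set p | 0 < p.2 /\
     forall h, nondegenerate h -> (forall v, V v -> ideal_side h v <= 0) ->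
       side h p <= 0].

Definition opposite_sides (F A B : set point) : Prop :=
  exists h, [/\ nondegenerate h,
    forall p, F p -> side h p = 0,
    forall p, A p -> side h p <= 0
  & forall p, B p -> 0 <= side h p].

Definition v_inf : ideal_point := None.
Definition v_0 : ideal_point := Some 0.
Definition v_1 : ideal_point := Some 1.
Definition v_i : ideal_point := Some (0 +i* 1).
Definition v_1i : ideal_point := Some (1 +i* 1).
Definition v_w : ideal_point := Some ((1 +i* 1) / 2).

Definition octahedron : set point :=
  hull [set v_inf; v_0; v_1; v_i; v_1i; v_w].

(* The pairs of opposite vertices are (oo, w), (0, 1 + i) and (1, i), and a face
   has exactly one vertex in each pair. *)
Definition octa_face (F : set point) : Prop :=
  exists a b c, [/\ [set v_inf; v_w] a, [set v_0; v_1i] b, [set v_1; v_i] c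
    & F = hull [set a; b; c]].

Definition face_R : set point := hull [set v_0; v_1; v_inf].
Definition face_S : set point := hull [set v_i; v_0; v_inf].

Definition set_stab (A : set point) : set psl2 := [set g | translate g A = A].
Definition octa_stab : set psl2 := set_stab octahedron.

End Geometry.

Arguments octahedron R : clear implicits.
Arguments face_R R : clear implicits.
Arguments face_S R : clear implicits.
Arguments octa_stab R : clear implicits.

Section Symbols.
Local Open Scope group_scope.
Variable R : realType.
Local Notation K := (octa_stab R).
Local Notation O := (octahedron R).
Local Notation face := (set (point R)).

Record local_data := LocalData {
  occ : finType;
  place : occ -> psl2;
  loc_hat : occ -> set psl2;
  loc_hat_subgroup : forall x, is_subgroup (loc_hat x);
  loc_hat_stab : forall x, loc_hat x `<=` set_stab (translate (place x) O)
}.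

(* J_x = g_x^-1 * hat(J)_x * g_x *)
Definition loc (L : local_data) (x : occ L) : set psl2 :=
  conj_set (loc_hat x) (place x).

Definition face_stab (L : local_data) (x : occ L) (F : face) : set psl2 :=
  [set j | loc x j /\ translate j F = F].

(* (F1, F1', q1) is obtained from (F, F', q), with F a face of x and F' a face
   of y, by a change of representatives. *)
Definition rep_change (L : local_data) (x y : occ L)
    (F F' : face) (q : psl2) (F1 F1' : face) (q1 : psl2) : Prop :=
  exists j j', [/\ loc x j, loc y j', F1 = translate j F, F1' = translate j' F'
    & q1 = j' * q * j^-1].

(* Faces are faces of O.  [stored x] consists of one representative F of each
   loc x-orbit of faces, with datum (F, mate x F, glue x F) and target occurrence
   [target x F]; the values of these three functions elsewhere are irrelevant.
   A face of O is always taken with its outward coorientation. *)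
Record face_data (L : local_data) := FaceData {
  stored : occ L -> set face;
  target : occ L -> face -> occ L;
  mate : occ L -> face -> face;
  glue : occ L -> face -> psl2;
  stored_face : forall x F, stored x F -> octa_face F;
  stored_rep : forall x F, octa_face F ->
    exists! F0, stored x F0 /\ exists2 j, loc x j & F0 = translate j F;
  mate_face : forall x F, stored x F -> octa_face (mate x F);
  glue_face : forall x F, stored x F -> translate (glue x F) F = mate x F;
  glue_side : forall x F, stored x F ->
    opposite_sides (mate x F) (translate (glue x F) O) O;
  glue_stab : forall x F, stored x F ->
    [set glue x F * j * (glue x F)^-1 | j in face_stab x F]
      = face_stab (target x F) (mate x F);
  pairing_invol : forall x F, stored x F -> exists F1,
    [/\ stored (target x F) F1, target (target x F) F1 = x
      & rep_change (target x F) x (mate x F) F (glue x F)^-1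
          F1 (mate (target x F) F1) (glue (target x F) F1)]
}.

Definition same_face_data (L : local_data) (D D' : face_data L) : Prop :=
  forall x F, stored D x F -> exists F1,
    [/\ stored D' x F1, target D' x F1 = target D x F
      & rep_change x (target D x F) F (mate D x F) (glue D x F)
          F1 (mate D' x F1) (glue D' x F1)].

Definition paired (L : local_data) (D : face_data L) (x y : occ L) : bool :=
  `[< exists2 F, stored D x F & target D x F = y >].

(* The pairing graph is symmetric since the pairing is involutive; a connected
   graph is nonempty. *)
Record symbol := Symbol {
  sym_loc :> local_data;
  sym_faces : face_data sym_loc;
  sym_connected : exists x, forall y, connect (paired sym_faces) x y
}.

(* The disjoint union of the J_x\K; the coset J_x k of x is the pair (x, J_x k). *)
Definition cells (L : local_data) : set (occ L * set psl2) :=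
  [set c | rcosets (loc c.1) K c.2].
Arguments cells L : clear implicits.
Definition cell (L : local_data) : Type := set_type (cells L).
HB.instance Definition _ L := Choice.on (cell L).

(* A relation rather than a map: on a facet the image is given by any k in the
   coset that carries F0 to a stored representative F, the cell of l being
   determined by s = l^-1 * q * k with q the datum of F. *)
Definition induced (L : local_data) (D : face_data L) (s : picard_gen)
    (c c' : cell L) : Prop :=
  let facet_rule F0 :=
    exists x k l,
      let F := translate k F0 in
      [/\ [/\ K k, K l & stored D x F],
          val c = (x, rcoset (loc x) k),
          gen_elt s = l^-1 * glue D x F * k
        & val c' = (target D x F, rcoset (loc (target D x F)) l)] in
  let inner_rule :=
    exists x k, [/\ K k, val c = (x, rcoset (loc x) k)
      & val c' = (x, rcoset (loc x) (k * gen_elt s))] in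
  match s with
  | genR => facet_rule (face_R R)
  | genS => facet_rule (face_S R)
  | genX | genY => inner_rule
  end.

Definition transition_system (L : local_data) (D : face_data L)
    (t : picard_gen -> cell L -> cell L) : Prop :=
  forall s c, induced D s c (t s c).

(* t' s stands for the inverse of t s; the leftmost letter acts first. *)
Definition run (T : Type) (t t' : picard_gen -> T -> T) (w : picard_word) (c : T)
    : T :=
  foldl (fun c l => if l.2 then t' l.1 c else t l.1 c) c w.

Definition valid (Sg : symbol) : Prop :=
  exists t t' : picard_gen -> cell Sg -> cell Sg,
    [/\ transition_system (sym_faces Sg) t,
        forall s, cancel (t s) (t' s) /\ cancel (t' s) (t s),
        forall w, w \in picard_relators -> forall c, run t t' w c = c
      & forall c c', exists w, run t t' w c = c'].

Definition picard_gset (Sg : symbol) (act : cell Sg -> psl2 -> cell Sg) : Prop :=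
  [/\ is_right_action act, transitive_action act
    & forall s c, induced (sym_faces Sg) s c (act c (gen_elt s))].

(* Generators determine the action, so that for a valid symbol this is the only
   one with the prescribed action of S, R, X, Y; it is trivial by convention if
   there is none. *)
Definition cell_act (Sg : symbol) : cell Sg -> psl2 -> cell Sg :=
  if pselect (exists act, @picard_gset Sg act) is left e then projT1 (cid e)
  else fun c _ => c.

Record marked_symbol := MarkedSymbol {
  unmarked :> symbol;
  mark_occ : occ unmarked;
  mark : cell unmarked;
  mark_fibre : (val mark).1 = mark_occ
}.

Definition symbol_group (Sg : marked_symbol) : set psl2 :=
  stabilizer (@cell_act Sg) (mark Sg).

Definition marked_equiv (Sg Sg' : marked_symbol) : Prop :=
  exists f, gset_iso (@cell_act Sg) (@cell_act Sg') f /\ f (mark Sg) = mark Sg'.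

Definition unmarked_equiv (Sg Sg' : symbol) : Prop :=
  exists f, gset_iso (@cell_act Sg) (@cell_act Sg') f.

(* the groups H_Sigma for all choices of the distinguished cell *)
Definition symbol_class (Sg : symbol) : set (set psl2) :=
  [set stabilizer (@cell_act Sg) c | c in [set: cell Sg]].

End Symbols.

(* Main.v *)
Require Import Defs.
From HB Require Import structures.
From mathcomp Require Import all_boot all_order all_algebra.
From mathcomp Require Import finmap.
From mathcomp Require Import boolp classical_sets functions cardinality reals.
From mathcomp Require Import complex.
From mathcomp Require Import zify ring lra.

Set Implicit Arguments.
Unset Strict Implicit.
Unset Printing Implicit Defensive.

Local Open Scope classical_set_scope.
Local Open Scope group_scope.

(** The cells of a symbol are the translates of the Picard cell in its octahedra,
    modulo the local groups, and the theorem says that prescribing how S, R, X and Y permute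
    them is the same as giving a transitive action of G = PSL_2(Z[i]).

    _The transitions are functions._  A cell on a facet is moved by any element
    k of its coset that carries the standard face to a stored representative.
    Two such elements differ by an element of the local group that fixes the
    face, and the gluing element carries it into the local group of the target,
    so the image coset does not change ([facet_rule_uniq]).

    _Permutations that satisfy the relators come from an action of G._  This is
    the assertion that the eight relators present G ([picard_presentation]).  In
    terms of T_1 = X S^-1, T_i = Y R^-1 and U = R S they say that T is a
    representation of the additive group Z[i], that U is an involution that
    commutes with S and inverts T, that S is an involution, and that S and T
    satisfy a braid relation for each unit.  Euclid's algorithm on the bottom row
    (c, d) of a matrix writes the matrix as a word in T, U and S.  The value of
    that word in a group with these relations depends only on the matrix
    ([euclid_uniq]), by induction on |c|: two admissible quotients of d by c
    differ by a unit, where the braid relation identifies the two words, or by a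
    sum of two perpendicular units, where an intermediate quotient is admissible
    too.  Hence the value is a morphism on G.

    _The stabilizer K of the octahedron and its faces._  A half-space that
    contains the hull of cusps, infinity among them, has all these cusps in its
    closure, as the vertical geodesics over the finite cusps show
    ([hullG_vertex]).  So an element of K maps each vertex to a Gaussian vector
    that satisfies the eight inequalities of the face planes; these force it to
    be a unit multiple of a vertex ([octa_planes_primitive]), and what remains is
    a finite enumeration of matrices by their columns.  It shows that K is
    finite, that the faces form two orbits, those of the faces F_R and F_S
    ([octa_face_orbit]), and that the stabilizers of F_R and F_S in K are
    generated by X and Y.  As R inverts X and S inverts Y, conjugation by R and S
    preserves these stabilizers ([face_orbit_uniq]).

    _From a subgroup to a symbol._  For H of finite index put an octahedron at
    each double coset H g_x K, and glue the face F = k F_R (or k F_S) of x to the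
    face l F_R (or l F_S) of y by q = l R k^-1 (or l S k^-1) whenever q lifts to
    an element of H between the two placements.  This relation is symmetric, is
    compatible with the local groups, and by the last remark determines (y, q) up
    to the local group of y ([glued_sym], [glued_move], [glued_uniq]); the axioms
    of a symbol follow from these three properties.  The map J_x k |-> H g_x k is
    a bijection onto the cosets of H that turns right multiplication by the
    generators into the transitions.

    The index formula is the orbit-stabilizer formula, and the correspondences
    hold because a transitive pointed set with a right action is determined by
    the stabilizer of its base point ([stabilizer_gset_iso]), while moving the
    base point conjugates the stabilizer. *)

(** * Division in the Gaussian integers *)

Section GaussNorm.
Import Order.TTheory GRing.Theory Num.Theory.
Local Open Scope ring_scope.
Implicit Types x y c d q r u : gaussInt.

Definition gsqnorm x : int := complex.Re x ^+ 2 + complex.Im x ^+ 2.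

Lemma gsqnorm_ge0 x : 0 <= gsqnorm x.
Proof. by rewrite addr_ge0 ?sqr_ge0. Qed.

Lemma gsqnorm_eq0 x : (gsqnorm x == 0) = (x == 0).
Proof.
case: x => a b; rewrite /gsqnorm /= paddr_eq0 ?sqr_ge0 // !sqrf_eq0.
by rewrite eq_complex.
Qed.

Lemma gmulE (a b a' b' : int) :
  ((a +i* b)%C : gaussInt) * ((a' +i* b')%C : gaussInt) =
  ((a * a' - b * b') +i* (a * b' + b * a'))%C.
Proof. by []. Qed.

Lemma gaddE (a b a' b' : int) :
  ((a +i* b)%C : gaussInt) + ((a' +i* b')%C : gaussInt) =
  ((a + a') +i* (b + b'))%C.
Proof. by []. Qed.

Lemma goppE (a b : int) :
  - ((a +i* b)%C : gaussInt) = ((- a) +i* (- b))%C.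
Proof. by []. Qed.

Lemma gsqnormM x y : gsqnorm (x * y) = gsqnorm x * gsqnorm y.
Proof. case: x y => [a b] [a' b']; rewrite gmulE /gsqnorm /=; ring. Qed.

Lemma gsqnormN x : gsqnorm (- x) = gsqnorm x.
Proof. by case: x => a b; rewrite goppE /gsqnorm /= !sqrrN. Qed.

Lemma gsqnorm0 : gsqnorm 0 = 0. Proof. by []. Qed.

Lemma gsqnorm_gt0 x : (0 < gsqnorm x) = (x != 0).
Proof. by rewrite lt_def gsqnorm_eq0 gsqnorm_ge0 andbT. Qed.

(** The quotient rounds both coordinates of the exact quotient to a nearest
    integer, so that the remainder has at most half the norm of the divisor. *)
Lemma gauss_division d c : c != 0 -> exists q, gsqnorm (d - c * q) < gsqnorm c.
Proof.
move=> c0; have := c0; rewrite -gsqnorm_gt0.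
have near (m n : int) : 0 < n -> exists k : int, 4 * (m - n * k) ^+ 2 <= n ^+ 2.
  move=> n0; exists (((2 * m + n) %/ (2 * n))%Z).
  have n20 : 2 * n != 0 by lia.
  have := divz_eq (2 * m + n) (2 * n).
  have := modz_ge0 (2 * m + n) n20.
  have := ltz_pmod (2 * m + n) (_ : 0 < 2 * n).
  set k := (_ %/ _)%Z; set e := (_ %% _)%Z => /(_ ltac:(lia)) e1 e0 eq.
  have -> : 4 * (m - n * k) ^+ 2 = (2 * (m - n * k)) ^+ 2 by ring.
  have -> : 2 * (m - n * k) = e - n by lia.
  nia.
case: c d c0 => [c1 c2] [d1 d2] c0; set n := gsqnorm _ => n0.
have [k1 h1] := near (d1 * c1 + d2 * c2) n n0.
have [k2 h2] := near (d2 * c1 - d1 * c2) n n0.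
exists (k1 +i* k2)%C; rewrite -(ltr_pM2r n0).
rewrite gmulE goppE gaddE.
set e := gsqnorm _; suff -> : e * n = (d1 * c1 + d2 * c2 - n * k1) ^+ 2 +
  (d2 * c1 - d1 * c2 - n * k2) ^+ 2 by nia.
rewrite /e /n /gsqnorm /=; ring.
Qed.

Definition gauss_units : seq gaussInt :=
  [:: (1 +i* 0); ((-1) +i* 0); (0 +i* 1); (0 +i* (-1))]%C.

Lemma sqr_sum_le3 (a b : int) : a ^+ 2 + b ^+ 2 < 4 ->
  [\/ a = 0, a = 1 | a = -1] /\ [\/ b = 0, b = 1 | b = -1].
Proof.
move=> h; have h1 : -2 < a < 2 by nia.
have h2 : -2 < b < 2 by nia.
split.
- have [->|[->|->]] : a = 0 \/ a = 1 \/ a = -1 by lia.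
  + by constructor 1.
  + by constructor 2.
  + by constructor 3.
- have [->|[->|->]] : b = 0 \/ b = 1 \/ b = -1 by lia.
  + by constructor 1.
  + by constructor 2.
  + by constructor 3.
Qed.

Lemma gauss_unitsP u : gsqnorm u = 1 -> u \in gauss_units.
Proof.
case: u => a b; rewrite /gsqnorm /= => h.
by have [] := @sqr_sum_le3 a b ltac:(lia);
  case=> ha; case=> hb; subst a b => //; move: h.
Qed.

Lemma gauss_units_inv u : u \in gauss_units -> exists2 v, v \in gauss_units & u * v = 1.
Proof.
rewrite !inE => /or4P[] /eqP->.
- by exists (1 +i* 0)%C.
- by exists ((-1) +i* 0)%C.
- by exists (0 +i* (-1))%C.
- by exists (0 +i* 1)%C.
Qed.

Lemma mul_eq1_gauss_units x y : x * y = 1 -> x \in gauss_units.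
Proof.
move=> h; apply: gauss_unitsP.
have := gsqnormM x y; rewrite h => /esym.
have -> : gsqnorm 1 = 1 by [].
have := gsqnorm_ge0 x; have := gsqnorm_ge0 y.
move: (gsqnorm x) (gsqnorm y) => a b b0 a0 ab.
have a1 : a != 0 by apply/eqP => a1; move: ab; rewrite a1 mul0r.
have b1 : b != 0 by apply/eqP => b1; move: ab; rewrite b1 mulr0.
nia.
Qed.

Lemma gsqnorm_triangle x y : gsqnorm (x - y) <= 2 * gsqnorm x + 2 * gsqnorm y.
Proof.
rewrite -subr_ge0; suff -> : 2 * gsqnorm x + 2 * gsqnorm y - gsqnorm (x - y) = gsqnorm (x + y).
  exact: gsqnorm_ge0.
case: x y => [a b] [a' b']; rewrite goppE !gaddE /gsqnorm /=; ring.
Qed.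

(** Two quotients of the same division differ by a small Gaussian integer; in
    the diagonal case one of the two intermediate lattice points is again a
    quotient, because opposite corners of a square have the same sum of squared
    distances to any point. *)
Lemma quotients_differ c r x : gsqnorm r < gsqnorm c -> gsqnorm (r - c * x) < gsqnorm c ->
  [\/ x = 0, x \in gauss_units |
     exists u v, [/\ u \in gauss_units, v \in gauss_units, x = u + v &
       gsqnorm (r - c * u) < gsqnorm c]].
Proof.
move=> h1 h2.
have h3 : gsqnorm c * gsqnorm x < gsqnorm c * 4.
  rewrite -gsqnormM; have := gsqnorm_triangle r (r - c * x).
  by rewrite opprB addrCA subrr addr0; lia.
have c0 : 0 < gsqnorm c by have := gsqnorm_ge0 r; lia.
move: h3; rewrite ltr_pM2l // => {c0}.
case: x h2 => a b h2; rewrite [X in X < 4]/gsqnorm /= => /sqr_sum_le3 [].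
case=> ha; case=> hb; subst a b; first [by constructor 1 | by constructor 2 | constructor 3].
all: match goal with h : is_true (gsqnorm (_ - _ * (?a +i* ?b)%C) < _) |- _ =>
  pose u : gaussInt := (a +i* 0)%C; pose v : gaussInt := (0 +i* b)%C;
  have : gsqnorm (r - c * u) + gsqnorm (r - c * v) < gsqnorm c + gsqnorm c;
  [suff -> : gsqnorm (r - c * u) + gsqnorm (r - c * v) = gsqnorm r + gsqnorm (r - c * (a +i* b)%C);
    [exact: ltrD h1 h |] |] end.
all: try by case: (r) (c) => [r1 r2] [c1 c2]; rewrite /u /v !gmulE !goppE !gaddE /gsqnorm /=; ring.
all: have [hu|hu] := ltP (gsqnorm (r - c * u)) (gsqnorm c);
  [by exists u, v | move=> e; exists v, u; split=> //; lia].
Qed.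

(** The quotient has modulus one, so one of its two coordinates exceeds 1/2 in
    absolute value and the corresponding unit is at distance less than one. *)
Lemma equal_norm_unit c d : c != 0 -> gsqnorm c = gsqnorm d ->
  exists2 u, u \in gauss_units & gsqnorm (d - c * u) < gsqnorm c.
Proof.
rewrite -gsqnorm_gt0 => c0 e.
pose P := complex.Re d * complex.Re c + complex.Im d * complex.Im c.
pose Q := complex.Im d * complex.Re c - complex.Re d * complex.Im c.
have hPQ : P ^+ 2 + Q ^+ 2 = gsqnorm c ^+ 2.
  have -> : gsqnorm c ^+ 2 = gsqnorm c * gsqnorm d by rewrite -e expr2.
  by rewrite /P /Q /gsqnorm; ring.
have exp u : gsqnorm (d - c * u) = gsqnorm d + gsqnorm c * gsqnorm u
     - 2 * (P * complex.Re u + Q * complex.Im u).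
  by rewrite /P /Q; case: c d u {c0 e P Q hPQ} => [c1 c2] [d1 d2] [u1 u2];
     rewrite gmulE goppE gaddE /gsqnorm /=; ring.
have : [|| gsqnorm c < 2 * P, gsqnorm c < - (2 * P), gsqnorm c < 2 * Q | gsqnorm c < - (2 * Q)].
  apply/negPn/negP; rewrite !negb_or -!leNgt => /and4P[p1 p2 p3 p4]; nia.
case/or4P => h; [exists (1 +i* 0)%C|exists ((-1) +i* 0)%C|exists (0 +i* 1)%C|exists (0 +i* (-1))%C];
  rewrite // exp -e [in gsqnorm (_ +i* _)%C]/gsqnorm /=; lia.
Qed.

End GaussNorm.

(** * Matrices of determinant one *)

Section SL2.
Import Order.TTheory GRing.Theory Num.Theory.
Local Open Scope ring_scope.
Implicit Types (A B : sl2) (a b c d q x : gaussInt).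

Definition ea A : gaussInt := val A 0 0.
Definition eb A : gaussInt := val A 0 1.
Definition ec A : gaussInt := val A 1 0.
Definition ed A : gaussInt := val A 1 1.

Lemma mx2P (T : Type) (M N : 'M[T]_2) :
  M 0 0 = N 0 0 -> M 0 1 = N 0 1 -> M 1 0 = N 1 0 -> M 1 1 = N 1 1 -> M = N.
Proof.
move=> h1 h2 h3 h4; apply/matrixP => i j.
by case: i => -[|[|//]] hi; case: j => -[|[|//]] hj;
   [move: h1 | move: h2 | move: h3 | move: h4]; congr (_ = _); congr (_ _ _); apply: val_inj.
Qed.

Lemma sl2P A B : ea A = ea B -> eb A = eb B -> ec A = ec B -> ed A = ed B -> A = B.
Proof. by move=> h1 h2 h3 h4; apply: val_inj; apply: mx2P. Qed.

Lemma sl2_detE A : ea A * ed A - eb A * ec A = 1.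
Proof.
rewrite -(sl2_det A) (_ : val A = mx22 (ea A) (eb A) (ec A) (ed A)).
  by rewrite det_mx22.
by apply: mx2P; rewrite !mxE.
Qed.

Definition sl2_mx a b c d (h : a * d - b * c = 1) : sl2 :=
  sl2_mk (etrans (det_mx22 a b c d) h).

Lemma T_subproof x : 1 * 1 - x * 0 = 1 :> gaussInt.
Proof. by rewrite mulr1 mulr0 subr0. Qed.
Definition sl2T x : sl2 := sl2_mx (T_subproof x).
Arguments sl2T x%_R.
Definition sl2S : sl2 := sl2_mk (gen_mx_det genS).
Lemma U_subproof : gauss_i * (- gauss_i) - 0 * 0 = 1. Proof. by []. Qed.
Definition sl2U : sl2 := sl2_mx U_subproof.
Lemma N_subproof : -1 * -1 - 0 * 0 = 1 :> gaussInt. Proof. by []. Qed.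
Definition sl2N : sl2 := sl2_mx N_subproof.

Lemma sl2_valM A B : val (A * B)%g = val A *m val B. Proof. by []. Qed.

Lemma sl2_entM A B i j :
  val (A * B)%g i j = val A i 0 * val B 0 j + val A i 1 * val B 1 j.
Proof.
rewrite sl2_valM mxE !big_ord_recl big_ord0 addr0.
by congr (_ * _ + _ * _); congr (_ _ _); apply: val_inj.
Qed.

Lemma eaM A B : ea (A * B)%g = ea A * ea B + eb A * ec B. Proof. exact: sl2_entM. Qed.
Lemma ebM A B : eb (A * B)%g = ea A * eb B + eb A * ed B. Proof. exact: sl2_entM. Qed.
Lemma ecM A B : ec (A * B)%g = ec A * ea B + ed A * ec B. Proof. exact: sl2_entM. Qed.
Lemma edM A B : ed (A * B)%g = ec A * eb B + ed A * ed B. Proof. exact: sl2_entM. Qed.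

Lemma eaE a b c d h : ea (@sl2_mx a b c d h) = a. Proof. by rewrite /ea mxE. Qed.
Lemma ebE a b c d h : eb (@sl2_mx a b c d h) = b. Proof. by rewrite /eb mxE. Qed.
Lemma ecE a b c d h : ec (@sl2_mx a b c d h) = c. Proof. by rewrite /ec mxE. Qed.
Lemma edE a b c d h : ed (@sl2_mx a b c d h) = d. Proof. by rewrite /ed mxE. Qed.

Lemma entriesS : ((ea sl2S = 0) * (eb sl2S = -1) * (ec sl2S = 1) * (ed sl2S = 0))%type.
Proof. by rewrite /ea /eb /ec /ed !mxE. Qed.

Lemma sl2_val1 : val (1%g : sl2) = 1%:M. Proof. by []. Qed.
Lemma entries1 : ((ea 1%g = 1) * (eb 1%g = 0) * (ec 1%g = 0) * (ed 1%g = 1))%type.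
Proof. by rewrite /ea /eb /ec /ed sl2_val1 !mxE. Qed.

Definition entriesE := (eaM, ebM, ecM, edM, eaE, ebE, ecE, edE, entriesS, entries1).

End SL2.

Arguments sl2T x%_R.
Arguments ea A%_g.
Arguments eb A%_g.
Arguments ec A%_g.
Arguments ed A%_g.

Ltac sl2_eq := apply: sl2P; rewrite /sl2T /sl2U /sl2N !entriesE; ring.

Section DiagonalMatrices.
Import Order.TTheory GRing.Theory Num.Theory.
Implicit Types (A : sl2) (u v : gaussInt).

(** Separates the two classes of units modulo sign: false for 1 and -1, true for i
    and -i. *)
Definition eps u : bool := (u != 1%R) && (u != (-1)%R).

Lemma eps_sqr u : u \in gauss_units -> (u * u = if eps u then -1 else 1)%R.
Proof. by rewrite !inE => /or4P[] /eqP ->. Qed.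

Lemma det_ec0 A : ec A = 0%R -> (ea A * ed A = 1)%R.
Proof. by move=> c0; have := sl2_detE A; rewrite c0 mulr0 subr0. Qed.

Lemma gauss_i2 : (gauss_i * gauss_i = -1)%R. Proof. by []. Qed.

Lemma diag_subproof u v : (u * v = 1)%R -> (v * u - 0 * 0 = 1 :> gaussInt)%R.
Proof. by move=> uv; rewrite mulr0 subr0 mulrC. Qed.
Definition sl2D u v (uv : (u * v = 1)%R) := sl2_mx (diag_subproof uv).

Lemma sl2D_cases u v (uv : (u * v = 1)%R) :
  exists b : bool, sl2D uv = sl2U ^+ eps v * sl2N ^+ b.
Proof.
have := @mul_eq1_gauss_units v u; rewrite mulrC => /(_ uv).
have inv w : (v * w = 1)%R -> u = w by move=> vw; rewrite -[RHS]mul1r -uv -mulrA vw mulr1.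
rewrite !inE => /or4P[] /eqP e.
- have {}e : v = 1%R := e; have u1 : u = 1%R by apply: inv; rewrite e.
  exists false; rewrite {2}e mulg1.
  by apply: sl2P; rewrite /sl2D !entriesE ?u1 ?e.
- have u1 : u = (-1)%R by apply: inv; rewrite e.
  exists true; rewrite {2}e mul1g expg1.
  by apply: sl2P; rewrite /sl2D /sl2N !entriesE ?u1 ?e.
- have u1 : u = (- gauss_i)%R by apply: inv; rewrite e.
  exists false; rewrite {2}e mulg1 expg1.
  by apply: sl2P; rewrite /sl2D /sl2U !entriesE ?u1 ?e.
- have {}e : v = (- gauss_i)%R := e; have u1 : u = gauss_i by apply: inv; rewrite e.
  exists true; rewrite {2}e !expg1.
  by apply: sl2P; rewrite /sl2D /sl2U /sl2N !entriesE ?u1 ?e; ring.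
Qed.

End DiagonalMatrices.

(** * Evaluating matrices by Euclid's algorithm *)

Section Presentation.
Import Order.TTheory GRing.Theory Num.Theory.
Variables (Gm : groupType) (tau : gaussInt -> Gm) (ups s : Gm).
Implicit Types (A B : sl2) (q u v x : gaussInt) (g : Gm).

(* The elements tau x, ups and s stand for the images of T_x, U and S. *)
Hypothesis tauD : forall x y, tau (x + y)%R = tau x * tau y.
Hypothesis ups2 : ups * ups = 1.
Hypothesis s2 : s * s = 1.
Hypothesis ups_s : ups * s = s * ups.
Hypothesis ups_tau : forall x, ups * tau x = tau (- x)%R * ups.
(* The image of the matrix identity S T_u S = T_-v S T_-u diag(u, v), with the
   diagonal matrix moved to the left of S. *)
Hypothesis braid : forall u v, u \in gauss_units -> (u * v = 1)%R ->
  s * tau u * s = tau (- v)%R * ups ^+ eps v * s * tau (- v)%R.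

(** A relation rather than a function: every quotient that makes the remainder
    smaller is allowed, so that the choice of quotients can be varied in proofs.
    The first clause uses that (a b; 0 d) = T_ab diag(a, d) when a d = 1. *)
Inductive euclid : sl2 -> Gm -> Prop :=
| euclid_base A : ec A = 0%R -> euclid A (tau (eb A * ea A)%R * ups ^+ eps (ea A))
| euclid_step A q g : (gsqnorm (ed A - ec A * q) < gsqnorm (ec A))%R ->
    euclid (A * sl2T (- q) * sl2S) g -> euclid A (g * s * tau q).

Lemma tau0 : tau 0%R = 1.
Proof. by apply: (@mulgI _ (tau 0%R)); rewrite -tauD addr0 mulg1. Qed.

Lemma tauN x : tau (- x)%R = (tau x)^-1.
Proof. by apply: (@mulgI _ (tau x)); rewrite -tauD subrr tau0 mulgV. Qed.

Lemma euclid_total A : exists g, euclid A g.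
Proof.
have [n le_n] : exists n : nat, (gsqnorm (ec A) < n%:Z)%R.
  exists (`|gsqnorm (ec A)|%N).+1; have := gsqnorm_ge0 (ec A); lia.
elim: n A le_n => [|n IH] A le_n; first by have := gsqnorm_ge0 (ec A); lia.
have [c0|c0] := eqVneq (ec A) 0%R; first by eexists; exact: euclid_base.
have [q hq] := gauss_division (ed A) c0.
have [|g hg] := IH (A * sl2T (- q) * sl2S).
  rewrite (_ : ec _ = (ed A - ec A * q)%R); first by lia.
  rewrite /sl2T !entriesE; ring.
by exists (g * s * tau q); apply: euclid_step.
Qed.

Lemma euclid_neg A g : euclid A g -> euclid (A * sl2N) g.
Proof.
elim=> {A g} [A c0|A q g hq _ IH].
  have h : ec (A * sl2N) = 0%R by rewrite !entriesE c0; ring.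
  have := euclid_base h.
  rewrite (_ : (eb (A * sl2N) * ea (A * sl2N))%R = (eb A * ea A)%R); last first.
    by rewrite !entriesE; ring.
  rewrite (_ : eps (ea (A * sl2N)) = eps (ea A)) //.
  rewrite (_ : ea (A * sl2N) = (- ea A)%R); last by rewrite !entriesE; ring.
  by rewrite /eps eqr_oppLR eqr_opp andbC.
apply: euclid_step.
  rewrite [X in (gsqnorm X < _)%R](_ : _ = - (ed A - ec A * q))%R; last by rewrite !entriesE; ring.
  by rewrite [X in (_ < gsqnorm X)%R](_ : _ = - ec A)%R ?gsqnormN // !entriesE; ring.
by rewrite (_ : _ * _ = A * sl2T (- q) * sl2S * sl2N) //; sl2_eq.
Qed.

Lemma euclid_T A x g : euclid A g -> euclid (A * sl2T x) (g * tau x).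
Proof.
case=> {A g} [A c0|A q g hq hg].
  have h : ec (A * sl2T x) = 0%R by rewrite /sl2T !entriesE c0; ring.
  have := euclid_base h.
  rewrite (_ : (eb (A * sl2T x) * ea (A * sl2T x) =
    eb A * ea A + x * (ea A * ea A))%R); last by rewrite /sl2T !entriesE; ring.
  rewrite (_ : ea (A * sl2T x) = ea A); last by rewrite /sl2T !entriesE; ring.
  rewrite tauD -!mulgA; congr (euclid _ (_ * _)).
  rewrite (eps_sqr (mul_eq1_gauss_units (det_ec0 c0))).
  case: (eps _); last by rewrite mulr1 mulg1 mul1g.
  by rewrite mulrN1 expg1 ups_tau.
rewrite -mulgA -tauD; apply: euclid_step.
  have -> : ec (A * sl2T x) = ec A by rewrite /sl2T !entriesE; ring.
  rewrite [X in (gsqnorm X < _)%R](_ : _ = ed A - ec A * q)%R //.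
  by rewrite /sl2T !entriesE; ring.
by rewrite (_ : _ * _ = A * sl2T (- q) * sl2S) //; sl2_eq.
Qed.

Lemma euclid_U A g : euclid A g -> euclid (A * sl2U) (g * ups).
Proof.
elim=> {A g} [A c0|A q g hq _ IH].
  have h : ec (A * sl2U) = 0%R by rewrite /sl2U !entriesE c0; ring.
  have := euclid_base h.
  rewrite (_ : (eb (A * sl2U) * ea (A * sl2U))%R = (eb A * ea A)%R); last first.
    by rewrite /sl2U !entriesE; ring: gauss_i2.
  rewrite (_ : ea (A * sl2U) = (ea A * gauss_i)%R); last by rewrite /sl2U !entriesE; ring.
  rewrite -mulgA; congr (euclid _ (_ * _)).
  by have /mul_eq1_gauss_units := det_ec0 c0; rewrite !inE => /or4P[] /eqP -> /=;
    rewrite ?mul1g ?ups2.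
have -> : g * s * tau q * ups = g * ups * s * tau (- q)%R.
  have e : tau q * ups = ups * tau (- q)%R by rewrite ups_tau opprK.
  by rewrite -mulgA e !mulgA -(mulgA g s ups) -ups_s mulgA.
apply: euclid_step.
  rewrite [X in (gsqnorm X < _)%R](_ : _ = (ed A - ec A * q) * - gauss_i)%R; last first.
    by rewrite /sl2U !entriesE; ring.
  rewrite [X in (_ < gsqnorm X)%R](_ : _ = ec A * gauss_i)%R; last by rewrite /sl2U !entriesE; ring.
  by rewrite !gsqnormM gsqnormN (_ : gsqnorm gauss_i = 1%R) // !mulr1.
rewrite (_ : _ * _ = A * sl2T (- q) * sl2S * sl2U * sl2N); first exact: euclid_neg.
sl2_eq.
Qed.

Lemma euclid_D A u v (uv : (u * v = 1)%R) g :
  euclid A g -> euclid (A * sl2D uv) (g * ups ^+ eps v).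
Proof.
move=> hg; have [b ->] := sl2D_cases uv; rewrite mulgA.
have {}hg : euclid (A * sl2U ^+ eps v) (g * ups ^+ eps v).
  by case: (eps v); rewrite ?expg1 ?expg0 ?mulg1 //; exact: euclid_U.
by case: b; rewrite ?expg1 ?expg0 ?mulg1 //; exact: euclid_neg.
Qed.

(** Uniqueness of the value for the matrices whose lower left entry has norm
    less than n; it is the induction hypothesis of [euclid_func]. *)
Definition functional_below (n : int) := forall A, (gsqnorm (ec A) < n)%R ->
  forall g g', euclid A g -> euclid A g' -> g = g'.

Lemma sl2_braid u v (uv : (u * v = 1)%R) :
  sl2S * sl2T v * sl2S = sl2T (- u) * sl2S * sl2T (- v) * sl2D uv.
Proof. by apply: sl2P; rewrite /sl2D /sl2T !entriesE; ring: uv. Qed.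

(** Comparing the norms of c and d: if they differ, one of A and A S is obtained
    from the other by a division with quotient 0.  If they are equal, dividing
    with a unit as quotient leads from A and from A S to matrices with smaller
    lower left entry, which the braid relation compares. *)
Lemma euclid_S n A g : functional_below n -> (gsqnorm (ec A) < n)%R ->
  euclid A g -> euclid (A * sl2S) (g * s).
Proof.
move=> fn cn hg.
have hc : ec (A * sl2S) = ed A by rewrite !entriesE; ring.
have hd : ed (A * sl2S) = (- ec A)%R by rewrite !entriesE; ring.
have [lt|lt|eqn] := ltgtP (gsqnorm (ec A)) (gsqnorm (ed A)).
- have -> : g * s = g * s * tau 0%R by rewrite tau0 mulg1.
  apply: euclid_step; first by rewrite hc hd mulr0 subr0 gsqnormN.
  rewrite (_ : _ * _ = A * sl2N); first exact: euclid_neg.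
  sl2_eq.
- have [g0 h0] := euclid_total (A * sl2S).
  have : euclid A (g0 * s * tau 0%R).
    apply: euclid_step; first by rewrite mulr0 subr0.
    by rewrite (_ : _ * _ = A * sl2S) //; sl2_eq.
  by rewrite tau0 mulg1 => /(fn _ cn _ _ hg) ->; rewrite -mulgA s2 mulg1.
- have c0 : ec A != 0%R.
    apply/eqP => c0; have d0 : ed A = 0%R.
      by apply/eqP; rewrite -gsqnorm_eq0 -eqn c0.
    by have := det_ec0 c0; rewrite d0 mulr0 => /esym/eqP; rewrite oner_eq0.
  have [u hu lt] := equal_norm_unit c0 eqn.
  have [v hv uv] := gauss_units_inv hu.
  have [g1 h1] := euclid_total (A * sl2T (- u) * sl2S).
  have h2 := euclid_step lt h1.
  rewrite (fn _ cn _ _ hg h2) -!mulgA [s * (_ * _)]mulgA (braid hu uv) !mulgA.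
  apply: euclid_step.
    rewrite hc hd -eqn.
    rewrite [X in (gsqnorm X < _)%R](_ : _ = (ed A - ec A * u) * v)%R; last by ring: uv.
    by rewrite gsqnormM (_ : gsqnorm v = 1%R) ?mulr1 //; move: hv; rewrite !inE => /or4P[] /eqP ->.
  have -> : A * sl2S * sl2T (- - v) * sl2S = A * sl2T (- u) * sl2S * sl2T (- v) * sl2D uv.
    by rewrite opprK -!mulgA; congr (_ * _); rewrite !mulgA; exact: sl2_braid.
  by apply: euclid_D; apply: euclid_T.
Qed.

(** Both words pass through matrices whose lower left entry is smaller than that
    of A, where the values are already unique; the braid relation compares them. *)
Lemma unit_step n A q u g1 g2 : functional_below n -> gsqnorm (ec A) = n -> u \in gauss_units ->
  (gsqnorm (ed A - ec A * q) < n)%R -> (gsqnorm (ed A - ec A * (q + u)) < n)%R ->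
  euclid (A * sl2T (- q) * sl2S) g1 -> euclid (A * sl2T (- (q + u)) * sl2S) g2 ->
  g1 * s * tau q = g2 * s * tau (q + u)%R.
Proof.
move=> fn cn hu lt1 lt2 h1 h2.
have [v hv uv] := gauss_units_inv hu.
have h3 : euclid (A * sl2T (- q) * sl2S * sl2T v * sl2S) (g1 * tau v * s).
  apply: (euclid_S fn); last exact: euclid_T.
  rewrite [X in (gsqnorm X < _)%R](_ : _ = ed A - ec A * q)%R //.
  by rewrite /sl2T !entriesE; ring.
have h4 : euclid (A * sl2T (- q) * sl2S * sl2T v * sl2S) (g2 * tau (- v)%R * ups ^+ eps v).
  rewrite (_ : _ * sl2T v * sl2S = A * sl2T (- (q + u)) * sl2S * sl2T (- v) * sl2D uv).
    by apply: euclid_D; apply: euclid_T.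
  have -> : sl2T (- (q + u)) = sl2T (- q) * sl2T (- u) by sl2_eq.
  by rewrite -!mulgA; congr (_ * (_ * _)); rewrite !mulgA; exact: sl2_braid.
have e : g1 * tau v * s = g2 * tau (- v)%R * ups ^+ eps v.
  apply: (fn _ _ _ _ h3 h4).
  rewrite [X in (gsqnorm X < _)%R](_ : _ = (ed A - ec A * (q + u)) * v)%R.
    by rewrite gsqnormM (_ : gsqnorm v = 1%R) ?mulr1 //; move: hv; rewrite !inE => /or4P[] /eqP ->.
  by rewrite /sl2T !entriesE; ring: uv.
have -> : g1 = g2 * tau (- v)%R * ups ^+ eps v * s * tau (- v)%R.
  by rewrite -e tauN -!mulgA [s * (s * _)]mulgA s2 mul1g mulgV mulg1.
have := braid hu uv; rewrite -!mulgA => b.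
rewrite addrC tauD; congr (_ * _).
have -> : s * (tau u * tau q) = s * (tau u * s) * (s * tau q).
  by rewrite -!mulgA [s * (s * _)]mulgA s2 mul1g.
by rewrite b -!mulgA.
Qed.

Lemma euclid_func n : functional_below (Posz n).
Proof.
elim: n => [|n IH] A lt g g' h h'; first by have := gsqnorm_ge0 (ec A); lia.
have [lt'|ge] := ltP (gsqnorm (ec A)) (Posz n); first exact: IH h h'.
have fn : functional_below (gsqnorm (ec A)).
  by move=> B ltB; apply: IH; lia.
case: h lt ge fn h' => {A g} [A c0|A q g hq hg] lt ge fn h'.
  case: h' c0 lt {ge fn} => {A g'} [A _ //|A q g hq hg] c0.
  by move: hq; rewrite c0 gsqnorm0 ltNge gsqnorm_ge0.
case: h' hq hg lt ge fn => {A g'} [A c0|A q' g' hq' hg'] hq hg lt ge fn.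
  by move: hq; rewrite c0 gsqnorm0 ltNge gsqnorm_ge0.
have := @quotients_differ (ec A) (ed A - ec A * q)%R (q' - q)%R hq.
rewrite (_ : (ed A - ec A * q - ec A * (q' - q) = ed A - ec A * q')%R); last by ring.
move=> /(_ hq') [/eqP|hu|[u [v [hu hv e lu]]]].
- rewrite subr_eq0 => /eqP e; subst q'; congr (_ * _ * _).
  apply: (fn _ _ _ _ hg hg').
  by rewrite [X in (gsqnorm X < _)%R](_ : _ = ed A - ec A * q)%R // /sl2T !entriesE; ring.
- have e : q' = (q + (q' - q))%R by ring.
  by rewrite e in hq' hg' *; apply: (@unit_step _ A) hg hg'; first exact: fn.
- have e' : q' = (q + u + v)%R by rewrite -addrA -e; ring.
  have lu' : (gsqnorm (ed A - ec A * (q + u)) < gsqnorm (ec A))%R.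
    by rewrite mulrDr opprD addrA.
  have [g3 h3] := euclid_total (A * sl2T (- (q + u)) * sl2S).
  subst q'; transitivity (g3 * s * tau (q + u)%R).
    exact: (unit_step fn).
  exact: (unit_step fn _ hv).
Qed.

Lemma euclid_uniq A g g' : euclid A g -> euclid A g' -> g = g'.
Proof.
by apply: (@euclid_func (`|gsqnorm (ec A)|%N).+1); have := gsqnorm_ge0 (ec A); lia.
Qed.

Lemma euclid_1 : euclid 1 1.
Proof.
have := @euclid_base 1; rewrite !entriesE mul0r tau0 mul1g => /(_ erefl).
by rewrite /eps eqxx.
Qed.

End Presentation.

(** * Generation by S, R, X and Y *)

Section Generation.
Import Order.TTheory GRing.Theory Num.Theory.
Implicit Types (A B : sl2) (q u v x : gaussInt).

Lemma sl2_generation (P : sl2 -> Prop) : P 1 ->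
  (forall A x, P A -> P (A * sl2T x)) -> (forall A, P A -> P (A * sl2S)) ->
  (forall A, P A -> P (A * sl2U)) -> (forall A, P A -> P (A * sl2N)) -> forall A, P A.
Proof.
move=> P1 PT PS PU PN A.
have [n le_n] : exists n : nat, (gsqnorm (ec A) < n%:Z)%R.
  exists (`|gsqnorm (ec A)|%N).+1; have := gsqnorm_ge0 (ec A); lia.
elim: n A le_n => [|n IH] A le_n; first by have := gsqnorm_ge0 (ec A); lia.
have [c0|c0] := eqVneq (ec A) 0%R.
  have da : (ed A * ea A = 1)%R by rewrite mulrC det_ec0.
  have -> : A = 1 * sl2T (eb A * ea A) * sl2D da.
    apply: sl2P; rewrite /sl2T /sl2D !entriesE ?c0; ring: da.
  have : P (1 * sl2T (eb A * ea A)) by apply: PT.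
  move: (_ * sl2T _) => B PB; have [b ->] := sl2D_cases da; rewrite mulgA.
  have {}PB : P (B * sl2U ^+ eps (ea A)).
    by case: (eps _); rewrite ?expg1 ?expg0 ?mulg1 //; exact: PU.
  by case: b; rewrite ?expg1 ?expg0 ?mulg1 //; exact: PN.
have [q hq] := gauss_division (ed A) c0.
have -> : A = A * sl2T (- q) * sl2S * sl2S * sl2N * sl2T q by sl2_eq.
apply: PT; apply: PN; apply: PS; apply: IH.
rewrite (_ : ec _ = (ed A - ec A * q)%R); first by lia.
rewrite /sl2T !entriesE; ring.
Qed.

Definition psl2_class := \pi_psl2%qT.

Lemma psl2_classM A B : psl2_class (A * B) = psl2_class A * psl2_class B.
Proof. exact: psl2_pi_mul. Qed.
Lemma psl2_class1 : psl2_class 1 = 1. Proof. by []. Qed.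

Lemma psl2_class_eqP A B : psl2_class A = psl2_class B <-> A = B \/ A = B * sl2N.
Proof.
have eN : val (B * sl2N) = (- val B)%R.
  rewrite sl2_valM (_ : val sl2N = (- 1%:M)%R); last by apply: mx2P; rewrite !mxE.
  by rewrite mulmxN mulmx1.
split=> [/eqmodP /orP[] /eqP e|e]; last (apply/eqmodP/orP; case: e => ->).
- by left; apply: val_inj.
- by right; apply: val_inj; rewrite eN.
- by left.
- by right; rewrite eN.
Qed.

Lemma psl2_classN : psl2_class sl2N = 1.
Proof. by apply/psl2_class_eqP; right; rewrite mul1g. Qed.

Lemma gaussMn (a b : int) n :
  (((a +i* b)%C : gaussInt) *+ n = ((a *+ n) +i* (b *+ n))%C)%R.
Proof. by elim: n => [|n IH] //; rewrite !mulrS IH. Qed.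

Local Notation S := (gen_elt genS).
Local Notation R := (gen_elt genR).
Local Notation X := (gen_elt genX).
Local Notation Y := (gen_elt genY).

Definition sl2g (s : picard_gen) : sl2 := sl2_mk (gen_mx_det s).

Lemma gen_class s : gen_elt s = psl2_class (sl2g s). Proof. by []. Qed.

Lemma sl2g_entries : ((ea (sl2g genR) = 0%R) * (eb (sl2g genR) = gauss_i) *
   (ec (sl2g genR) = gauss_i) * (ed (sl2g genR) = 0%R) *
  (ea (sl2g genX) = 1%R) * (eb (sl2g genX) = (-1)%R) *
   (ec (sl2g genX) = 1%R) * (ed (sl2g genX) = 0%R) *
  (ea (sl2g genY) = (-1)%R) * (eb (sl2g genY) = gauss_i) *
   (ec (sl2g genY) = gauss_i) * (ed (sl2g genY) = 0%R))%type.
Proof. by rewrite /ea /eb /ec /ed !mxE. Qed.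

Lemma gen_S : S = psl2_class sl2S. Proof. by []. Qed.
Lemma gen_R : R = psl2_class (sl2U * sl2S).
Proof.
apply/psl2_class_eqP; right.
apply: sl2P; rewrite -/(sl2g genR) /sl2U /sl2N !entriesE !sl2g_entries; ring.
Qed.
Lemma gen_X : X = psl2_class (sl2T 1 * sl2S).
Proof.
apply/psl2_class_eqP; left.
apply: sl2P; rewrite -/(sl2g genX) /sl2T !entriesE !sl2g_entries; ring.
Qed.
Lemma gen_Y : Y = psl2_class (sl2T gauss_i * sl2U * sl2S).
Proof.
apply/psl2_class_eqP; right.
by apply: sl2P; rewrite -/(sl2g genY) /sl2T /sl2U /sl2N !entriesE !sl2g_entries; ring: gauss_i2.
Qed.

Lemma psl2_class_SS : psl2_class sl2S * psl2_class sl2S = 1.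
Proof. by rewrite -psl2_classM; apply/psl2_class_eqP; right; sl2_eq. Qed.
Lemma psl2_class_T u v : psl2_class (sl2T (u + v)) = psl2_class (sl2T u) * psl2_class (sl2T v).
Proof. by rewrite -psl2_classM; congr (psl2_class _); sl2_eq. Qed.
Lemma psl2_class_TX : X * S = psl2_class (sl2T 1).
Proof. by rewrite gen_X psl2_classM gen_S -mulgA psl2_class_SS mulg1. Qed.
Lemma psl2_class_TY : Y * R = psl2_class (sl2T gauss_i).
Proof.
rewrite gen_Y gen_R -psl2_classM; apply/psl2_class_eqP; right.
by apply: sl2P; rewrite /sl2T /sl2U /sl2N !entriesE; ring: gauss_i2.
Qed.

(* A sign has to be guessed since elements of PSL_2 are matrices modulo sign. *)
Ltac psl2_class_eq := apply/psl2_class_eqP;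
  first [ by left; apply: sl2P; rewrite /sl2N !entriesE ?sl2g_entries; ring: gauss_i2
        | by right; apply: sl2P; rewrite /sl2N !entriesE ?sl2g_entries; ring: gauss_i2 ].

Lemma gen_XV : X^-1 = X * X.
Proof.
apply: mulg1_eq; rewrite !gen_class -!psl2_classM -psl2_class1; psl2_class_eq.
Qed.

Definition word_val (Gm : groupType) (f : picard_gen -> Gm) (w : picard_word) : Gm :=
  foldl (fun c l => c * (if l.2 then (f l.1)^-1 else f l.1)) 1 w.

Lemma psl2_relators w : w \in picard_relators -> word_val gen_elt w = 1.
Proof.
rewrite /picard_relators !inE => wr.
repeat (case/orP: wr => [/eqP -> /=|wr]); last move/eqP: wr => -> /=.
all: rewrite /word_val /= mul1g ?gen_XV !gen_class -!psl2_classM -psl2_class1; psl2_class_eq.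
Qed.

(** The generators have finite order, so their products form a group.  It contains
    U = R S and the translations X S^-1 and Y R^-1, hence everything, by Euclid's
    algorithm. *)
Lemma psl2_ind (P : psl2 -> Prop) : P 1 ->
  (forall g s, P g -> P (g * gen_elt s)) -> forall g, P g.
Proof.
move=> P1 Pgen.
pose Q h := forall g, P g -> P (g * h).
have Qgen s : Q (gen_elt s) by move=> g; apply: Pgen.
have QM h k : Q h -> Q k -> Q (h * k) by move=> qh qk g /qh/qk; rewrite mulgA.
have QS : Q (psl2_class sl2S) := Qgen genS.
have QU : Q (psl2_class sl2U).
  have -> : psl2_class sl2U = R * S by rewrite gen_R gen_S psl2_classM -mulgA psl2_class_SS mulg1.
  exact: QM.
have QT1 : Q (psl2_class (sl2T 1)) by rewrite -psl2_class_TX; apply: QM.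
have QTi : Q (psl2_class (sl2T gauss_i)) by rewrite -psl2_class_TY; apply: QM.
have QTN x : Q (psl2_class (sl2T x)) -> Q (psl2_class (sl2T (- x))).
  move=> qx; have -> : psl2_class (sl2T (- x)) =
      psl2_class sl2U * psl2_class (sl2T x) * psl2_class sl2U.
    rewrite -!psl2_classM; apply/psl2_class_eqP; right.
    by apply: sl2P; rewrite /sl2T /sl2U /sl2N !entriesE; ring: gauss_i2.
  by apply: (QM _ _ (QM _ _ QU qx)).

have QTD x y : Q (psl2_class (sl2T x)) -> Q (psl2_class (sl2T y)) -> Q (psl2_class (sl2T (x + y))).
  by move=> qx qy; rewrite psl2_class_T; apply: QM.
have QT0 : Q (psl2_class (sl2T 0)).
  by have := QTD _ _ QT1 (QTN _ QT1); rewrite subrr.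
have QTn x n : Q (psl2_class (sl2T x)) -> Q (psl2_class (sl2T (x *+ n))).
  by move=> qx; elim: n => [|n IH] //; rewrite mulrS; apply: QTD.
have QT x : Q (psl2_class (sl2T x)).
  case: x => a b.
  have -> : ((a +i* b)%C = (a +i* 0)%C + (0 +i* b)%C :> gaussInt)%R.
    by rewrite gaddE addr0 add0r.
  apply: QTD.
  - case: a => a.
      by have := QTn _ a QT1; rewrite gaussMn mul0rn -natz.
    by have := QTn _ a.+1 (QTN _ QT1); rewrite gaussMn mul0rn NegzE -natz mulNrn.
  - case: b => b.
      by have := QTn _ b QTi; rewrite gaussMn mul0rn -natz.
    by have := QTn _ b.+1 (QTN _ QTi); rewrite gaussMn mul0rn NegzE -natz mulNrn.
move=> g; rewrite -[g]reprK -/psl2_class; move: (repr g) => {g}.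
apply: sl2_generation => // [A x|A|A|A] PA; rewrite psl2_classM.
- exact: QT.
- exact: QS.
- exact: QU.
- by rewrite psl2_classN mulg1.
Qed.

End Generation.

(** * The presentation of the Picard group *)

Section IntegerPowers.
Import Order.TTheory GRing.Theory Num.Theory.
Variable Gm : groupType.
Implicit Types (g h : Gm) (z : int).

Definition zpow g z : Gm :=
  match z with Posz n => g ^+ n | Negz n => g^-1 ^+ n.+1 end.

Lemma zpowS g z : zpow g (1 + z)%R = g * zpow g z.
Proof.
case: z => [n|[|n]]; first by rewrite -PoszD add1n /= expgS.
- by rewrite /= expg1 mulgV.
- rewrite (_ : (1 + Negz n.+1)%R = Negz n); last by rewrite !NegzE; lia.
  by rewrite /= [g^-1 ^+ n.+2]expgS mulgA mulgV mul1g.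
Qed.

Lemma zpowP g z : zpow g (-1 + z)%R = g^-1 * zpow g z.
Proof.
by apply: (@mulgI _ g); rewrite -zpowS mulgA mulgV mul1g; congr (zpow g _); lia.
Qed.

Lemma zpowD g y z : zpow g (y + z)%R = zpow g y * zpow g z.
Proof.
elim: y => [|n IH|n IH].
- by rewrite add0r mul1g.
- by rewrite intS -addrA !zpowS IH mulgA.
- by rewrite intS opprD -addrA !zpowP IH mulgA.
Qed.

Lemma zpow_commute g h y z : commute g h -> commute (zpow g y) (zpow h z).
Proof.
move=> gh; have ghV : commute g h^-1 by apply: commuteV.
have gVh x : commute g x -> commute g^-1 x by move=> gx; apply/commute_sym/commuteV/commute_sym.
case: y => n; case: z => m; apply: commuteX2 => //; exact: gVh.
Qed.

Lemma zpow_dihedral g h z : h * g = g^-1 * h -> h * zpow g z = zpow g (- z)%R * h.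
Proof.
move=> hg; have hgV : h * g^-1 = g * h.
  by apply: (@mulgI _ g^-1); apply: (@mulIg _ g); rewrite !mulgA -hg mulgVK mulVg mul1g hg.
elim: z => [|n IH|n IH].
- by rewrite mul1g mulg1.
- by rewrite intS zpowS opprD zpowP mulgA hg -mulgA IH mulgA.
- by rewrite intS opprK zpowS opprD zpowP mulgA hgV -mulgA IH opprK mulgA.
Qed.

End IntegerPowers.

Section PicardPresentation.
Import Order.TTheory GRing.Theory Num.Theory.
Variable Gm : groupType.

(** The value of Euclid's algorithm is multiplicative because it is compatible
    with right multiplication by the generators T, U, S and by -1. *)
Lemma sl2_lift (tau : gaussInt -> Gm) (ups s : Gm) :
    (forall x y, tau (x + y)%R = tau x * tau y) ->
    ups * ups = 1 -> s * s = 1 -> ups * s = s * ups ->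
    (forall x, ups * tau x = tau (- x)%R * ups) ->
    (forall u v, u \in gauss_units -> (u * v = 1)%R ->
       s * tau u * s = tau (- v)%R * ups ^+ eps v * s * tau (- v)%R) ->
  exists phi : psl2 -> Gm, [/\ forall g h, phi (g * h) = phi g * phi h,
    forall x, phi (psl2_class (sl2T x)) = tau x, phi (psl2_class sl2U) = ups
    & phi (psl2_class sl2S) = s].
Proof.
move=> tauD ups2 s2 us ut br.
have uniq := euclid_uniq tauD ups2 s2 us ut br.
have hT := euclid_T tauD ut; have hU := euclid_U ups2 us ut.
have fn n : functional_below tau ups s n by move=> A _; exact: uniq.
have hS A g : euclid tau ups s A g -> euclid tau ups s (A * sl2S) (g * s).
  by apply: (euclid_S tauD ups2 s2 us ut br (fn (gsqnorm (ec A) + 1)%R)); lia.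
have h1 := euclid_1 ups s tauD.
have [psi hpsi] := choice (euclid_total tau ups s).
have psiM A B : psi (A * B) = psi A * psi B.
  apply: (uniq _ _ _ (hpsi _)); move: B; apply: sl2_generation => [|B x IH|B IH|B IH|B IH].
  - by rewrite (uniq _ _ _ (hpsi 1) h1) !mulg1.
  - by rewrite (uniq _ _ _ (hpsi _) (hT s _ x _ (hpsi B))) !mulgA; apply: hT.
  - by rewrite (uniq _ _ _ (hpsi _) (hS _ _ (hpsi B))) !mulgA; apply: hS.
  - by rewrite (uniq _ _ _ (hpsi _) (hU _ _ (hpsi B))) !mulgA; apply: hU.
  - by rewrite (uniq _ _ _ (hpsi _) (euclid_neg (hpsi B))) !mulgA; apply: euclid_neg.
have psiN A : psi (A * sl2N) = psi A by apply: (uniq _ _ _ (hpsi _)); exact: euclid_neg.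
have psi_pi A : psi (repr (psl2_class A)) = psi A.
  have /psl2_class_eqP[->|->] // : psl2_class (repr (psl2_class A)) = psl2_class A.
  by rewrite /psl2_class reprK.
exists (fun g => psi (repr g)); split=> [g h|x||].
- by rewrite -psiM -[g in LHS]reprK -[h in LHS]reprK -/psl2_class -psl2_classM psi_pi.
- by rewrite psi_pi; apply: (uniq _ _ _ (hpsi _)); have := hT s _ x _ h1; rewrite !mul1g.
- by rewrite psi_pi; apply: (uniq _ _ _ (hpsi _)); have := hU _ _ h1; rewrite !mul1g.
- by rewrite psi_pi; apply: (uniq _ _ _ (hpsi _)); have := hS _ _ h1; rewrite !mul1g.
Qed.

Theorem picard_presentation (f : picard_gen -> Gm) :
    (forall w, w \in picard_relators -> word_val f w = 1) ->
  exists phi : psl2 -> Gm,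
    (forall g h, phi (g * h) = phi g * phi h) /\ forall a, phi (gen_elt a) = f a.
Proof.
move=> rel.
set s := f genS; set r := f genR; set x := f genX; set y := f genY.
have rel' k : k < 8 -> word_val f (nth [::] picard_relators k) = 1.
  by move=> k8; apply/rel/mem_nth.
have s2 : s * s = 1 by have := rel' 0%N isT; rewrite /word_val /= mul1g.
have r2 : r * r = 1 by have := rel' 1%N isT; rewrite /word_val /= mul1g.
have rs : r * s * r * s = 1 by have := rel' 2%N isT; rewrite /word_val /= mul1g.
have x3 : x * x * x = 1 by have := rel' 3%N isT; rewrite /word_val /= mul1g.
have rx : r * x * r * x = 1 by have := rel' 4%N isT; rewrite /word_val /= mul1g.
have y3 : y * y * y = 1 by have := rel' 5%N isT; rewrite /word_val /= mul1g.
have xy : x^-1 * y * x^-1 * y = 1 by have := rel' 6%N isT; rewrite /word_val /= mul1g.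
have sy : s * y * s * y = 1 by have := rel' 7%N isT; rewrite /word_val /= mul1g.
have sV : s^-1 = s := mulg1_eq s2.
have rV : r^-1 = r := mulg1_eq r2.
have xx : x * x = x^-1 by rewrite -[LHS]invgK (mulg1_eq x3).
have yy : y * y = y^-1 by rewrite -[LHS]invgK (mulg1_eq y3).
have inv2 (a b : Gm) : a * b * a * b = 1 -> a * b = b^-1 * a^-1.
  by rewrite -mulgA => /mulg1_eq <-; rewrite invgM.
have {}rs : s * r = r * s by rewrite (inv2 _ _ rs) sV rV.
have {}rx : r * x = x^-1 * r by rewrite (inv2 _ _ rx) rV.
have {}sy : s * y = y^-1 * s by rewrite (inv2 _ _ sy) sV.
have {}xy : x^-1 * y = y^-1 * x by rewrite (inv2 _ _ xy) invgK.
have rxV : r * x^-1 = x * r.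
  by apply: (@mulgI _ x^-1); apply: (@mulIg _ x); rewrite !mulgA -rx mulgVK mulVg mul1g rx.
have syV : s * y^-1 = y * s.
  by apply: (@mulgI _ y^-1); apply: (@mulIg _ y); rewrite !mulgA -sy mulgVK mulVg mul1g sy.
have xyV : y * x^-1 = x * y^-1.
  by apply: (@mulgI _ x^-1); apply: (@mulIg _ x); rewrite !mulgA xy mulVg mul1g mulgVK.
(* Extended rewriting rules, for products associated to the right. *)
have ext (a b c d : Gm) : a * b = c * d -> forall z, a * (b * z) = c * (d * z).
  by move=> e z; rewrite !mulgA e.
have ext1 (a b : Gm) : a * b = 1 -> forall z, a * (b * z) = z.
  by move=> e z; rewrite mulgA e mul1g.
have s2' := ext1 _ _ s2; have r2' := ext1 _ _ r2; have rs' := ext _ _ _ _ rs.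
have rx' := ext _ _ _ _ rx; have rxV' := ext _ _ _ _ rxV.
have sy' := ext _ _ _ _ sy; have syV' := ext _ _ _ _ syV.
(* T_1 = X S and T_i = Y R because S and R are involutions. *)
pose tau (c : gaussInt) := zpow (x * s) (complex.Re c) * zpow (y * r) (complex.Im c).
have comm : commute (x * s) (y * r).
  by rewrite /commute -!mulgA sy' rx' rs !mulgA xyV.
pose ups := r * s.
have e2 : ups * ups = 1 by rewrite /ups -!mulgA rs' s2 mulg1 r2.
have us : ups * s = s * ups by rewrite /ups mulgA rs.
have ux : ups * (x * s) = (x * s)^-1 * ups.
  by rewrite /ups invgM sV -!mulgA -rs' rx'.
have uy : ups * (y * r) = (y * r)^-1 * ups.
  by rewrite /ups invgM rV -!mulgA sy' rs.
have [||||||phi [phiM phiT phiU phiS]] := @sl2_lift tau ups s.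
- move=> [a b] [a' b']; rewrite gaddE /tau /= !zpowD -!mulgA; congr (_ * _).
  by rewrite !mulgA; congr (_ * _); apply: zpow_commute.
- exact: e2.
- exact: s2.
- exact: us.
- move=> [a b]; rewrite goppE /tau /= mulgA (zpow_dihedral _ ux) -mulgA.
  by rewrite (zpow_dihedral _ uy) mulgA.
- move=> u v hu uv; have vE w : (u * w = 1)%R -> v = w.
    by move=> uw; rewrite -[v]mul1r -uw [(u * _)%R]mulrC -mulrA uv mulr1.
  have xVxV : x^-1 * x^-1 = x by rewrite -invgM xx invgK.
  have yVyV : y^-1 * y^-1 = y by rewrite -invgM yy invgK.
  have t1 : tau 1%R = x * s by exact: mulg1.
  have tN1 : tau (-1)%R = s * x^-1 by rewrite -[s in RHS]sV -invgM; exact: mulg1.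
  have ti : tau gauss_i = y * r by exact: mul1g.
  have tNi : tau (- gauss_i)%R = r * y^-1 by rewrite -[r in RHS]rV -invgM; exact: mul1g.
  move: hu; rewrite !inE => /or4P[] /eqP e.
  + have {}e : u = 1%R := e.
    rewrite (vE 1%R) ?e ?mulr1 // t1 tN1 mulg1 -!mulgA s2 mulg1 s2'.
    by rewrite xVxV.
  + have {}e : u = (-1)%R := e.
    rewrite (vE (-1)%R) ?e // opprK t1 tN1 mulg1 -!mulgA s2' s2'.
    by rewrite mulgA xx.
  + have {}e : u = gauss_i := e.
    rewrite (vE (- gauss_i)%R) ?e // opprK ti expg1 /ups -!mulgA r2' s2'.
    by rewrite sy' rs' s2 mulg1 mulgA yy.
  + have {}e : u = (- gauss_i)%R := e.
    rewrite (vE gauss_i) ?e // tNi expg1 /ups -!mulgA s2' r2' yVyV.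
    by rewrite rs' syV' s2 mulg1.
exists phi; split=> //; case.
- by rewrite gen_S.
- by rewrite gen_R psl2_classM phiM phiU phiS -mulgA s2 mulg1.
- by rewrite gen_X psl2_classM phiM phiT phiS (mulg1 (x * s) : tau 1%R = _) -mulgA s2 mulg1.
- rewrite gen_Y !psl2_classM !phiM phiT phiU phiS (mul1g (y * r) : tau gauss_i = _).
  by rewrite /ups -!mulgA s2 mulg1 r2 mulg1.
Qed.

End PicardPresentation.

(** * The action on the upper half-space *)

Section HalfSpace.
Import Order.TTheory GRing.Theory Num.Theory.
Local Open Scope ring_scope.
Local Open Scope complex_scope.
Variable R : realType.
Implicit Types (p : Defs.point R) (h : hplane R).

(** The homogeneous form of [ideal_side]: the value at the cusp z = p/q, up to the
    positive factor |q|^2, is that of the Hermitian form of the plane at (p, q). *)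
Definition herm_form h (u : (R[i] * R[i])%type) : R :=
  hp_a h * sqnorm u.1 + 2 * complex.Re (conjc (hp_b h) * (u.1 * conjc u.2))
  + hp_c h * sqnorm u.2.

Section Mobius.
Variables a b c d : R[i].

Definition mob_den p : R := sqnorm (c * p.1 + d) + sqnorm c * p.2 ^+ 2.
Definition mob_num p : R[i] :=
  (a * p.1 + b) * conjc (c * p.1 + d) + a * conjc c * (p.2 ^+ 2)%:C.
Definition mob p : Defs.point R := (mob_num p / (mob_den p)%:C, p.2 / mob_den p).

(** The Hermitian form composed with the linear map with matrix (a b; c d). *)
Definition pullback h : hplane R :=
  HPlane (herm_form h (a, c))
    ((hp_a h)%:C * conjc a * b + hp_b h * conjc a * d
     + conjc (hp_b h) * b * conjc c + (hp_c h)%:C * conjc c * d)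
    (herm_form h (b, d)).

Definition mob_vec (u : (R[i] * R[i])%type) := (a * u.1 + b * u.2, c * u.1 + d * u.2).

Hypothesis det1 : a * d - b * c = 1.

Lemma mob_den_gt0 p : 0 < p.2 -> 0 < mob_den p.
Proof.
move=> p0; have sq0 (z : R[i]) : 0 <= sqnorm z by rewrite addr_ge0 ?sqr_ge0.
have sq_eq0 (z : R[i]) : sqnorm z = 0 -> z = 0.
  case: z => x y /eqP; rewrite /sqnorm /= paddr_eq0 ?sqr_ge0 // !sqrf_eq0.
  by move=> /andP[/eqP -> /eqP ->].
have p2 : 0 < p.2 ^+ 2 by rewrite exprn_gt0.
have m0 : 0 <= sqnorm c * p.2 ^+ 2 by rewrite mulr_ge0 // ltW.
rewrite /mob_den lt_def addr_ge0 // andbT paddr_eq0 // mulf_eq0 (gt_eqF p2) orbF.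
apply/negP => /andP[/eqP/sq_eq0 e1 /eqP/sq_eq0 e2].
move: e1 det1; rewrite e2 mul0r add0r => ->.
by rewrite !mulr0 subr0 => /eqP; rewrite eq_sym oner_eq0.
Qed.

Lemma divc_real (z : R[i]) (n : R) :
  z / n%:C = (complex.Re z / n) +i* (complex.Im z / n).
Proof.
rewrite -fmorphV; case: z => x y.
by apply/eqP; rewrite eq_complex /= !mulr0 subr0 add0r !eqxx.
Qed.

(** Up to the positive factor [mob_den], the equation of a plane is the Hermitian
    form evaluated at a positive Hermitian matrix attached to the point, on which
    the group acts linearly. *)
Lemma mob_side h p : 0 < p.2 -> side h (mob p) * mob_den p = side (pullback h) p.
Proof.
move=> p0; have n0 := mob_den_gt0 p0.
have top : sqnorm (mob_num p) + p.2 ^+ 2 =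
    (sqnorm (a * p.1 + b) + sqnorm a * p.2 ^+ 2) * mob_den p.
  have s1 : sqnorm (a * d - b * c) = 1.
    by rewrite det1 /sqnorm /= expr0n /= expr1n addr0.
  rewrite -[p.2 ^+ 2 in LHS]mulr1 -s1.
  rewrite /mob_num /mob_den /sqnorm; case: p {p0 n0} => [[z1 z2] t].
  case: (a) (b) (c) (d) => [a1 a2] [b1 b2] [c1 c2] [d1 d2] /=; ring.
have -> : side h (mob p) * mob_den p =
    hp_a h * (sqnorm (a * p.1 + b) + sqnorm a * p.2 ^+ 2)
    + 2 * complex.Re (conjc (hp_b h) * mob_num p) + hp_c h * mob_den p.
  rewrite /side /mob divc_real /=.
  have -> : sqnorm ((complex.Re (mob_num p) / mob_den p) +i* (complex.Im (mob_num p) / mob_den p))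
     + (p.2 / mob_den p) ^+ 2 = (sqnorm (mob_num p) + p.2 ^+ 2) / mob_den p ^+ 2.
    by rewrite /sqnorm /=; field; rewrite gt_eqF.
  rewrite top; case: (hp_b h) (mob_num p) => [h1 h2] [m1 m2] /=; field; by rewrite gt_eqF.
rewrite /side /pullback /herm_form /mob_num /mob_den /sqnorm.
case: p {p0 n0 top} => [[z1 z2] t].
case: (a) (b) (c) (d) (hp_b h) => [a1 a2] [b1 b2] [c1 c2] [d1 d2] [h1 h2] /=; ring.
Qed.

Lemma herm_form_pullback h u : herm_form (pullback h) u = herm_form h (mob_vec u).
Proof.
rewrite /pullback /herm_form /mob_vec /sqnorm.
case: u => [[u1 u2] [v1 v2]].
case: (a) (b) (c) (d) (hp_b h) => [a1 a2] [b1 b2] [c1 c2] [d1 d2] [h1 h2] /=; ring.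
Qed.

Lemma nondeg_pullback h : Defs.nondegenerate h -> Defs.nondegenerate (pullback h).
Proof.
rewrite /Defs.nondegenerate => nd; rewrite -subr_gt0.
suff -> : sqnorm (hp_b (pullback h)) - hp_a (pullback h) * hp_c (pullback h) =
  (sqnorm (hp_b h) - hp_a h * hp_c h) * sqnorm (a * d - b * c).
  by rewrite det1 [sqnorm 1]/sqnorm /= expr0n /= expr1n addr0 mulr1 subr_gt0.
rewrite /pullback /herm_form /sqnorm.
case: (a) (b) (c) (d) (hp_b h) => [a1 a2] [b1 b2] [c1 c2] [d1 d2] [h1 h2] /=; ring.
Qed.

Lemma mob_gt0 p : 0 < p.2 -> 0 < (mob p).2.
Proof. by move=> p0; rewrite divr_gt0 // mob_den_gt0. Qed.

End Mobius.

(** The values of [side] recover z and |z|^2 + t^2, hence the point. *)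
Lemma side_inj p q : 0 < p.2 -> 0 < q.2 -> (forall h, side h p = side h q) -> p = q.
Proof.
case: p q => [[x y] t] [[x' y'] t'] /= t0 t0' e.
have e1 : x = x'.
  have := e (HPlane 0 (2^-1 +i* 0) 0); rewrite /side /= !mul0r oppr0 !mul0r subr0.
  by rewrite !add0r !addr0 subr0 !mulrA divff ?pnatr_eq0 // !mul1r.
have e2 : y = y'.
  have := e (HPlane 0 (0 +i* 2^-1) 0); rewrite /side /= !mul0r.
  by rewrite !add0r !addr0 !mulNr !opprK !mulrA divff ?pnatr_eq0 // !mul1r.
subst x' y'; congr (_, _).
have := e (HPlane 1 0 0); rewrite /side /= !mul0r !mul1r !oppr0 !mul0r subr0 mulr0 !addr0.
move=> /addrI /eqP; rewrite -subr_eq0 subr_sqr mulf_eq0 subr_eq0.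
by case/orP => [/eqP //|]; rewrite gt_eqF // addr_gt0.
Qed.

Lemma pullbackM (a b c d a' b' c' d' : R[i]) h :
  pullback a' b' c' d' (pullback a b c d h) =
  pullback (a * a' + b * c') (a * b' + b * d') (c * a' + d * c') (c * b' + d * d') h.
Proof.
rewrite /pullback.
congr HPlane; rewrite ?/herm_form ?/sqnorm /=.
all: case: a b c d (hp_b h) => [a1 a2] [b1 b2] [c1 c2] [d1 d2] [h1 h2];
  case: a' b' c' d' => [a1' a2'] [b1' b2'] [c1' c2'] [d1' d2'] /=.
- ring.
- apply/eqP; rewrite eq_complex /=; apply/andP; split; apply/eqP; ring.
- ring.
Qed.

(** Both sides have the same equations, because pulling planes back is functorial. *)
Lemma mobM (a b c d a' b' c' d' : R[i]) p : a * d - b * c = 1 -> a' * d' - b' * c' = 1 ->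
  0 < p.2 -> mob a b c d (mob a' b' c' d' p) =
  mob (a * a' + b * c') (a * b' + b * d') (c * a' + d * c') (c * b' + d * d') p.
Proof.
move=> det det' p0.
have det2 : (a * a' + b * c') * (c * b' + d * d') - (a * b' + b * d') * (c * a' + d * c') = 1.
  have <- : (a * d - b * c) * (a' * d' - b' * c') = 1 by rewrite det det' mulr1.
  by ring.
have q0 := mob_gt0 det' p0.
have n1 := mob_den_gt0 det q0; have n2 := mob_den_gt0 det' p0; have n3 := mob_den_gt0 det2 p0.
have key h : side h (mob a b c d (mob a' b' c' d' p)) *
    (mob_den c d (mob a' b' c' d' p) * mob_den c' d' p) =
  side h (mob (a * a' + b * c') (a * b' + b * d') (c * a' + d * c') (c * b' + d * d') p) *
    mob_den (c * a' + d * c') (c * b' + d * d') p.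
  by rewrite mulrA mob_side // mob_side // pullbackM mob_side.
apply: side_inj; [exact: mob_gt0|exact: mob_gt0|] => h.
have side1 q : side (HPlane 0 0 1) q = 1 :> R.
  by case: q => [[x y] t]; rewrite /side /=; ring.
have := key (HPlane 0 0 1); rewrite !side1 !mul1r.
by move=> e; have := key h; rewrite e; apply: mulIf; rewrite gt_eqF.
Qed.

End HalfSpace.

(** * Convex hulls of cusps *)

Section IdealPolyhedra.
Import Order.TTheory GRing.Theory Num.Theory.
Local Open Scope ring_scope.
Local Open Scope complex_scope.
Variable R : realType.
Local Notation pt := (Defs.point R).
Implicit Types (p : pt) (h : hplane R) (A B : sl2).

(** A cusp p/q is represented by a vector (p, q), on which matrices act linearly,
    rather than by a point of the boundary sphere. *)
Definition gvec : Type := (gaussInt * gaussInt)%type.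
Implicit Types (u v : gvec) (U V : seq gvec).

Local Notation gC := (@gauss_C R).

Lemma gauss_CD (x y : gaussInt) : gC (x + y) = gC x + gC y.
Proof.
case: x y => [a b] [a' b']; rewrite gaddE /gauss_C.
by apply/eqP; rewrite eq_complex /= !rmorphD !eqxx.
Qed.

Lemma gauss_CM (x y : gaussInt) : gC (x * y) = gC x * gC y.
Proof.
case: x y => [a b] [a' b']; rewrite gmulE /gauss_C.
by apply/eqP; rewrite eq_complex /= rmorphB rmorphD !rmorphM !eqxx.
Qed.

Lemma gauss_CN (x : gaussInt) : gC (- x) = - gC x.
Proof.
case: x => [a b]; rewrite goppE /gauss_C.
by apply/eqP; rewrite eq_complex /= !rmorphN !eqxx.
Qed.

Lemma gauss_C1 : gC 1 = 1. Proof. by []. Qed.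

Definition gvecC u : (R[i] * R[i])%type := (gC u.1, gC u.2).

Definition act_gvec A u : gvec :=
  (ea A * u.1 + eb A * u.2, ec A * u.1 + ed A * u.2).

Lemma act_gvecM A B u : act_gvec (A * B)%g u = act_gvec A (act_gvec B u).
Proof. by rewrite /act_gvec !entriesE /=; congr (_, _); ring. Qed.

Lemma act_gvec1 u : act_gvec 1%g u = u.
Proof. by case: u => x y; rewrite /act_gvec !entriesE /=; congr (_, _); ring. Qed.

Lemma detC A : gC (ea A) * gC (ed A) - gC (eb A) * gC (ec A) = 1.
Proof. by rewrite -!gauss_CM -gauss_CN -gauss_CD sl2_detE. Qed.

Definition mob_sl2 A p := mob (gC (ea A)) (gC (eb A)) (gC (ec A)) (gC (ed A)) p.

Lemma hact_class A p : hact (psl2_class A) p = mob_sl2 A p.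
Proof. by rewrite /psl2_class hact_pi; case: p. Qed.

Lemma mob_sl2M A B p : 0 < p.2 -> mob_sl2 (A * B)%g p = mob_sl2 A (mob_sl2 B p).
Proof.
move=> p0; rewrite /mob_sl2 mobM ?detC // !entriesE !gauss_CD !gauss_CM //.
Qed.

Lemma mob_sl2_1 p : 0 < p.2 -> mob_sl2 1%g p = p.
Proof.
rewrite /mob_sl2 !entriesE /mob /mob_num /mob_den => _.
have -> : gC 0 = 0 by [].
rewrite !gauss_C1; case: p => [[x y] t] /=.
have -> : sqnorm (0 * (x +i* y) + 1) + sqnorm 0 * t ^+ 2 = 1 :> R by rewrite /sqnorm /=; ring.
rewrite !divr1; congr (_, _).
by apply/eqP; rewrite eq_complex /=; apply/andP; split; apply/eqP; ring.
Qed.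

Lemma mob_sl2_gt0 A p : 0 < p.2 -> 0 < (mob_sl2 A p).2.
Proof. by apply: mob_gt0; exact: detC. Qed.

Definition pullback_sl2 A h := pullback (gC (ea A)) (gC (eb A)) (gC (ec A)) (gC (ed A)) h.

Definition gauss_form h u := herm_form h (gvecC u).

Lemma gauss_form_pullback A h u : gauss_form (pullback_sl2 A h) u = gauss_form h (act_gvec A u).
Proof.
by rewrite /gauss_form herm_form_pullback /mob_vec /gvecC /act_gvec /= !gauss_CD !gauss_CM.
Qed.

Lemma side_mob_sl2_le0 A h p : 0 < p.2 ->
  (side h (mob_sl2 A p) <= 0) = (side (pullback_sl2 A h) p <= 0).
Proof.
move=> p0; rewrite -mob_side //; last exact: detC.
by rewrite pmulr_lle0 // (mob_den_gt0 (detC A)).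
Qed.

(** The set [hull] in terms of representatives of the cusps, see [hull_ideal]. *)
Definition hullG U : set pt := [set p | 0 < p.2 /\ forall h, Defs.nondegenerate h ->
   (forall u, u \in U -> gauss_form h u <= 0) -> side h p <= 0].

Lemma hullG_gt0 U p : hullG U p -> 0 < p.2. Proof. by case. Qed.

Lemma hact_hullG A U p : hullG U p -> hullG (map (act_gvec A) U) (mob_sl2 A p).
Proof.
move=> [p0 hp]; split; first exact: mob_sl2_gt0.
move=> h nd hU; rewrite side_mob_sl2_le0 //; apply: hp.
  exact: (nondeg_pullback (detC A)).
by move=> u uU; rewrite gauss_form_pullback hU // map_f.
Qed.

Lemma translate_hullG A U : translate (psl2_class A) (hullG U) = hullG (map (act_gvec A) U).
Proof.
apply/seteqP; split => [_ [p hp <-]|q hq] /=; first by rewrite hact_class; exact: hact_hullG.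
exists (mob_sl2 A^-1%g q); last first.
  have q0 := hullG_gt0 hq.
  by rewrite hact_class -mob_sl2M // mulgV mob_sl2_1.
have := hact_hullG A^-1%g hq; rewrite -map_comp (eq_map (g := id)) ?map_id //.
by move=> u; rewrite /= -act_gvecM mulVg act_gvec1.
Qed.

Definition gassoc u v : bool :=
  has (fun e => (u.1 == e * v.1) && (u.2 == e * v.2)) gauss_units.

Lemma gauss_form_assoc h u v : gassoc u v -> gauss_form h u = gauss_form h v.
Proof.
case/hasP => e he /andP[/eqP e1 /eqP e2].
have ee : sqnorm (gC e) = 1.
  by move: he; rewrite !inE => /or4P[] /eqP ->; rewrite /sqnorm /gauss_C /=
     ?mulrNz ?mulr1z ?mulr0z ?sqrrN ?expr0n ?expr1n /= ?addr0 ?add0r.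
rewrite /gauss_form /gvecC e1 e2 !gauss_CM -[RHS]mul1r -ee /herm_form /sqnorm.
move: (gC v.1) (gC v.2) (gC e) (hp_b h) => [x1 x2] [y1 y2] [z1 z2] [b1 b2] /=; ring.
Qed.

Definition assoc_subset U V : bool := all (fun u => has (gassoc u) V) U.

Lemma assoc_subset_hull U V : assoc_subset U V -> hullG U `<=` hullG V.
Proof.
move=> /allP sUV p [p0 hp]; split=> // h nd hV; apply: hp => // u uU.
by have /hasP[v vV /gauss_form_assoc ->] := sUV _ uU; exact: hV.
Qed.

Lemma hullG_eq U V : assoc_subset U V && assoc_subset V U -> hullG U = hullG V.
Proof. by case/andP => s1 s2; apply/seteqP; split; exact: assoc_subset_hull. Qed.

Definition ideal u : ideal_point R := if u.2 == 0 then None else Some (gC u.1 / gC u.2).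

Definition nonzero_gvec u := (u.1 != 0) || (u.2 != 0).

Lemma gauss_C_eq0 x : (gC x == 0) = (x == 0).
Proof. by case: x => a b; rewrite /gauss_C !eq_complex /= !intr_eq0. Qed.

Lemma sqnorm_gt0 (z : R[i]) : z != 0 -> 0 < sqnorm z.
Proof.
case: z => x y; rewrite eq_complex /= negb_and => xy.
rewrite /sqnorm /= lt_def addr_ge0 ?sqr_ge0 // andbT.
by rewrite paddr_eq0 ?sqr_ge0 // !sqrf_eq0 negb_and.
Qed.

Lemma gauss_form_ideal h u : u.2 != 0 ->
  gauss_form h u = ideal_side h (Some (gC u.1 / gC u.2)) * sqnorm (gC u.2).
Proof.
move=> u2; have q0 : gC u.2 != 0 by rewrite gauss_C_eq0.
have key (z q : R[i]) : herm_form h (z * q, q) = ideal_side h (Some z) * sqnorm q.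
  rewrite /herm_form /ideal_side /sqnorm.
  by case: z q (hp_b h) => [z1 z2] [q1 q2] [b1 b2] /=; ring.
by rewrite -key divfK.
Qed.

Lemma gauss_form_inf h u : u.2 = 0 -> gauss_form h u = hp_a h * sqnorm (gC u.1).
Proof.
rewrite /gauss_form /gvecC => ->; have -> : gC 0 = 0 by [].
by rewrite /herm_form /sqnorm; case: (gC u.1) (hp_b h) => [x1 x2] [b1 b2] /=; ring.
Qed.

Lemma ideal_side_le0 h u : nonzero_gvec u -> (ideal_side h (ideal u) <= 0) = (gauss_form h u <= 0).
Proof.
rewrite /nonzero_gvec /ideal; have [u2|u2] := eqVneq u.2 0; last first.
  by rewrite gauss_form_ideal // pmulr_lle0 // sqnorm_gt0 // gauss_C_eq0.
by rewrite orbF => u1; rewrite gauss_form_inf // pmulr_lle0 // sqnorm_gt0 // gauss_C_eq0.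
Qed.

Lemma hull_ideal U : all nonzero_gvec U -> hull [set ideal u | u in [set` U]] = hullG U.
Proof.
move=> /allP nzU; apply/seteqP; split => p [p0 hp]; split=> // h nd hU; apply: hp => //.
- by move=> _ [u uU <-]; rewrite ideal_side_le0 ?hU ?nzU.
- by move=> u uU; rewrite -ideal_side_le0 ?nzU //; apply: hU; exists u.
Qed.

Lemma quadratic_le0 (a c : R) : (forall t, 0 < t -> a * t ^+ 2 + c <= 0) -> a <= 0 /\ c <= 0.
Proof.
move=> h; split; rewrite leNgt; apply/negP => x0.
- have t1 : 1 <= 1 + `|c| / a by rewrite lerDl divr_ge0 // ltW.
  have := h _ (lt_le_trans ltr01 t1); apply/negP; rewrite -ltNge.
  have e : a * (1 + `|c| / a) = a + `|c| by rewrite mulrDr mulr1 mulrCA divff ?mulr1 // gt_eqF.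
  have c1 : - c <= `|c| by rewrite -normrN ler_norm.
  have : a * (1 + `|c| / a) <= a * (1 + `|c| / a) ^+ 2 by rewrite ler_pM2l // ler_eXnr.
  by rewrite e; lra.
- have b0 : 0 < 1 + `|a| by rewrite ltr_pwDl.
  (* For this t the left side is c (1 + |a| + a) / (1 + |a|). *)
  pose t := Num.sqrt (c / (1 + `|a|)); have t0 : 0 < t by rewrite sqrtr_gt0 divr_gt0.
  have := h _ t0; apply/negP; rewrite -ltNge sqr_sqrtr ?divr_ge0 ?ltW //.
  have -> : a * (c / (1 + `|a|)) + c = c * (1 + `|a| + a) / (1 + `|a|).
    by field; rewrite gt_eqF.
  rewrite divr_gt0 // mulr_gt0 //.
  have : - a <= `|a| by rewrite -normrN ler_norm.
  lra.
Qed.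

(** The vertical geodesic over a finite vertex lies in any hull that also has
    the vertex at infinity, so a half-space containing the hull contains both
    ends of that geodesic. *)
Lemma hullG_vertex U h u : (1, 0) \in U -> u \in U -> u.2 != 0 ->
  (forall p, hullG U p -> side h p <= 0) -> hp_a h <= 0 /\ gauss_form h u <= 0.
Proof.
move=> infU uU u2 hh.
have q0 : 0 < sqnorm (gC u.2) by rewrite sqnorm_gt0 // gauss_C_eq0.
set z := gC u.1 / gC u.2.
have sideE h' (t : R) : side h' (z, t) = hp_a h' * t ^+ 2 + gauss_form h' u / sqnorm (gC u.2).
  rewrite gauss_form_ideal // mulfK ?gt_eqF // /side /ideal_side /= -/z; ring.
have inf_form h' : gauss_form h' (1, 0) = hp_a h'.
  rewrite gauss_form_inf //= gauss_C1.
  by rewrite /sqnorm /= expr0n /= expr1n addr0 mulr1.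
have {}hh (t : R) : 0 < t -> hp_a h * t ^+ 2 + gauss_form h u / sqnorm (gC u.2) <= 0.
  move=> t0; rewrite -sideE; apply: hh; split=> // h' nd hU; rewrite sideE.
  have := hU _ infU; rewrite inf_form => a0.
  rewrite -[leRHS]addr0 lerD //; last by rewrite pmulr_lle0 ?invr_gt0 ?hU.
  by rewrite mulr_le0_ge0 // sqr_ge0.
suff [-> h0] : hp_a h <= 0 /\ gauss_form h u / sqnorm (gC u.2) <= 0.
  by move: h0; rewrite pmulr_lle0 ?invr_gt0.
exact: quadratic_le0.
Qed.

End IdealPolyhedra.

(** * Enumerating the octahedral group *)

Section FiniteCheck.
Import Order.TTheory GRing.Theory Num.Theory.
Local Open Scope ring_scope.

Definition g_inf : gvec := (1, 0).
Definition g_0 : gvec := (0, 1).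
Definition g_1 : gvec := (1, 1).
Definition g_i : gvec := (gauss_i, 1).
Definition g_1i : gvec := ((1 +i* 1)%C, 1).
Definition g_w : gvec := (1, (1 +i* (-1))%C).

Definition octa_vertices : seq gvec := [:: g_inf; g_0; g_1; g_i; g_1i; g_w].

(** A matrix as the pair of its columns: unlike those of the matrix type, its
    entries can be computed by reduction. *)
Definition qmat : Type := (gvec * gvec)%type.
Definition qact (m : qmat) (u : gvec) : gvec :=
  (m.1.1 * u.1 + m.2.1 * u.2, m.1.2 * u.1 + m.2.2 * u.2).
Definition qmul (m n : qmat) : qmat := (qact m n.1, qact m n.2).
Definition qneg (m : qmat) : qmat := ((- m.1.1, - m.1.2), (- m.2.1, - m.2.2)).
Definition qdet (m : qmat) : gaussInt := m.1.1 * m.2.2 - m.2.1 * m.1.2.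

Definition qgen (s : picard_gen) : qmat :=
  match s with
  | genS => ((0, 1), (-1, 0))
  | genR => ((0, gauss_i), (gauss_i, 0))
  | genX => ((1, 1), (-1, 0))
  | genY => ((-1, gauss_i), (gauss_i, 0))
  end.
Definition qword (w : seq picard_gen) : qmat :=
  foldr (fun s m => qmul (qgen s) m) ((1, 0), (0, 1)) w.

(** Words for elements of K that carry F_R, respectively F_S, to the four faces
    in its orbit.  They are coset representatives for the subgroup generated by
    the rotation X, respectively Y, of that face. *)
Definition repsR : seq (seq picard_gen) :=
  [:: [::]; [:: genY]; [:: genY; genY]; [:: genX; genY]].
Definition repsS : seq (seq picard_gen) :=
  [:: [::]; [:: genX]; [:: genX; genX]; [:: genY; genX]].
Definition wordsR := [seq w ++ nseq j genX | w <- repsR, j <- iota 0 3].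
Definition wordsS := [seq w ++ nseq j genY | w <- repsS, j <- iota 0 3].

Definition octa_vertex_multiples : seq gvec :=
  [seq (e * v.1, e * v.2) | e <- gauss_units, v <- octa_vertices].

Definition qstab (m : qmat) : bool :=
  (qdet m == 1) && all (fun u => has (gassoc (qact m u)) octa_vertices) octa_vertices.

Definition among (ws : seq (seq picard_gen)) (m : qmat) : bool :=
  has (fun w => (m == qword w) || (m == qneg (qword w))) ws.

(** The columns of a matrix that permutes the vertices are unit multiples of
    vertices, being the images of the vectors of infinity and 0. *)
Lemma qstab_words : all (fun u => all (fun v =>
    qstab (u, v) ==> among wordsR (u, v) && among wordsS (u, v))
  octa_vertex_multiples) octa_vertex_multiples.
Proof. by vm_compute. Qed.

End FiniteCheck.

(** * The face planes of the octahedron *)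

Section Octahedron.
Import Order.TTheory GRing.Theory Num.Theory.
Local Open Scope ring_scope.
Local Open Scope complex_scope.

Definition int_plane : Type := (int * gaussInt * int)%type.

Definition int_form (f : int_plane) (u : gvec) : int :=
  let: (a, b, c) := f in
  let: (p1 +i* p2) := u.1 in
  let: (q1 +i* q2) := u.2 in
  a * (p1 ^+ 2 + p2 ^+ 2)
  + 2 * (complex.Re b * (p1 * q1 + p2 * q2) + complex.Im b * (p2 * q1 - p1 * q2))
  + c * (q1 ^+ 2 + q2 ^+ 2).

Definition int_nondeg (f : int_plane) : bool :=
  let: (a, b, c) := f in a * c < gsqnorm b.

(** The eight face planes of the octahedron, negative on its interior: four
    vertical planes around the unit square and four hemispheres over the circles
    whose diameters are the sides of that square. *)
Definition octa_planes : seq int_plane :=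
  [:: (0, -1 +i* 0, 0); (0, 0 +i* -1, 0); (0, 1 +i* 0, -2); (0, 0 +i* 1, -2);
      (-2, 1 +i* 0, 0); (-2, 0 +i* 1, 0); (-2, 1 +i* 2, -2); (-2, 2 +i* 1, -2)].

Definition int_opp (f : int_plane) : int_plane := let: (a, b, c) := f in (- a, - b, - c).

Lemma octa_planes_vertices :
  all (fun f => int_nondeg f && all (fun u => int_form f u <= 0) octa_vertices) octa_planes.
Proof. by vm_compute. Qed.

(** For the point z = (P + i Q) / N: the open disks whose diameters are the sides
    of the unit square cover it except for its corners and its center. *)
Lemma square_disks (P Q N : int) : 0 < N -> 0 <= P <= N -> 0 <= Q <= N ->
  P * (N - P) <= Q ^+ 2 -> Q * (N - Q) <= P ^+ 2 ->
  P * (N - P) <= (N - Q) ^+ 2 -> Q * (N - Q) <= (N - P) ^+ 2 ->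
  (P = 0 \/ P = N) /\ (Q = 0 \/ Q = N) \/ 2 * P = N /\ 2 * Q = N.
Proof.
have key (m n : int) : 0 < N -> 0 <= m -> 0 <= n -> 2 * m <= N -> 2 * n <= N ->
    m * (N - m) <= n ^+ 2 -> n * (N - n) <= m ^+ 2 -> m = n /\ (m = 0 \/ 2 * m = N).
  move=> N0 m0 n0 hm hn h1 h2.
  have mn : m <= n.
    rewrite leNgt; apply/negP => lt; nia.
  have nm : n <= m.
    rewrite leNgt; apply/negP => lt; nia.
  have e : m = n by lia.
  subst n; split=> //; have [->|m1] := eqVneq m 0; first by left.
  right; nia.
move=> N0 hP hQ h1 h2 h3 h4.
have [p|p] := leP (2 * P) N; have [q|q] := leP (2 * Q) N.
- have [] := key P Q N0; lia.
- have [] := key P (N - Q) N0; lia.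
- have [] := key (N - P) Q N0; lia.
- have [] := key (N - P) (N - Q) N0; lia.
Qed.

Lemma gsqnorm_sub_eq (p q : gaussInt) : gsqnorm (p - q) = 0 -> p = q.
Proof. by move/eqP; rewrite gsqnorm_eq0 subr_eq0 => /eqP. Qed.

(** With z = p/q, the inequalities say that z lies in the unit square and outside
    the open disks over its sides, so z is a vertex; a primitive vector on the
    line of a vertex is a unit multiple of its representative. *)
Lemma octa_planes_primitive (p q x y : gaussInt) : x * p + y * q = 1 ->
  all (fun f => int_form f (p, q) <= 0) octa_planes -> has (gassoc (p, q)) octa_vertices.
Proof.
move=> bez.
have assoc e v : v \in octa_vertices -> e \in gauss_units -> p = e * v.1 -> q = e * v.2 ->
    has (gassoc (p, q)) octa_vertices.
  move=> vV eu hp hq; apply/hasP; exists v => //; apply/hasP; exists e => //.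
  by rewrite /= hp hq !eqxx.
have [q0|q0] := eqVneq q 0.
  have pu : p \in gauss_units.
    by move: bez; rewrite q0 mulr0 addr0 mulrC => /mul_eq1_gauss_units.
  by move=> _; apply: (assoc p g_inf) => //=; rewrite ?mulr1 ?mulr0.
have unit_q v : p = v * q -> q \in gauss_units.
  move=> e; apply: (@mul_eq1_gauss_units _ (x * v + y)).
  by rewrite -bez e; ring.
have N0 : 0 < gsqnorm q by rewrite gsqnorm_gt0.
pose P := complex.Re p * complex.Re q + complex.Im p * complex.Im q.
pose Q := complex.Im p * complex.Re q - complex.Re p * complex.Im q.
have hMN : gsqnorm p * gsqnorm q = P ^+ 2 + Q ^+ 2 by rewrite /P /Q /gsqnorm; ring.
have subE (v : gaussInt) : gsqnorm (p - v * q) =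
   gsqnorm p + gsqnorm v * gsqnorm q - 2 * (complex.Re v * P + complex.Im v * Q).
  rewrite /P /Q; case: p q v {bez assoc q0 unit_q N0 P Q hMN} => [p1 p2] [q1 q2] [v1 v2].
  by rewrite gmulE goppE gaddE /gsqnorm /=; ring.
have subE' (v : gaussInt) : gsqnorm (q - v * p) =
   gsqnorm q + gsqnorm v * gsqnorm p - 2 * (complex.Re v * P - complex.Im v * Q).
  rewrite /P /Q; case: p q v {bez assoc q0 unit_q N0 P Q hMN subE} => [p1 p2] [q1 q2] [v1 v2].
  by rewrite gmulE goppE gaddE /gsqnorm /=; ring.
move=> H; have {H} : [&& -2 * P <= 0, -2 * Q <= 0, 2 * P - 2 * gsqnorm q <= 0,
    2 * Q - 2 * gsqnorm q <= 0, -2 * gsqnorm p + 2 * P <= 0, -2 * gsqnorm p + 2 * Q <= 0,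
    -2 * gsqnorm p + 2 * P + 4 * Q - 2 * gsqnorm q <= 0 &
    -2 * gsqnorm p + 4 * P + 2 * Q - 2 * gsqnorm q <= 0].
  move: H; rewrite /P /Q /gsqnorm.
  case: p q {bez assoc q0 unit_q N0 P Q hMN subE subE'} => [p1 p2] [q1 q2] /=.
  rewrite andbT; congr [&& _, _, _, _, _, _, _ & _]; congr (_ <= _); ring.
case/and4P => a1 a2 a3 /and5P[a4 a5 a6 a7 a8].
set N := gsqnorm q in N0 hMN subE subE' a1 a2 a3 a4 a5 a6 a7 a8.
set M := gsqnorm p in hMN subE subE' a1 a2 a3 a4 a5 a6 a7 a8.
have mulN (z : int) : 0 <= z -> 0 <= N * z by move=> z0; rewrite mulr_ge0 // ltW.
have cancelN (k : int) : M * N = k * N -> M = k by apply: mulIf; rewrite gt_eqF.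
have b1 : P * (N - P) <= Q ^+ 2 by have := mulN (M - P) ltac:(lia); lia.
have b2 : Q * (N - Q) <= P ^+ 2 by have := mulN (M - Q) ltac:(lia); lia.
have b3 : P * (N - P) <= (N - Q) ^+ 2 by have := mulN (M - P - 2 * Q + N) ltac:(lia); lia.
have b4 : Q * (N - Q) <= (N - P) ^+ 2 by have := mulN (M - Q - 2 * P + N) ltac:(lia); lia.
have [||[hP hQ]|[hP hQ]] := square_disks N0 _ _ b1 b2 b3 b4; try lia.
- have fin v : v.2 = 1 -> v \in octa_vertices -> gsqnorm (p - v.1 * q) = 0 ->
      has (gassoc (p, q)) octa_vertices.
    move=> v2 vV /gsqnorm_sub_eq e; apply: (assoc q v) => //; first exact: unit_q e.
      by rewrite mulrC.
    by rewrite v2 mulr1.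
  case: hP hQ => hP [] hQ.
  + have M0 : M = 0 by apply: cancelN; rewrite hMN hP hQ; ring.
    by apply: (fin g_0) => //; rewrite subE (_ : gsqnorm _ = 0) //= hP hQ M0; lia.
  + have M1 : M = N by apply: cancelN; rewrite hMN hP hQ; ring.
    by apply: (fin g_i) => //; rewrite subE (_ : gsqnorm _ = 1) //= hP hQ M1; lia.
  + have M1 : M = N by apply: cancelN; rewrite hMN hP hQ; ring.
    by apply: (fin g_1) => //; rewrite subE (_ : gsqnorm _ = 1) //= hP hQ M1; lia.
  + have M2 : M = 2 * N by apply: cancelN; rewrite hMN hP hQ; ring.
    by apply: (fin g_1i) => //; rewrite subE (_ : gsqnorm _ = 2) //= hP hQ M2; lia.
- have /gsqnorm_sub_eq e : gsqnorm (q - g_w.2 * p) = 0.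
    have M2 : 2 * M = N.
      have PQ : P = Q by lia.
      apply: (@mulIf _ N); first by rewrite gt_eqF.
      by rewrite -mulrA hMN -PQ -hP; ring.
    by rewrite subE' (_ : gsqnorm _ = 2) //=; lia.
  apply: (assoc p g_w) => //=; first last.
  + by rewrite mulrC.
  + by rewrite mulr1.
  + by apply: (@mul_eq1_gauss_units _ (x + y * g_w.2)); rewrite -bez [q in RHS]e; ring.
Qed.

End Octahedron.

(** * Translates of polyhedra *)

Section OctahedralGroup.
Import Order.TTheory GRing.Theory Num.Theory.
Variable R : realType.
Local Notation K := (octa_stab R).
Local Notation O := (octahedron R).
Local Notation face := (set (Defs.point R)).
Implicit Types (g h k : psl2) (A B : sl2) (F : face).

Definition upper : face := [set p | (0 < p.2)%R].

Lemma translateM g h F : F `<=` upper -> translate (g * h) F = translate g (translate h F).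
Proof.
move=> F0; rewrite -[g]reprK -[h]reprK -/psl2_class -psl2_classM /translate image_comp.
by apply: eq_imagel => p /F0 p0; rewrite /= !hact_class mob_sl2M.
Qed.

Lemma translate1 F : F `<=` upper -> translate 1 F = F.
Proof.
move=> F0; rewrite -[RHS]image_id; apply: eq_imagel => p /F0 p0.
by rewrite -psl2_class1 hact_class mob_sl2_1.
Qed.

Lemma translate_upper g F : F `<=` upper -> translate g F `<=` upper.
Proof.
move=> F0 _ [p /F0 p0 <-]; rewrite -[g]reprK -/psl2_class hact_class.
exact: mob_sl2_gt0.
Qed.

Lemma translateK g F : F `<=` upper -> translate g^-1 (translate g F) = F.
Proof. by move=> F0; rewrite -translateM // mulVg translate1. Qed.

Lemma hullG_upper U : @hullG R U `<=` upper.
Proof. by move=> p; exact: hullG_gt0. Qed.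

Definition plane_of (f : int_plane) : hplane R :=
  let: (a, b, c) := f in HPlane a%:~R (gauss_C R b) c%:~R.

Lemma gauss_form_int f u : gauss_form (plane_of f) u = ((int_form f u)%:~R)%R.
Proof.
case: f u => [[a [b1 b2]] c] [[p1 p2] [q1 q2]].
rewrite /gauss_form /herm_form /gvecC /plane_of /gauss_C /int_form /sqnorm /=.
rewrite !(rmorphD, rmorphB, rmorphN, rmorphM, rmorphXn) /=; ring.
Qed.

Lemma nondeg_plane_of f : int_nondeg f -> Defs.nondegenerate (plane_of f).
Proof.
case: f => [[a [b1 b2]] c]; rewrite /int_nondeg /Defs.nondegenerate /gsqnorm /sqnorm /=.
by rewrite -(ltr_int R) !(rmorphD, rmorphM, rmorphXn).
Qed.

Lemma hullG_side U f p : int_nondeg f -> all (fun u => int_form f u <= 0)%R U -> @hullG R U p ->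
  (side (plane_of f) p <= 0)%R.
Proof.
move=> nd /allP hU [_]; apply; first exact: nondeg_plane_of.
by move=> u uU; rewrite gauss_form_int lerz0 hU.
Qed.

Lemma ideal_vertices : (((ideal R g_inf = v_inf R) * (ideal R g_0 = v_0 R) *
  (ideal R g_1 = v_1 R)) * ((ideal R g_i = v_i R) * (ideal R g_1i = v_1i R) *
  (ideal R g_w = v_w R)))%type.
Proof.
rewrite /ideal /=; do !split => //; congr Some; rewrite ?gauss_C1 ?divr1 //.
have gw : gauss_C R g_w.2 = (1%R +i* (-1)%R)%C by rewrite /gauss_C /= mulrNz mulr1z.
rewrite gw; apply/eqP; rewrite eqr_div.
- rewrite eq_complex /=; apply/andP; split; apply/eqP; ring.
- by rewrite eq_complex /= oner_eq0.
- by rewrite pnatr_eq0.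
Qed.

End OctahedralGroup.

(** * The stabilizer of the octahedron *)

Section OctahedralFaces.
Import Order.TTheory GRing.Theory Num.Theory.
Variable R : realType.
Local Notation K := (octa_stab R).
Local Notation O := (octahedron R).
Local Notation face := (set (Defs.point R)).
Implicit Types (g h k : psl2) (A B : sl2) (F : face) (b : bool).

Lemma hull_ideal3 u v w : all nonzero_gvec [:: u; v; w] ->
  hull [set ideal R u; ideal R v; ideal R w] = @hullG R [:: u; v; w].
Proof.
move=> nz; rewrite -hull_ideal //; congr hull.
apply/seteqP; split=> [x [[|]|] ->|_ [x /= + <-]] /=.
- by exists u; rewrite //= inE eqxx.
- by exists v; rewrite //= !inE eqxx orbT.
- by exists w; rewrite //= !inE eqxx !orbT.
- by rewrite !inE => /or3P[] /eqP ->; [left; left|left; right|right].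
Qed.

Lemma octahedronE : O = @hullG R octa_vertices.
Proof.
rewrite -hull_ideal // /octahedron -!ideal_vertices; congr hull.
apply/seteqP; split=> [x [[[[[|]|]|]|]|] ->|_ [x /= + <-]] /=.
- by exists g_inf.
- by exists g_0.
- by exists g_1.
- by exists g_i.
- by exists g_1i.
- by exists g_w.
- rewrite !inE => /orP[/eqP ->|]; first by do 5 left.
  move=> /orP[/eqP ->|]; first by do 4 left; right.
  move=> /orP[/eqP ->|]; first by do 3 left; right.
  move=> /orP[/eqP ->|]; first by do 2 left; right.
  by move=> /orP[/eqP ->|/eqP ->]; [left; right|right].
Qed.

(** The two facets through which the standard cell leaves the octahedron, indexed
    by a boolean: true for R and F_R, false for S and F_S. *)
Definition side_gen b := if b then genR else genS.
Definition side_face b : face := if b then face_R R else face_S R.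
Definition side_faceV b : seq gvec :=
  if b then [:: g_0; g_1; g_inf] else [:: g_i; g_0; g_inf].

Lemma side_faceE b : side_face b = @hullG R (side_faceV b).
Proof. by case: b; rewrite /= /face_R /face_S -!ideal_vertices hull_ideal3. Qed.

Lemma octahedron_upper : O `<=` @upper R.
Proof. by rewrite octahedronE; exact: hullG_upper. Qed.

Lemma side_face_upper b : side_face b `<=` @upper R.
Proof. by rewrite side_faceE; exact: hullG_upper. Qed.

Lemma octa_stab_subgroup : is_subgroup K.
Proof.
have ou := octahedron_upper.
split; first by apply/mem_set; rewrite /octa_stab /set_stab /= translate1.
move=> g h /set_mem gK /set_mem hK; apply/mem_set; rewrite /octa_stab /set_stab /=.
by rewrite translateM // -[X in translate h^-1 X]hK translateK.
Qed.

(* Each vertex vector has a coordinate equal to 1. *)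
Lemma octa_vertices_primitive : all (fun u : gvec => has (fun xy : gvec =>
  xy.1 * u.1 + xy.2 * u.2 == 1)%R [:: g_inf; g_0]) octa_vertices.
Proof. by vm_compute. Qed.

Lemma stab_vertices A u : K (psl2_class A) -> u \in octa_vertices ->
  has (gassoc (act_gvec A u)) octa_vertices.
Proof.
move=> AK uV.
have [x [y xy]] : exists x y : gaussInt, (x * u.1 + y * u.2 = 1)%R.
  by have /allP/(_ u uV)/hasP[[x y] _ /eqP e] := octa_vertices_primitive; exists x, y.
apply: (@octa_planes_primitive _ _ (x * ed A - y * ec A) (y * ea A - x * eb A))%R.
  rewrite -[RHS]xy -[RHS]mul1r -(sl2_detE A); ring.
apply/allP => f fp; have /andP[nd fV] := allP octa_planes_vertices _ fp.
have hO p : O p -> (side (pullback_sl2 A (plane_of R f)) p <= 0)%R.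
  move=> Op; rewrite -side_mob_sl2_le0; last exact: octahedron_upper Op.
  apply: (hullG_side nd fV); rewrite -octahedronE -AK -hact_class.
  by exists p.
have := @hullG_vertex R octa_vertices (pullback_sl2 A (plane_of R f)).
rewrite -octahedronE => hv; rewrite -(lerz0 R) -gauss_form_int -gauss_form_pullback.
have [u2|u2] := eqVneq u.2 0%R.
  have [h0 _] := hv g_0 isT isT isT hO.
  by rewrite gauss_form_inf // mulr_le0_ge0 // addr_ge0 ?sqr_ge0.
by have [] := hv u isT uV u2 hO.
Qed.

Definition gen_mul (w : seq picard_gen) : psl2 := foldr (fun s g => gen_elt s * g) 1 w.

Lemma gen_mul_cat w1 w2 : gen_mul (w1 ++ w2) = gen_mul w1 * gen_mul w2.
Proof. by elim: w1 => [|s w IH] /=; rewrite ?mul1g // IH mulgA. Qed.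

Lemma gen_mul_nseq s n : gen_mul (nseq n s) = gen_elt s ^+ n.
Proof. by elim: n => [|n IH] //=; rewrite IH expgS. Qed.

Definition qmat_of A : qmat := ((ea A, ec A), (eb A, ed A)).

Lemma qmat_ofM A B : qmat_of (A * B) = qmul (qmat_of A) (qmat_of B).
Proof. by rewrite /qmat_of !entriesE. Qed.

Lemma qmat_of_gen s : qmat_of (sl2g s) = qgen s.
Proof. by case: s; rewrite /qmat_of ?sl2g_entries ?entriesS. Qed.

Lemma gen_mul_class w : exists2 A, gen_mul w = psl2_class A & qmat_of A = qword w.
Proof.
elim: w => [|s w [A eA qA]]; first by exists 1; rewrite // /qmat_of !entriesE.
by exists (sl2g s * A); rewrite /= ?eA ?psl2_classM ?gen_class // qmat_ofM qA qmat_of_gen.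
Qed.

Lemma qmat_of_inj A B : qmat_of A = qmat_of B -> A = B.
Proof. by case=> *; apply: sl2P. Qed.

Lemma among_gen_mul ws A : among ws (qmat_of A) -> exists2 w, w \in ws & psl2_class A = gen_mul w.
Proof.
case/hasP => w wws h; exists w => //; have [B -> qB] := gen_mul_class w.
apply/psl2_class_eqP; case/orP: h => /eqP; rewrite -qB.
  by move=> /qmat_of_inj; left.
move=> e; right; apply: qmat_of_inj.
rewrite e qmat_ofM /qmat_of /sl2N /qmul /qact /qneg !entriesE /=.
by congr (_, _, (_, _)); ring.
Qed.

Lemma octa_stab_words g : K g ->
  (exists2 w, w \in wordsR & g = gen_mul w) /\ (exists2 w, w \in wordsS & g = gen_mul w).
Proof.
rewrite -[g]reprK -/psl2_class; move: (repr g) => {g} A AK.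
have img u : u \in octa_vertices -> has (gassoc (act_gvec A u)) octa_vertices.
  exact: stab_vertices.
have unit u : u \in octa_vertices -> act_gvec A u \in octa_vertex_multiples.
  move=> /img /hasP[v vV /hasP[e eu /andP[/eqP e1 /eqP e2]]].
  by apply/allpairsP; exists (e, v); split=> //=; rewrite -e1 -e2; case: (act_gvec _ _).
have q1 : act_gvec A g_inf = (ea A, ec A) by rewrite /act_gvec /= !mulr1 !mulr0 !addr0.
have q2 : act_gvec A g_0 = (eb A, ed A) by rewrite /act_gvec /= !mulr1 !mulr0 !add0r.
have := qstab_words => /allP/(_ (ea A, ec A)); rewrite -{1}q1 unit // => /(_ isT).
move=> /allP/(_ (eb A, ed A)); rewrite -{1}q2 unit // => /(_ isT) /implyP.
have -> : qstab (ea A, ec A, (eb A, ed A)).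
  apply/andP; split; first by rewrite /qdet /= sl2_detE.
  by apply/allP => u /img.
by move=> /(_ isT) /andP[/among_gen_mul h1 /among_gen_mul h2].
Qed.

Lemma octa_stab_finite : finite_set K.
Proof.
apply: (@sub_finite_set _ _ [set gen_mul w | w in [set` wordsR]]).
  by move=> g /octa_stab_words[[w wR ->] _]; exists w.
exact: finite_image.
Qed.

Lemma translate_gen_mul w U :
  translate (gen_mul w) (@hullG R U) = @hullG R [seq qact (qword w) u | u <- U].
Proof.
by have [A -> <-] := gen_mul_class w; rewrite translate_hullG.
Qed.

Lemma translate_gen_mul_eq w U V :
  let U' := [seq qact (qword w) u | u <- U] in assoc_subset U' V && assoc_subset V U' ->
  translate (gen_mul w) (@hullG R U) = @hullG R V.
Proof. by move=> U' /hullG_eq; rewrite translate_gen_mul. Qed.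

Lemma gen_mul1 s : gen_mul [:: s] = gen_elt s. Proof. exact: mulg1. Qed.

Lemma genX_octa : K (gen_elt genX).
Proof.
rewrite /octa_stab /set_stab /= octahedronE -gen_mul1.
by apply: translate_gen_mul_eq; vm_compute.
Qed.

Lemma genY_octa : K (gen_elt genY).
Proof.
rewrite /octa_stab /set_stab /= octahedronE -gen_mul1.
by apply: translate_gen_mul_eq; vm_compute.
Qed.

(** The generator of order three that rotates the face of the given type. *)
Definition rot_gen b := if b then genX else genY.

Lemma rot_gen_octa b : K (gen_elt (rot_gen b)).
Proof. by case: b; [exact: genX_octa | exact: genY_octa]. Qed.

Lemma rot_gen_face b : translate (gen_elt (rot_gen b)) (side_face b) = side_face b.
Proof.
by rewrite side_faceE -gen_mul1; apply: translate_gen_mul_eq; case: b; vm_compute.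
Qed.

Lemma side_gen_face b : translate (gen_elt (side_gen b)) (side_face b) = side_face b.
Proof.
by rewrite side_faceE -gen_mul1; apply: translate_gen_mul_eq; case: b; vm_compute.
Qed.

End OctahedralFaces.

(** * Orbits of faces *)

Section FaceOrbits.
Import Order.TTheory GRing.Theory Num.Theory.
Variable R : realType.
Local Notation K := (octa_stab R).
Local Notation O := (octahedron R).
Local Notation face := (set (Defs.point R)).
Local Notation side_face := (@side_face R).
Implicit Types (g h k : psl2) (F : face) (b : bool).

Definition reps b := if b then repsR else repsS.

Definition octa_triples : seq (gvec * gvec * gvec) :=
  [seq (ad.1, ad.2, c) | ad <- [seq (a, d) | a <- [:: g_inf; g_w], d <- [:: g_0; g_1i]],
                         c <- [:: g_1; g_i]].
Definition triple_seq (t : gvec * gvec * gvec) : seq gvec := [:: t.1.1; t.1.2; t.2].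

Definition rep_faceV (bw : bool * seq picard_gen) : seq gvec :=
  [seq qact (qword bw.2) u | u <- side_faceV bw.1].
Definition face_reps : seq (bool * seq picard_gen) :=
  [seq (true, w) | w <- repsR] ++ [seq (false, w) | w <- repsS].

Definition assoc_equal U V := assoc_subset U V && assoc_subset V U.

Lemma triples_reps :
  all (fun t => has (fun bw => assoc_equal (rep_faceV bw) (triple_seq t)) face_reps) octa_triples &&
  all (fun bw => has (fun t => assoc_equal (rep_faceV bw) (triple_seq t)) octa_triples) face_reps.
Proof. by vm_compute. Qed.

Lemma octa_faceE F : octa_face F <-> exists2 t, t \in octa_triples & F = hullG (triple_seq t).
Proof.
have E a d c : all nonzero_gvec [:: a; d; c] -> hullG [:: a; d; c] =
  hull [set ideal R a; ideal R d; ideal R c] by move=> nz; rewrite hull_ideal3.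
split.
- move=> [a [d [c [[->|->] [->|->] [->|->] ->]]]]; rewrite -!ideal_vertices -E //.
  + by exists (g_inf, g_0, g_1).
  + by exists (g_inf, g_0, g_i).
  + by exists (g_inf, g_1i, g_1).
  + by exists (g_inf, g_1i, g_i).
  + by exists (g_w, g_0, g_1).
  + by exists (g_w, g_0, g_i).
  + by exists (g_w, g_1i, g_1).
  + by exists (g_w, g_1i, g_i).
- move=> [t /allpairsP[[ab c] [/allpairsP[[a d] [/= ha hb ->]] /= hc ->]] ->].
  exists (ideal R a), (ideal R d), (ideal R c).
  move: ha hb hc; rewrite !inE => /orP ha /orP hb /orP hc.
  by case: ha => /eqP ->; case: hb => /eqP ->; case: hc => /eqP ->;
    rewrite /triple_seq E // !ideal_vertices; split=> //; (by left) || (by right).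
Qed.

Lemma octa_stab_reps b g : K g -> exists w j, w \in reps b /\
  g = gen_mul w * gen_elt (rot_gen b) ^+ j.
Proof.
case/octa_stab_words => -[w1 w1R e1] [w2 w2S e2].
case: b; [move: w1R; rewrite e1 {w2 w2S e2 e1}|move: w2S; rewrite e2 {w1 w1R e1 e2}].
all: by move=> /allpairsP[[w j] [/= wR _ ->]]; exists w, j;
  rewrite gen_mul_cat gen_mul_nseq.
Qed.

Lemma octa_stab1 : K 1. Proof. by have [/set_mem] := octa_stab_subgroup R. Qed.
Lemma octa_stabM g h : K g -> K h -> K (g * h).
Proof.
move=> /mem_set gK /mem_set hK; apply/set_mem/group_closedM => //.
exact: octa_stab_subgroup.
Qed.
Lemma octa_stabV g : K g -> K g^-1.
Proof. by move=> /mem_set gK; apply/set_mem/group_closedV => //; exact: octa_stab_subgroup. Qed.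

Lemma octa_stab_gen_mul b w : w \in reps b -> K (gen_mul w).
Proof.
have gX := genX_octa R; have gY := genY_octa R.
by case: b; rewrite !inE => /or4P[] /eqP ->; rewrite /= ?mulg1;
  do ?[exact: octa_stab1 | exact: gX | exact: gY | apply: octa_stabM].
Qed.

Lemma rot_face b j : translate (gen_elt (rot_gen b) ^+ j) (side_face b) = side_face b.
Proof.
have fu := @side_face_upper R b.
elim: j => [|j IH]; first by rewrite translate1.
by rewrite expgS translateM // IH rot_gen_face.
Qed.

Lemma octa_face_orbit F : octa_face F <-> exists b, exists2 k, K k & F = translate k (side_face b).
Proof.
have /andP[/allP h1 /allP h2] := triples_reps.
rewrite octa_faceE; split=> [[t /h1 /hasP[[b w] bw e] ->]|[b [k kK ->]]].
- exists b; exists (gen_mul w); last by rewrite side_faceE translate_gen_mul; apply/esym/hullG_eq.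
  apply: (@octa_stab_gen_mul b); move: bw; rewrite mem_cat.
  by case/orP => /mapP[w' w'R [-> ->]].
- have [w [j [wR ->]]] := octa_stab_reps b kK.
  have /h2 /hasP[t tT e] : (b, w) \in face_reps.
    rewrite mem_cat; apply/orP.
    by case: b wR {kK}; [left|right]; apply/mapP; exists w.
  exists t => //; rewrite translateM ?rot_face; last exact: side_face_upper.
  by rewrite side_faceE translate_gen_mul; exact: hullG_eq.
Qed.

Lemma hullG_vertices V (h : hplane R) v : g_inf \in V -> g_0 \in V ->
    all (fun v => (v == g_inf) || (v.2 != 0%R)) V ->
    (forall p, @hullG R V p -> (side h p <= 0)%R) -> v \in V -> (gauss_form h v <= 0)%R.
Proof.
move=> infV zV /allP fin hh vV; have /orP[/eqP ->|v2] := fin _ vV.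
  have [h0 _] := hullG_vertex infV zV isT hh.
  by rewrite gauss_form_inf // mulr_le0_ge0 // addr_ge0 ?sqr_ge0.
by have [] := hullG_vertex infV vV v2 hh.
Qed.

(** Faces with different vertices have different hulls: the plane of the first
    face has a vertex of the second one strictly on its inner side. *)
Definition separated U V : bool :=
  has (fun f => [&& int_nondeg (int_opp f), all (fun u => int_form (int_opp f) u <= 0)%R U &
     has (fun v => 0 < int_form (int_opp f) v)%R V]) octa_planes.

Lemma separatedP (U V : seq gvec) : g_inf \in V -> g_0 \in V ->
  all (fun v => (v == g_inf) || (v.2 != 0%R)) V -> separated U V -> @hullG R U <> hullG V.
Proof.
move=> infV zV fin /hasP[f _ /and3P[nd fU /hasP[v vV fv]]] e.
have := hullG_vertices infV zV fin _ vV (h := plane_of R (int_opp f)).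
rewrite gauss_form_int lerz0 leNgt fv -e => /(_ (fun p => hullG_side nd fU)).
by [].
Qed.

Lemma reps_separated : all (fun bw => all (fun b' =>
    (bw == (b', [::])) || separated (rep_faceV bw) (side_faceV b')) [:: true; false]) face_reps.
Proof. by vm_compute. Qed.

Lemma side_gen_rot b : gen_elt (side_gen b) * gen_elt (rot_gen b) =
  (gen_elt (rot_gen b))^-1 * (gen_elt (side_gen b))^-1.
Proof.
have h : gen_elt (side_gen b) * gen_elt (rot_gen b) *
    gen_elt (side_gen b) * gen_elt (rot_gen b) = 1.
  have := @psl2_relators (if b then [:: (genR, false); (genX, false); (genR, false); (genX, false)]
    else [:: (genS, false); (genY, false); (genS, false); (genY, false)]).
  by case: b; rewrite /word_val /= mul1g; apply; rewrite !inE eqxx ?orbT.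
by move: h; rewrite -mulgA => /mulg1_eq <-; rewrite invgM.
Qed.

Lemma side_gen_sq b : gen_elt (side_gen b) * gen_elt (side_gen b) = 1.
Proof.
have := @psl2_relators (if b then [:: (genR, false); (genR, false)]
  else [:: (genS, false); (genS, false)]).
by case: b; rewrite /word_val /= mul1g; apply; rewrite !inE eqxx ?orbT.
Qed.

Lemma side_genV b : (gen_elt (side_gen b))^-1 = gen_elt (side_gen b).
Proof. exact/mulg1_eq/side_gen_sq. Qed.

(** The element k'^-1 k fixes the standard face, so it is a power of the rotation
    of that face, which the side generator inverts. *)
Lemma face_orbit_uniq b b' k k' : K k -> K k' ->
  translate k (side_face b) = translate k' (side_face b') ->
  b = b' /\ K (gen_elt (side_gen b) * (k'^-1 * k) * gen_elt (side_gen b)).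
Proof.
move=> kK k'K e.
have fu := @side_face_upper R b; have fu' := @side_face_upper R b'.
have mK : K (k'^-1 * k) by apply: octa_stabM => //; exact: octa_stabV.
have : translate (k'^-1 * k) (side_face b) = side_face b'.
  by rewrite translateM // e translateK.
move: (k'^-1 * k) mK => m mK {e}.
have [w [j [wR ->]]] := octa_stab_reps b mK.
rewrite translateM // rot_face => e.
have bw : (b, w) \in face_reps.
  rewrite mem_cat; apply/orP.
  by case: (b) wR; [left|right]; apply/mapP; exists w.
have /allP/(_ b') := allP reps_separated _ bw.
have -> : b' \in [:: true; false] by case: (b').
move=> /(_ isT) /orP[/eqP[-> ->]|sep]; last first.
  exfalso; apply: (separatedP _ _ _ sep); try by case: (b').
  by rewrite -side_faceE -e side_faceE translate_gen_mul.
split=> //; rewrite /= mul1g; elim: j {wR bw e} => [|j IH].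
  by rewrite mulg1 side_gen_sq; exact: octa_stab1.
rewrite expgS mulgA side_gen_rot side_genV -!mulgA; apply: octa_stabM.
  by apply/octa_stabV/rot_gen_octa.
by rewrite mulgA.
Qed.

Definition side_plane b : int_plane :=
  if b then (0, gauss_i, 0)%R else (0, 1, 0)%R.

Lemma side_opposite b :
  opposite_sides (side_face b) (translate (gen_elt (side_gen b)) O) O.
Proof.
have sideN f p : side (plane_of R (int_opp f)) p = (- side (plane_of R f) p)%R.
  case: f p => [[a [b1 b2]] c] [[z1 z2] t]; rewrite /side /plane_of /int_opp /gauss_C /=.
  rewrite !rmorphN /=; ring.
have ndN f : int_nondeg f -> int_nondeg (int_opp f).
  by case: f => [[a [b1 b2]] c]; rewrite /int_nondeg /int_opp mulrNN gsqnormN.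
have nd : int_nondeg (side_plane b) by case: b.
exists (plane_of R (side_plane b)); split.
- exact: nondeg_plane_of.
- move=> p; rewrite side_faceE => pF; apply/eqP; rewrite eq_le -[X in _ && X]oppr_le0 -sideN.
  by apply/andP; split; apply: hullG_side pF; rewrite ?ndN //; case: b {nd}; vm_compute.
- move=> p; rewrite octahedronE -gen_mul1 translate_gen_mul; apply: hullG_side => //.
  by case: b {nd}; vm_compute.
- move=> p; rewrite octahedronE -oppr_le0 -sideN; apply: hullG_side; first exact: ndN.
  by case: b {nd}; vm_compute.
Qed.

(** The witness is moved by pulling it back along the inverse. *)
Lemma opposite_sides_translate g F F1 F2 :
  F `<=` @upper R -> F1 `<=` @upper R -> F2 `<=` @upper R -> opposite_sides F F1 F2 ->
  opposite_sides (translate g F) (translate g F1) (translate g F2).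
Proof.
rewrite -[g]reprK -/psl2_class; move: (repr g) => A Fu F1u F2u [h [nd h0 h1 h2]].
have key p : (0 < p.2)%R -> exists2 n, (0 < n)%R &
    (side (pullback_sl2 A^-1%g h) (mob_sl2 A p) = side h p * n)%R.
  move=> p0; rewrite /pullback_sl2 -mob_side; [|exact: detC|exact: mob_sl2_gt0].
  rewrite -/(mob_sl2 A^-1 _) -mob_sl2M // mulVg mob_sl2_1 //; eexists; last by [].
  by apply: mob_den_gt0; [exact: detC|exact: mob_sl2_gt0].
exists (pullback_sl2 A^-1 h); split.
- exact: nondeg_pullback (detC _ _) _ nd.
- move=> _ [p Fp <-]; rewrite hact_class; have [n _ ->] := key p (Fu _ Fp).
  by rewrite h0 // mul0r.
- move=> _ [p Fp <-]; rewrite hact_class; have [n n0 ->] := key p (F1u _ Fp).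
  by rewrite pmulr_lle0 // h1.
- move=> _ [p Fp <-]; rewrite hact_class; have [n n0 ->] := key p (F2u _ Fp).
  by rewrite pmulr_lge0 // h2.
Qed.

End FaceOrbits.

(** * Counting *)

Section Counting.

Lemma ncard_eq (T U : choiceType) (A : set T) (B : set U) :
  finite_set A -> (A #= B)%card -> ncard A = ncard B.
Proof.
move=> [n An] AB; rewrite /ncard (card_fset_set An).
by apply/esym/card_fset_set; apply: card_eq_trans An; apply: card_esym.
Qed.

Lemma ncard_sigma (I : finType) (T : choiceType) (B : I -> set T) :
  (forall i, finite_set (B i)) ->
  ncard [set c : I * T | B c.1 c.2] = (\sum_i ncard (B i))%N.
Proof.
move=> finB.
have fin : finite_set [set c : I * T | B c.1 c.2].
  apply: (@sub_finite_set _ _ ([set: I] `*`` B)); first by move=> c.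
  by apply: finite_setXR => //; exact: finite_finset.
rewrite /ncard card_fset_sum1 (partition_big fst xpredT) //=.
apply: eq_bigr => i _; rewrite -big_filter sum1_size -(size_map snd).
apply: perm_size; apply: uniq_perm; last first.
- move=> y; rewrite in_fset_set //; apply/mapP/idP.
    move=> [[j z]]; rewrite mem_filter /= => /andP[/eqP ->].
    by rewrite in_fset_set // => /set_mem /= Bz ->; apply/mem_set.
  move/set_mem => By; exists (i, y); rewrite // mem_filter eqxx /=.
  by rewrite in_fset_set //; apply/mem_set.
- exact: fset_uniq.
- rewrite map_inj_in_uniq ?filter_uniq ?fset_uniq //.
  move=> [j z] [j' z']; rewrite !mem_filter /= => /andP[/eqP -> _] /andP[/eqP -> _] ->.
  by [].
Qed.

End Counting.

(** * Cosets and right actions *)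

Section CosetsActions.
Variable G : groupType.
Implicit Types (H K : set G) (g h k : G).

Lemma subgroup1 H : is_subgroup H -> H 1. Proof. by case=> /set_mem. Qed.
Lemma subgroupM H g h : is_subgroup H -> H g -> H h -> H (g * h).
Proof. by move=> sH /mem_set Hg /mem_set Hh; apply/set_mem/group_closedM. Qed.
Lemma subgroupV H g : is_subgroup H -> H g -> H g^-1.
Proof. by move=> sH /mem_set Hg; apply/set_mem/group_closedV. Qed.

Lemma rcosetP H g x : rcoset H g x <-> H (x * g^-1).
Proof.
split=> [[h Hh <-]|Hx]; first by rewrite mulgK.
by exists (x * g^-1); rewrite // mulgVK.
Qed.

Lemma rcoset_eqP H g k : is_subgroup H -> rcoset H g = rcoset H k <-> H (g * k^-1).
Proof.
move=> sH; split=> [e|Hgk].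
  by apply/rcosetP; rewrite -e; apply/rcosetP; rewrite mulgV; exact: subgroup1.
apply/seteqP; split=> x /rcosetP Hx; apply/rcosetP.
  by rewrite -(divgKA g); apply: subgroupM.
rewrite -(divgKA k); apply: subgroupM => //.
by rewrite -invgF; apply: subgroupV.
Qed.

Lemma conj_setP H g x : conj_set H g x <-> H (g * x * g^-1).
Proof.
split=> [[h Hh <-]|Hx]; first by rewrite conjgE !mulgA mulgV mul1g mulgK.
by exists (g * x * g^-1); rewrite // conjgE !mulgA mulVg mul1g mulgVK.
Qed.

Lemma conj_set_subgroup H g : is_subgroup H -> is_subgroup (conj_set H g).
Proof.
move=> sH; split.
  by apply/mem_set/conj_setP; rewrite mulg1 mulgV; exact: subgroup1.
move=> x y /set_mem/conj_setP Hx /set_mem/conj_setP Hy; apply/mem_set/conj_setP.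
rewrite (_ : _ * _ = (g * x * g^-1) * (g * y * g^-1)^-1).
  by apply: subgroupM => //; apply: subgroupV.
by rewrite !invgM invgK !mulgA mulgVK.
Qed.

Lemma setI_subgroup H K : is_subgroup H -> is_subgroup K -> is_subgroup (H `&` K).
Proof.
move=> sH sK; split; first by apply/mem_set; split; exact: subgroup1.
move=> x y /set_mem[Hx Kx] /set_mem[Hy Ky]; apply/mem_set.
by split; apply: subgroupM => //; apply: subgroupV.
Qed.

Section Action.
Variables (T : Type) (act : T -> G -> T).
Hypothesis (actR : is_right_action act).

Lemma act_invK c g : act (act c g) g^-1 = c.
Proof. by rewrite -actR.2 mulgV actR.1. Qed.

Lemma act_Vact c g : act (act c g^-1) g = c.
Proof. by rewrite -actR.2 mulVg actR.1. Qed.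

Lemma stabilizer_subgroup c : is_subgroup (stabilizer act c).
Proof.
split; first by apply/mem_set; exact: actR.1.
move=> g h /set_mem /= gc /set_mem /= hc; apply/mem_set.
by rewrite /stabilizer /= actR.2 gc -[in LHS]hc act_invK.
Qed.

Lemma stabilizer_act c g : stabilizer act (act c g) = conj_set (stabilizer act c) g.
Proof.
apply/seteqP; split=> h /=.
  by move=> hc; apply/conj_setP; rewrite /stabilizer /= !actR.2 hc act_invK.
by move=> /conj_setP; rewrite /stabilizer /= !actR.2 => e; rewrite -[in RHS]e act_Vact.
Qed.

Lemma stabilizer_orbits c : transitive_action act ->
  conj_class (stabilizer act c) = [set stabilizer act c' | c' in [set: T]].
Proof.
move=> tr; apply/seteqP; split=> _ [x _ <-].
  by exists (act c x); rewrite // stabilizer_act.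
by have [g <-] := tr c x; exists g; rewrite // stabilizer_act.
Qed.

Lemma rcoset_stabilizer c k :
  rcoset (stabilizer act c) k = [set g | act c g = act c k].
Proof.
apply/seteqP; split=> g; first by move=> /rcosetP /= e; rewrite -[in RHS]e -actR.2 mulgVK.
by move=> /= e; apply/rcosetP; rewrite /stabilizer /= actR.2 e act_invK.
Qed.

End Action.

Lemma orbit_stabilizer (T : choiceType) (act : T -> G -> T) c :
    is_right_action act -> transitive_action act -> finite_set [set: T] ->
  finite_index_subgroup (stabilizer act c) /\
  ncard (rcosets (stabilizer act c) [set: G]) = ncard [set: T].
Proof.
move=> actR tr fin.
have e : rcosets (stabilizer act c) [set: G] =
    (fun c' => [set g | act c g = c']) @` [set: T].
  apply/seteqP; split=> _ [x _ <-].
    by exists (act c x); rewrite // rcoset_stabilizer.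
  by have [g <-] := tr c x; exists g; rewrite // rcoset_stabilizer.
have inj : injective (fun c' => [set g | act c g = c']).
  move=> c1 c2 /seteqP[s12 _]; have [g gc] := tr c c1.
  by rewrite -gc; exact: s12.
rewrite e; split; first by split; [exact: stabilizer_subgroup | rewrite e; exact: finite_image].
apply/esym/ncard_eq => //; apply: card_esym; apply: inj_card_eq.
exact: in2W.
Qed.

Lemma gset_iso_stabilizer (T T' : Type) (act : T -> G -> T) (act' : T' -> G -> T') f c :
  gset_iso act act' f -> stabilizer act' (f c) = stabilizer act c.
Proof.
move=> [/bij_inj inj eqv]; apply/seteqP; split=> g /=; rewrite /stabilizer /= -eqv.
  exact: inj.
by move=> ->.
Qed.

(** Both sets are the set of cosets of the common stabilizer: c g goes to c' g. *)
Lemma stabilizer_gset_iso (T T' : Type) (act : T -> G -> T) (act' : T' -> G -> T') c c' :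
    is_right_action act -> transitive_action act ->
    is_right_action act' -> transitive_action act' ->
    stabilizer act c = stabilizer act' c' ->
  exists f, gset_iso act act' f /\ f c = c'.
Proof.
move=> aR tr aR' tr' e.
have [w hw] := choice (fun x => tr c x).
have [w' hw'] := choice (fun x => tr' c' x).
have key g h : act c g = act c h <-> act' c' g = act' c' h.
  have := rcoset_stabilizer aR c h; rewrite e (rcoset_stabilizer aR') => /seteqP[s1 s2].
  by split; [exact: (s2 g) | exact: (s1 g)].
have fE g : act' c' (w (act c g)) = act' c' g by apply/key; rewrite hw.
have gE g : act c (w' (act' c' g)) = act c g by apply/key; rewrite hw'.
exists (fun x => act' c' (w x)); split; first split.
- exists (fun y => act c (w' y)) => [x|y]; first by rewrite gE hw.
  by rewrite fE hw'.
- by move=> x g; rewrite -[in LHS](hw x) -aR.2 fE aR'.2.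
- by rewrite -[in LHS](aR.1 c) fE aR'.1.
Qed.

Lemma coset_act_right H : is_right_action (@coset_act G H).
Proof.
split=> [c|c g h]; apply: val_inj; apply/seteqP; split=> x.
- by move=> /rcosetP; rewrite invg1 mulg1.
- by move=> cx; apply/rcosetP; rewrite invg1 mulg1.
- by move=> /rcosetP /= cx; apply/rcosetP/rcosetP; rewrite -mulgA -invgM.
- by move=> /rcosetP/rcosetP cx; apply/rcosetP; rewrite /= invgM mulgA.
Qed.

Lemma rcosetM H g h : rcoset (rcoset H g) h = rcoset H (g * h).
Proof.
apply/seteqP; split=> x; first by move=> /rcosetP/rcosetP; rewrite -mulgA -invgM => /rcosetP.
by move=> /rcosetP Hx; apply/rcosetP/rcosetP; rewrite -mulgA -invgM.
Qed.

Lemma rcoset1 H : rcoset H 1 = H.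
Proof.
apply/seteqP; split=> x; first by move=> /rcosetP; rewrite invg1 mulg1.
by move=> Hx; apply/rcosetP; rewrite invg1 mulg1.
Qed.

Lemma coset_space_rep H (c : coset_space H) : exists g, val c = rcoset H g.
Proof. by case: c => A hA; have [g _ eA] := set_mem hA; exists g; rewrite eA. Qed.

Lemma coset_act_transitive H : transitive_action (@coset_act G H).
Proof.
move=> c c'; have [g cg] := coset_space_rep c; have [g' cg'] := coset_space_rep c'.
by exists (g^-1 * g'); apply: val_inj; rewrite /= cg rcosetM mulgA mulgV mul1g cg'.
Qed.

Lemma stabilizer_base_coset H (c : coset_space H) : is_subgroup H -> val c = H ->
  stabilizer (@coset_act G H) c = H.
Proof.
move=> sH cH; apply/seteqP; split=> g.
  move=> /(congr1 val) /=; rewrite cH => e.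
  by rewrite -e; apply/rcosetP; rewrite mulgV; exact: subgroup1.
move=> Hg; apply: val_inj; rewrite /= cH -[RHS]rcoset1.
by apply/rcoset_eqP; rewrite // invg1 mulg1.
Qed.

End CosetsActions.

(** * The group of bijections of a set *)

Section Permutations.
Variable T : Type.

Record bijection := Bijection {
  bij_fun :> T -> T;
  bij_inv : T -> T;
  bij_funK : cancel bij_fun bij_inv;
  bij_invK : cancel bij_inv bij_fun
}.

HB.instance Definition _ := gen_eqMixin bijection.
HB.instance Definition _ := gen_choiceMixin bijection.

Lemma bijectionP (p q : bijection) : bij_fun p = bij_fun q -> p = q.
Proof.
case: p q => [f f' fK f'K] [g g' gK g'K] /= e; subst g.
have e : f' = g' by apply/funext => x; rewrite -[in LHS](g'K x) fK.
by subst g'; congr Bijection; exact: Prop_irrelevance.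
Qed.

Definition bijection1 : bijection := @Bijection idfun idfun (fun _ => erefl) (fun _ => erefl).
Definition bijectionV (p : bijection) : bijection := Bijection (@bij_invK p) (@bij_funK p).
(** The left factor acts first, so that a morphism into this group is a right action. *)
Definition bijectionM (p q : bijection) : bijection :=
  Bijection (can_comp (@bij_funK q) (@bij_funK p)) (can_comp (@bij_invK p) (@bij_invK q)).

Lemma bijectionMA : associative bijectionM.
Proof. by move=> p q r; exact: bijectionP. Qed.
Lemma bijection1M : left_id bijection1 bijectionM.
Proof. by move=> p; exact: bijectionP. Qed.
Lemma bijectionM1 : right_id bijection1 bijectionM.
Proof. by move=> p; exact: bijectionP. Qed.
Lemma bijectionVM : left_inverse bijection1 bijectionV bijectionM.
Proof. by move=> p; apply: bijectionP; apply/funext => x /=; rewrite bij_invK. Qed.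
Lemma bijectionMV : right_inverse bijection1 bijectionV bijectionM.
Proof. by move=> p; apply: bijectionP; apply/funext => x /=; rewrite bij_funK. Qed.

HB.instance Definition _ := isGroup.Build bijection
  bijectionMA bijection1M bijectionM1 bijectionVM bijectionMV.

Lemma run_word_val (f : picard_gen -> bijection) w c :
  run (fun s => bij_fun (f s)) (fun s => bij_inv (f s)) w c = bij_fun (word_val f w) c.
Proof.
have gen (p : bijection) : run (fun s => bij_fun (f s)) (fun s => bij_inv (f s)) w (p c) =
    foldl (fun c l => c * (if l.2 then (f l.1)^-1 else f l.1)) p w c.
  rewrite /run; elim: w p => [|[s b] w IH] p //=.
  by rewrite -IH; case: b.
exact: (gen 1).
Qed.

End Permutations.

(** * Transitions between cells *)

Section Transitions.
Variable R : realType.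
Local Notation K := (octa_stab R).
Local Notation face := (set (Defs.point R)).

Lemma octa_face_upper (F : face) : octa_face F -> F `<=` @upper R.
Proof.
move=> /octa_face_orbit[b [k _ ->]]; apply: translate_upper; exact: side_face_upper.
Qed.

Lemma loc_subgroup (L : local_data R) (x : occ L) : is_subgroup (loc x).
Proof. exact/conj_set_subgroup/loc_hat_subgroup. Qed.

Lemma same_face_data_refl (L : local_data R) (D : face_data L) : same_face_data D D.
Proof.
move=> x F DF; exists F; split=> //; exists 1, 1.
have mu := octa_face_upper (mate_face DF); have Fu := octa_face_upper (stored_face DF).
by split; rewrite ?translate1 ?mul1g ?invg1 ?mulg1 //; exact: (subgroup1 (loc_subgroup _)).
Qed.

Definition facet_rule (L : local_data R) (D : face_data L) s (F0 : face) (c c' : cell L) :=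
  exists x k l, let F := translate k F0 in
    [/\ [/\ K k, K l & stored D x F], val c = (x, rcoset (loc x) k),
        gen_elt s = l^-1 * Defs.glue D x F * k
      & val c' = (target D x F, rcoset (loc (target D x F)) l)].

(** The stored representative is unique up to the stabilizer of the face in the
    local group, which the gluing element carries into the local group of the
    target; so the image coset does not depend on any choice. *)
Lemma facet_rule_uniq (L : local_data R) (D D' : face_data L) s F0 c c1 c2 :
  F0 `<=` @upper R -> same_face_data D D' ->
  facet_rule D s F0 c c1 -> facet_rule D' s F0 c c2 -> c1 = c2.
Proof.
move=> F0u sD [x [k [l [[kK lK DF] ec es ec1]]]] [x' [k' [l' [[k'K l'K DF'] ec' es' ec2]]]].
move: ec'; rewrite ec => -[ex ek]; subst x'.
set F := translate k F0 in DF es ec1; set F' := translate k' F0 in DF' es' ec2.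
have Fo := stored_face DF; have Fu := octa_face_upper Fo.
have Jk : loc x (k' * k^-1) by apply/(rcoset_eqP _ _ (loc_subgroup x)).
have F'E : F' = translate (k' * k^-1) F.
  by rewrite /F /F' -translateM // mulgVK.
have [F1 [D'F1 tF1 [j [j' [Jj Jj' F1E mE gE]]]]] := sD x F DF.
have [F2 [_ uniq]] := stored_rep D' x Fo.
have F1F' : F1 = F'.
  transitivity F2; first by apply/esym/uniq; split=> //; exists j.
  by apply/uniq; split=> //; exists (k' * k^-1).
rewrite -F1F' in ec2 es'; rewrite F1F' in F1E.
apply: val_inj; rewrite ec1 ec2 tF1; congr (_, _).
apply/esym/rcoset_eqP; first exact: loc_subgroup.
have m_stab : face_stab x F (j^-1 * (k' * k^-1)).
  split; first by apply: (subgroupM (loc_subgroup x)) => //; apply: (subgroupV (loc_subgroup x)).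
  by rewrite translateM // -F'E F1E translateK.
have [Jq _] : face_stab (target D x F) (mate D x F)
    (Defs.glue D x F * (j^-1 * (k' * k^-1)) * (Defs.glue D x F)^-1).
  by rewrite -glue_stab //; exists (j^-1 * (k' * k^-1)).
have lE : l = Defs.glue D x F * k * (gen_elt s)^-1.
  by rewrite es !invgM invgK !mulgA mulgK mulgV mul1g.
have lE' : l' = Defs.glue D' x F1 * k' * (gen_elt s)^-1.
  by rewrite es' !invgM invgK !mulgA mulgK mulgV mul1g.
have -> : l' * l^-1 = j' * (Defs.glue D x F * (j^-1 * (k' * k^-1)) * (Defs.glue D x F)^-1).
  by rewrite lE lE' gE !invgM invgK !mulgA mulgVK.
exact: (subgroupM (loc_subgroup _)).
Qed.

Lemma induced_uniq (L : local_data R) (D D' : face_data L) s c c1 c2 :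
  same_face_data D D' -> induced D s c c1 -> induced D' s c c2 -> c1 = c2.
Proof.
move=> sD; have inner s' c1' c2' : 
    (exists x k, [/\ K k, val c = (x, rcoset (loc x) k)
       & val c1' = (x, rcoset (loc x) (k * gen_elt s'))]) ->
    (exists x k, [/\ K k, val c = (x, rcoset (loc x) k)
       & val c2' = (x, rcoset (loc x) (k * gen_elt s'))]) -> c1' = c2' :> cell L.
  move=> [x [k [_ ec e1]]] [x' [k' [_ + e2]]]; rewrite ec => -[ex ek]; subst x'.
  by apply: val_inj; rewrite e1 e2 -!rcosetM ek.
case: s => /=.
- by apply: facet_rule_uniq => //; exact: (@side_face_upper R false).
- by apply: facet_rule_uniq => //; exact: (@side_face_upper R true).
- exact: inner.
- exact: inner.
Qed.

Lemma cells_finite (L : local_data R) : finite_set (@cells R L).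
Proof.
apply: (@sub_finite_set _ _ ([set: occ L] `*`` (fun x => rcosets (loc x) K))).
  by move=> c.
apply: finite_setXR => [|x _]; first exact: finite_finset.
by apply: finite_image; exact: octa_stab_finite.
Qed.

Lemma cell_finite (L : local_data R) : finite_set [set: cell L].
Proof. by rewrite (eq_finite_set (card_setT _)); exact: cells_finite. Qed.

Lemma ncard_cell (L : local_data R) :
  ncard [set: cell L] = (\sum_(x : occ L) ncard (rcosets (loc x) K))%N.
Proof.
rewrite (ncard_eq (cell_finite L) (card_setT _)) -ncard_sigma // => x.
by apply: finite_image; exact: octa_stab_finite.
Qed.

Lemma cell_rep (L : local_data R) (c : cell L) :
  exists x k, K k /\ val c = (x, rcoset (loc x) k).
Proof.
case: c => -[x A] hA /=; have [k Kk eA] := set_mem hA.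
by exists x, k; split=> //; congr (_, _); exact: esym eA.
Qed.

Lemma cell_exists (L : local_data R) x k : K k ->
  exists c : cell L, val c = (x, rcoset (loc x) k).
Proof.
move=> Kk; have hc : (x, rcoset (loc x) k) \in @cells R L by apply/mem_set; exists k.
by exists (exist (fun z => z \in @cells R L) _ hc).
Qed.

End Transitions.

(** * Valid symbols as G-sets *)

Section Validity.
Variable R : realType.
Local Notation K := (octa_stab R).
Implicit Types Sg : symbol R.

Lemma word_val_act (T : Type) (act : T -> psl2 -> T) : is_right_action act ->
  forall w c, run (fun s c => act c (gen_elt s)) (fun s c => act c (gen_elt s)^-1) w c =
    act c (word_val gen_elt w).
Proof.
move=> actR w c.
have gen g : run (fun s c => act c (gen_elt s)) (fun s c => act c (gen_elt s)^-1) w (act c g) =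
    act c (foldl (fun c l => c * (if l.2 then (gen_elt l.1)^-1 else gen_elt l.1)) g w).
  rewrite /run; elim: w g => [|[s b] w IH] g //=.
  by rewrite -IH; case: b; rewrite -actR.2.
by rewrite -gen actR.1.
Qed.

Lemma psl2_word g : exists w, g = word_val gen_elt w.
Proof.
elim/psl2_ind: g => [|g s [w ->]]; first by exists [::].
by exists (rcons w (s, false)); rewrite /word_val -cats1 foldl_cat.
Qed.

(** From left to right, the permutations satisfy the relators and hence define a
    morphism from G to the group of bijections of the set of cells. *)
Lemma validP Sg : valid Sg <-> finite_set [set: cell Sg] /\ exists act, @picard_gset R Sg act.
Proof.
split=> [[t [t' [tr tK rel trans]]]|[_ [act [actR trans ind]]]].
- split; first exact: cell_finite.
  pose f s := Bijection (tK s).1 (tK s).2.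
  have runE w c : run t t' w c = bij_fun (word_val f w) c by rewrite -run_word_val.
  have [phi [phiM phig]] : exists phi : psl2 -> bijection (cell Sg),
      (forall g h, phi (g * h) = phi g * phi h) /\ forall a, phi (gen_elt a) = f a.
    apply: picard_presentation => w wr; apply: bijectionP; apply/funext => c.
    by rewrite -runE rel.
  have phi1 : phi 1 = 1 by apply: (@mulgI _ (phi 1)); rewrite -phiM !mulg1.
  have phiV g : phi g^-1 = (phi g)^-1.
    by apply: (@mulgI _ (phi g)); rewrite -phiM !mulgV.
  have phiw w : phi (word_val gen_elt w) = word_val f w.
    rewrite /word_val -phi1; elim: w (1 : psl2) => [|[s b] w IH] g //=.
    by rewrite IH phiM; case: b; rewrite ?phiV phig.
  exists (fun c g => bij_fun (phi g) c); split.
  + by split=> [c|c g h]; rewrite ?phi1 ?phiM.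
  + by move=> c c'; have [w <-] := trans c c'; exists (word_val gen_elt w); rewrite phiw runE.
  + by move=> s c; rewrite phig; exact: tr.
- exists (fun s c => act c (gen_elt s)), (fun s c => act c (gen_elt s)^-1); split.
  + by move=> s c; exact: ind.
  + by move=> s; split=> c; rewrite -actR.2 ?mulgV ?mulVg actR.1.
  + by move=> w wr c; rewrite word_val_act // psl2_relators // actR.1.
  + move=> c c'; have [g <-] := trans c c'; have [w ->] := psl2_word g.
    by exists w; rewrite word_val_act.
Qed.

Lemma cell_actP Sg : valid Sg -> picard_gset (@cell_act R Sg).
Proof.
move=> /validP[_ ex]; rewrite /cell_act; case: pselect => // e.
exact: (projT2 (cid e)).
Qed.

Lemma picard_gset_uniq Sg act act' : @picard_gset R Sg act -> @picard_gset R Sg act' ->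
  forall c g, act c g = act' c g.
Proof.
move=> [actR _ ind] [actR' _ ind'] c; elim/psl2_ind => [|g s IH].
  by rewrite actR.1 actR'.1.
rewrite actR.2 actR'.2 IH.
exact: induced_uniq (@same_face_data_refl _ _ _) (ind _ _) (ind' _ _).
Qed.

Lemma symbol_index Sg (c : cell Sg) : valid Sg ->
  finite_index_subgroup (stabilizer (@cell_act R Sg) c) /\
  ncard (rcosets (stabilizer (@cell_act R Sg) c) [set: psl2]) = ncard [set: cell Sg].
Proof.
move=> v; have [actR tr _] := cell_actP v.
exact: orbit_stabilizer (cell_finite Sg).
Qed.

Lemma symbol_class_conj Sg (c : cell Sg) : valid Sg ->
  symbol_class Sg = conj_class (stabilizer (@cell_act R Sg) c).
Proof.
by move=> v; have [actR tr _] := cell_actP v; rewrite stabilizer_orbits.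
Qed.

Lemma symbol_cell Sg : exists c : cell Sg, True.
Proof.
have [x _] := sym_connected Sg.
by have [c _] := cell_exists x (octa_stab1 R); exists c.
Qed.

End Validity.

(** * The symbol of a finite-index subgroup *)

Section SymbolOfSubgroup.
Variable R : realType.
Local Notation K := (octa_stab R).
Local Notation O := (octahedron R).
Local Notation face := (set (Defs.point R)).
Local Notation side_face := (@side_face R).
Local Notation tau b := (gen_elt (side_gen b)).
Variables (H : set psl2) (r : set psl2 -> psl2).
Hypothesis H_fin : finite_index_subgroup H.
Hypothesis rP : forall A, dcosets H K A -> dcoset H (r A) K = A.

Let sH : is_subgroup H := H_fin.1.
Let sK : is_subgroup K := octa_stab_subgroup R.
Let Ou := @octahedron_upper R.
Let fu := @side_face_upper R.

Lemma dcosets_finite : finite_set (dcosets H K).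
Proof.
apply: (@sub_finite_set _ _
  ((fun A : set psl2 => [set a * k | a in A & k in K]) @` rcosets H [set: psl2])).
  move=> _ [g _ <-]; exists (rcoset H g); first by exists g.
  apply/seteqP; split=> x; first by move=> [_ [h Hh <-] [k Kk <-]]; exists h => //; exists k.
  by move=> [h Hh [k Kk <-]]; exists (h * g); [exists h | exists k].
exact: finite_image H_fin.2.
Qed.

Definition occH : finType := fset_sub_type (fset_set (dcosets H K)).

Lemma occH_dcoset (x : occH) : dcosets H K (fsval x).
Proof. by have := fsvalP x; rewrite in_fset_set ?inE //; exact: dcosets_finite. Qed.

Definition placeH (x : occH) : psl2 := r (fsval x).

Lemma placeH_dcoset x : dcoset H (placeH x) K = fsval x.
Proof. exact/rP/occH_dcoset. Qed.

Lemma dcosetP g x : dcoset H g K x <-> exists2 k, K k & H (x * k^-1 * g^-1).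
Proof.
split=> [[h Hh [k Kk <-]]|[k Kk Hx]].
  by exists k; rewrite // !mulgK.
by exists (x * k^-1 * g^-1) => //; exists k; rewrite // !mulgVK.
Qed.

Lemma placeH_exists g : exists x k, K k /\ H (g * k^-1 * (placeH x)^-1).
Proof.
have hd : dcosets H K (dcoset H g K) by exists g.
have hin : dcoset H g K \in fset_set (dcosets H K).
  by rewrite in_fset_set ?inE //; exact: dcosets_finite.
pose x : occH := FSetSub hin.
have : dcoset H (placeH x) K g.
  rewrite placeH_dcoset; apply/dcosetP; exists 1; first exact: subgroup1.
  by rewrite invg1 mulg1 mulgV; exact: subgroup1.
by move=> /dcosetP[k Kk Hg]; exists x, k.
Qed.

Lemma placeH_uniq x y k : K k -> H (placeH y * k * (placeH x)^-1) -> x = y.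
Proof.
move=> Kk Hyx; apply: val_inj; change (fsval x = fsval y); rewrite -!placeH_dcoset.
set g := placeH x in Hyx *; set g' := placeH y in Hyx *.
apply/seteqP; split=> z /dcosetP[m Km Hz]; apply/dcosetP.
  exists (k * m); first exact: subgroupM.
  rewrite (_ : _ * _ = (z * m^-1 * g^-1) * (g' * k * g^-1)^-1).
    by apply: subgroupM => //; apply: subgroupV.
  by rewrite !invgM !invgK !mulgA mulgVK.
exists (k^-1 * m); first by apply: subgroupM => //; apply: subgroupV.
rewrite (_ : _ * _ = (z * m^-1 * g'^-1) * (g' * k * g^-1)); first exact: subgroupM.
by rewrite !invgM !invgK !mulgA mulgVK.
Qed.

Definition locH (x : occH) : set psl2 := conj_set H (placeH x) `&` K.

Lemma locH_subgroup x : is_subgroup (locH x).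
Proof. by apply: setI_subgroup => //; exact: conj_set_subgroup. Qed.

(** Conjugating by the placement turns this group into [locH]. *)
Definition hatH (x : occH) : set psl2 := H `&` set_stab (translate (placeH x) O).

Lemma set_stab_translate g j : set_stab (translate g O) j <-> K (g^-1 * j * g).
Proof.
have gu := translate_upper (g := g) Ou.
rewrite /octa_stab /set_stab /=; split=> e.
  by rewrite !translateM ?e ?translateK //; exact: translate_upper.
rewrite -[in RHS]e -!translateM // !mulgA mulgV mul1g.
by rewrite translateM //.
Qed.

Lemma hatH_subgroup x : is_subgroup (hatH x).
Proof.
apply: setI_subgroup => //.
have -> : set_stab (translate (placeH x) O) = conj_set K (placeH x)^-1.
  apply/seteqP; split=> j; first by move=> /set_stab_translate Kj; apply/conj_setP; rewrite invgK.
  by move=> /conj_setP; rewrite invgK => Kj; apply/set_stab_translate.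
exact: conj_set_subgroup.
Qed.

Lemma hatH_stab x : hatH x `<=` set_stab (translate (placeH x) O).
Proof. by move=> j []. Qed.

Definition dataH : local_data R := LocalData hatH_subgroup hatH_stab.

Lemma loc_dataH (x : occ dataH) : loc x = locH x.
Proof.
apply/seteqP; split=> j.
  move=> /conj_setP[Hj /set_stab_translate]; rewrite /= !mulgA mulVg mul1g mulgVK => Kj.
  by split=> //; apply/conj_setP.
move=> [/conj_setP Hj Kj]; apply/conj_setP; split=> //.
by apply/set_stab_translate; rewrite /= !mulgA mulVg mul1g mulgVK.
Qed.

(** q glues the face F of x to the face F' of y: after moving both faces to the
    standard facet of the same type, q becomes the generator attached to that
    facet, and q lifts to an element of H between the two placements. *)
Definition glued (x : occH) (F : face) (d : occH * face * psl2) : Prop :=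
  exists b k l, [/\ K k, K l, F = translate k (side_face b) &
    [/\ d.1.2 = translate l (side_face b), d.2 = l * tau b * k^-1
      & H (placeH d.1.1 * d.2 * (placeH x)^-1)]].

Lemma glued_exists x F : octa_face F -> exists d, glued x F d.
Proof.
move=> /octa_face_orbit[b [k Kk FE]].
have [y [l [Kl Hl]]] := placeH_exists (placeH x * k * tau b).
exists (y, translate l (side_face b), l * tau b * k^-1), b, k, l; split=> //; split=> //=.
rewrite (_ : _ * _ = (placeH x * k * tau b * l^-1 * (placeH y)^-1)^-1).
  exact: subgroupV.
by rewrite !invgM !invgK side_genV !mulgA.
Qed.

Lemma glued_sym x F y F' q : glued x F (y, F', q) -> glued y F' (x, F, q^-1).
Proof.
move=> [b [k [l [Kk Kl FE /= [F'E qE Hq]]]]].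
exists b, l, k; split=> //=; split=> //; first by rewrite qE !invgM invgK side_genV !mulgA.
rewrite (_ : _ * _ = (placeH y * q * (placeH x)^-1)^-1); first exact: subgroupV.
by rewrite !invgM !invgK !mulgA.
Qed.

Lemma glued_move x F y F' q j j' : glued x F (y, F', q) -> locH x j -> locH y j' ->
  glued x (translate j F) (y, translate j' F', j' * q * j^-1).
Proof.
move=> [b [k [l [Kk Kl FE /= [F'E qE Hq]]]]] [/conj_setP Hj Kj] [/conj_setP Hj' Kj'].
exists b, (j * k), (j' * l); split=> /=.
- exact: subgroupM.
- exact: subgroupM.
- by rewrite translateM // FE.
- split; first by rewrite translateM // F'E.
    by rewrite qE invgM !mulgA.
  rewrite (_ : _ * _ = (placeH y * j' * (placeH y)^-1) * (placeH y * q * (placeH x)^-1) *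
     (placeH x * j * (placeH x)^-1)^-1).
    by apply: subgroupM => //; [exact: subgroupM | exact: subgroupV].
  by rewrite !invgM !invgK !mulgA !mulgVK.
Qed.

Lemma glued_face x F y F' q : glued x F (y, F', q) ->
  [/\ octa_face F', translate q F = F' & opposite_sides F' (translate q O) O].
Proof.
move=> [b [k [l [Kk Kl FE /= [F'E qE Hq]]]]].
have Kk' : translate k^-1 O = O by apply: (subgroupV sK).
split; first by apply/octa_face_orbit; exists b, l.
  by rewrite qE FE -translateM // mulgVK translateM // side_gen_face F'E.
rewrite F'E qE translateM // Kk' translateM // -[X in opposite_sides _ _ X]Kl.
apply: opposite_sides_translate => //; first exact: translate_upper.
exact: side_opposite.
Qed.

(** The transition element l = q k tau of a cell on the facet b stays in K,
    whichever element k of K carries the standard facet to the face. *)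
Lemma glued_octa x F d b k : glued x F d -> K k -> F = translate k (side_face b) ->
  K (d.2 * k * tau b).
Proof.
move=> [b' [k' [l' [Kk' Kl' FE [_ -> _]]]]] Kk FE'.
have [eb Kt] := face_orbit_uniq Kk Kk' (etrans (esym FE') FE); subst b'.
by rewrite -!mulgA; apply: subgroupM => //; move: Kt; rewrite -!mulgA.
Qed.

(** The quotient q2 q1^-1 is in K because conjugation by the side generator
    preserves the stabilizer of the standard face in K, and it lifts to H between
    the placements of y1 and y2, which therefore share a double coset. *)
Lemma glued_uniq x F y1 F1 q1 y2 F2 q2 :
  glued x F (y1, F1, q1) -> glued x F (y2, F2, q2) ->
  [/\ y1 = y2, locH y1 (q2 * q1^-1) & F2 = translate (q2 * q1^-1) F1].
Proof.
move=> g1 g2; have [F1o q1F _] := glued_face g1; have [_ q2F _] := glued_face g2.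
have Fu : F `<=` @upper R.
  case: g1 => b [k [l [_ _ -> _]]]; apply: translate_upper; exact: fu.
have Ku : K (q2 * q1^-1).
  have [b [k [l [Kk Kl FE /= [_ q1E _]]]]] := g1.
  have := glued_octa g2 Kk FE; rewrite q1E /= !invgM invgK side_genV => Kq.
  by rewrite !mulgA; apply: subgroupM => //; exact: subgroupV.
have [_ [_ [_ [_ _ _ [_ _ /= Hq1]]]]] := g1.
have [_ [_ [_ [_ _ _ [_ _ /= Hq2]]]]] := g2.
have Hu : H (placeH y2 * (q2 * q1^-1) * (placeH y1)^-1).
  rewrite (_ : _ * _ = (placeH y2 * q2 * (placeH x)^-1) * (placeH y1 * q1 * (placeH x)^-1)^-1).
    by apply: subgroupM => //; exact: subgroupV.
  by rewrite !invgM !invgK !mulgA mulgVK.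
have ey : y1 = y2 := placeH_uniq Ku Hu; subst y2.
split=> //; first by split=> //; apply/conj_setP.
have q1u : F1 `<=` @upper R by rewrite -q1F; exact: translate_upper.
by rewrite -q2F -q1F -translateM // mulgVK.
Qed.

Definition datum (x : occH) (F : face) : occH * face * psl2 :=
  if pselect (octa_face F) is left Fo then projT1 (cid (glued_exists x Fo))
  else (x, F, 1).

Lemma datumP x F : octa_face F -> glued x F (datum x F).
Proof. by move=> Fo; rewrite /datum; case: pselect => // Fo'; exact: projT2 (cid _). Qed.

Definition face_orbit (x : occH) (F : face) : set face := [set translate j F | j in locH x].

(** One face in each orbit of the local group, selected as the chosen element of
    the orbit as a set. *)
Definition storedH (x : occH) : set face :=
  [set F | octa_face F /\ F = xget set0 (face_orbit x F)].

Lemma octa_face_translate k (F : face) : K k -> octa_face F -> octa_face (translate k F).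
Proof.
move=> Kk /octa_face_orbit[b [m Km ->]]; apply/octa_face_orbit.
by exists b, (k * m); [exact: subgroupM | rewrite translateM].
Qed.

Lemma face_orbit_translate x j (F : face) : locH x j -> F `<=` @upper R ->
  face_orbit x (translate j F) = face_orbit x F.
Proof.
move=> Jj Fu; apply/seteqP; split=> _ [m Jm <-].
  by exists (m * j); [exact: (subgroupM (locH_subgroup x)) | rewrite translateM].
exists (m * j^-1).
  by apply: (subgroupM (locH_subgroup x)) => //; exact: (subgroupV (locH_subgroup x)).
by rewrite -translateM // mulgVK.
Qed.

Lemma storedH_face x F : storedH x F -> octa_face F. Proof. by case. Qed.

Lemma storedH_exists x F : octa_face F ->
  exists j, locH x j /\ storedH x (translate j F).
Proof.
move=> Fo; have Fu := octa_face_upper Fo.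
have [j Jj jF] : face_orbit x F (xget set0 (face_orbit x F)).
  apply: (@xgetI _ _ _ (translate 1 F)); exists 1 => //.
  exact: subgroup1 (locH_subgroup x).
exists j; split=> //; split; first by apply: octa_face_translate => //; case: Jj.
by rewrite face_orbit_translate.
Qed.

Lemma storedH_rep (x : occ dataH) F : octa_face F ->
  exists! F0, storedH x F0 /\ exists2 j, loc x j & F0 = translate j F.
Proof.
move=> Fo; have [j [Jj jF]] := storedH_exists x Fo.
exists (translate j F); split; first by split=> //; exists j; rewrite ?loc_dataH.
move=> F' [[_ eF'] [j' Jj' F'E]]; rewrite loc_dataH in Jj'.
rewrite eF' F'E face_orbit_translate //; last exact: octa_face_upper.
by rewrite [LHS]jF.2 face_orbit_translate //; exact: octa_face_upper.
Qed.

Lemma datum_face (x : occH) F : storedH x F -> octa_face (datum x F).1.2.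
Proof.
move=> /storedH_face/(datumP x); case: (datum x F) => [[y F'] q] g.
by have [] := glued_face g.
Qed.

Lemma datum_glue (x : occH) F : storedH x F -> translate (datum x F).2 F = (datum x F).1.2.
Proof.
move=> /storedH_face/(datumP x); case: (datum x F) => [[y F'] q] g.
by have [] := glued_face g.
Qed.

Lemma datum_side (x : occH) F : storedH x F ->
  opposite_sides (datum x F).1.2 (translate (datum x F).2 O) O.
Proof.
move=> /storedH_face/(datumP x); case: (datum x F) => [[y F'] q] g.
by have [] := glued_face g.
Qed.

(** Moving the datum by j^-1 gives a second datum q j^-1 for the same face, so
    [glued_uniq] applies. *)
Lemma glued_stab x F y F' q j : glued x F (y, F', q) -> locH x j -> translate j F = F ->
  locH y (q * j * q^-1) /\ translate (q * j * q^-1) F' = F'.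
Proof.
move=> g Jj jF.
have J'1 : locH y 1 := subgroup1 (locH_subgroup y).
have Jj' : locH x j^-1 := subgroupV (locH_subgroup x) Jj.
have [F'o qF _] := glued_face g; have F'u := octa_face_upper F'o.
have := glued_move g Jj' J'1; rewrite translate1 // mul1g invgK.
have Fu : F `<=` @upper R.
  by case: g => b [k [l [_ _ -> _]]]; apply: translate_upper; exact: fu.
have -> : translate j^-1 F = F by rewrite -[in LHS]jF translateK.
by move=> /(glued_uniq g)[_ Jq e].
Qed.

Lemma datum_stab (x : occ dataH) F : storedH x F ->
  [set (datum x F).2 * j * (datum x F).2^-1 | j in @face_stab R dataH x F]
    = @face_stab R dataH (datum x F).1.1 (datum x F).1.2.
Proof.
move=> /storedH_face/(datumP x); case: (datum x F) => [[y F'] q] g /=.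
rewrite /face_stab !loc_dataH; apply/seteqP; split=> j.
  by move=> [m [Jm mF] <-]; apply: glued_stab g Jm mF.
move=> [Jj jF']; have [Jq qF] := glued_stab (glued_sym g) Jj jF'.
by exists (q^-1 * j * q^-1^-1); rewrite // invgK !mulgA mulgV mul1g mulgK.
Qed.

Lemma datum_invol (x : occ dataH) F : storedH x F -> exists F1,
  [/\ storedH (datum x F).1.1 F1, (datum (datum x F).1.1 F1).1.1 = x
    & @rep_change R dataH (datum x F).1.1 x (datum x F).1.2 F (datum x F).2^-1
        F1 (datum (datum x F).1.1 F1).1.2 (datum (datum x F).1.1 F1).2].
Proof.
move=> sF; have := datumP x (storedH_face sF); case: (datum x F) => [[y F'] q] g /=.
have [F'o _ _] := glued_face g; have Fo := storedH_face sF.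
have [j [Jj sF1]] := storedH_exists y F'o.
have J1 : locH x 1 := subgroup1 (locH_subgroup x).
have := glued_move (glued_sym g) Jj J1; rewrite translate1 ?mul1g; last exact: octa_face_upper.
have := datumP y (storedH_face sF1).
case e : (datum y (translate j F')) => [[x2 F2] q2] g2 g1.
have [ex Ju F2E] := glued_uniq g1 g2; subst x2.
exists (translate j F'); rewrite e; split=> //=.
exists j, (q2 * (q^-1 * j^-1)^-1); rewrite !loc_dataH; split=> //.
by rewrite invgM !invgK !mulgA mulgK mulgK.
Qed.

Definition facesH : face_data dataH := @FaceData R dataH storedH
  (fun x F => (datum x F).1.1) (fun x F => (datum x F).1.2) (fun x F => (datum x F).2)
  storedH_face storedH_rep datum_face datum_glue datum_side datum_stab datum_invol.

Lemma cell_coset_exists (c : cell dataH) : exists A : coset_space H,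
  forall (x : occ dataH) k, K k -> val c = (x, rcoset (loc x) k) ->
  val A = rcoset H (placeH x * k).
Proof.
have [x [k [Kk ec]]] := cell_rep c.
have hA : rcoset H (placeH x * k) \in rcosets H [set: psl2].
  by apply/mem_set; exists (placeH x * k).
exists (exist (fun A => A \in rcosets H [set: psl2]) _ hA) => y m Km.
rewrite ec => -[exy]; subst y => /(rcoset_eqP _ _ (loc_subgroup x)).
rewrite loc_dataH => -[/conj_setP Hkm _] /=; apply/rcoset_eqP => //.
by rewrite invgM !mulgA in Hkm *.
Qed.

Definition cell_coset (c : cell dataH) : coset_space H := projT1 (cid (cell_coset_exists c)).

Lemma cell_cosetE (c : cell dataH) (x : occ dataH) k : K k ->
  val c = (x, rcoset (loc x) k) -> val (cell_coset c) = rcoset H (placeH x * k).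
Proof. by move: x k; exact: projT2 (cid (cell_coset_exists c)). Qed.

Lemma cell_coset_inj : injective cell_coset.
Proof.
move=> c c' /(congr1 val).
have [x [k [Kk ec]]] := cell_rep c; have [y [m [Km ec']]] := cell_rep c'.
rewrite (cell_cosetE Kk ec) (cell_cosetE Km ec') => /(rcoset_eqP _ _ sH).
rewrite invgM !mulgA => Hxy.
have Kkm : K (k * m^-1) by apply: subgroupM => //; exact: subgroupV.
have exy : y = x by apply: (placeH_uniq Kkm); rewrite !mulgA.
subst y; apply: val_inj; rewrite ec ec'; congr (_, _).
apply/rcoset_eqP; first exact: loc_subgroup.
by rewrite loc_dataH; split=> //; apply/conj_setP; rewrite !mulgA.
Qed.

Lemma cell_coset_surj A : exists c, cell_coset c = A.
Proof.
have [g eA] := coset_space_rep A; have [x [k [Kk Hg]]] := placeH_exists g.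
have [c ec] := @cell_exists R dataH x k Kk; exists c; apply: val_inj.
rewrite eA (cell_cosetE Kk ec); apply/esym/rcoset_eqP => //.
by rewrite invgM mulgA.
Qed.

Lemma cell_coset_bij : bijective cell_coset.
Proof.
have [h hK] := choice cell_coset_surj.
exists h => [c|A]; last exact: hK.
by apply: cell_coset_inj; rewrite hK.
Qed.

Definition coset_cell (A : coset_space H) : cell dataH := projT1 (cid (cell_coset_surj A)).

Lemma coset_cellK : cancel coset_cell cell_coset.
Proof. by move=> A; exact: projT2 (cid (cell_coset_surj A)). Qed.

Definition actH (c : cell dataH) g : cell dataH := coset_cell (coset_act (cell_coset c) g).

Lemma cell_coset_act c g : cell_coset (actH c g) = coset_act (cell_coset c) g.
Proof. exact: coset_cellK. Qed.

Lemma actH_right : is_right_action actH.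
Proof.
have [a1 aM] := coset_act_right H.
by split=> [c|c g h]; apply: cell_coset_inj; rewrite !cell_coset_act ?a1 ?aM.
Qed.

Lemma actH_transitive : transitive_action actH.
Proof.
move=> c c'; have [g e] := coset_act_transitive (cell_coset c) (cell_coset c').
by exists g; apply: cell_coset_inj; rewrite cell_coset_act.
Qed.

Lemma cell_of_coset (c : cell dataH) (y : occ dataH) l : K l ->
  val (cell_coset c) = rcoset H (placeH y * l) -> val c = (y, rcoset (loc y) l).
Proof.
move=> Kl e; have [c' ec'] := @cell_exists R dataH y l Kl.
rewrite -ec'; congr val; apply: cell_coset_inj; apply: val_inj.
by rewrite e (cell_cosetE Kl ec').
Qed.

Lemma actH_inner s c : K (gen_elt s) ->
  exists x k, [/\ K k, val c = (x, rcoset (loc x) k)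
    & val (actH c (gen_elt s)) = (x, rcoset (loc x) (k * gen_elt s))].
Proof.
move=> Ks; have [x [k [Kk ec]]] := cell_rep c; exists x, k; split=> //.
apply: cell_of_coset; first exact: subgroupM.
by rewrite cell_coset_act /= (cell_cosetE Kk ec) rcosetM mulgA.
Qed.

(** With l = q k tau, the coset of y and l is that of x and k moved by tau, since
    q lifts to an element of H. *)
Lemma actH_facet b c : facet_rule facesH (side_gen b) (side_face b) c (actH c (tau b)).
Proof.
have [x [k [Kk ec]]] := cell_rep c.
have Fo : octa_face (translate k (side_face b)) by apply/octa_face_orbit; exists b, k.
have [j [Jj sF]] := storedH_exists x Fo; rewrite -translateM // in sF.
have Kj : K (j * k) by apply: subgroupM => //; case: Jj.
set F := translate (j * k) (side_face b) in sF.
have g := datumP x (storedH_face sF).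
have Kl := glued_octa g Kj erefl.
exists x, (j * k), ((datum x F).2 * (j * k) * tau b); split=> //.
- rewrite ec; congr (_, _); apply/rcoset_eqP; first exact: loc_subgroup.
  rewrite invgM mulgA mulgV mul1g loc_dataH.
  exact: subgroupV (locH_subgroup x) Jj.
- by rewrite /= !invgM side_genV !mulgA !mulgVK.
- apply: cell_of_coset => //.
  rewrite cell_coset_act /= (cell_cosetE Kk ec) rcosetM; apply/rcoset_eqP => //.
  have [_ [_ [_ [_ _ _ [_ _ /=]]]]] := g.
  move: (datum x F).2 (datum x F).1.1 => q y Hq.
  case: Jj => /conj_setP Hj _.
  rewrite (_ : _ * _ = ((placeH y * q * (placeH x)^-1) * (placeH x * j * (placeH x)^-1))^-1).
    by apply: (subgroupV sH); exact: subgroupM.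
  rewrite !invgM !invgK side_genV !mulgA mulgVK.
  by rewrite -[_ * tau b * tau b]mulgA side_gen_sq mulg1 mulgK.
Qed.

Lemma actH_induced s c : induced facesH s c (actH c (gen_elt s)).
Proof.
case: s; [exact: (actH_facet false)|exact: (actH_facet true)| |].
- exact: (actH_inner c (genX_octa R)).
- exact: (actH_inner c (genY_octa R)).
Qed.

Lemma induced_connect s (c c' : cell dataH) : induced facesH s c c' ->
  connect (paired facesH) (val c).1 (val c').1.
Proof.
have facet F0 : facet_rule facesH s F0 c c' -> connect (paired facesH) (val c).1 (val c').1.
  move=> [x [k [l [[_ _ sF] -> _ ->]]]] /=; apply: connect1; apply/asboolP.
  by eexists; first exact: sF.
case: s facet => /= facet.
- exact: facet.
- exact: facet.
- by move=> [x [k [_ -> ->]]].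
- by move=> [x [k [_ -> ->]]].
Qed.

Lemma facesH_connected : exists x, forall y, connect (paired facesH) x y.
Proof.
have [x _] := placeH_exists 1; exists x => y.
have [c ec] := @cell_exists R dataH x 1 (subgroup1 sK).
have [c' ec'] := @cell_exists R dataH y 1 (subgroup1 sK).
have -> : x = (val c).1 by rewrite ec.
have -> : y = (val c').1 by rewrite ec'.
have [g <-] := actH_transitive c c'.
elim/psl2_ind: g => [|g s IH]; first by rewrite actH_right.1.
by apply: connect_trans IH _; rewrite actH_right.2; exact: induced_connect (actH_induced _ _).
Qed.

Definition symbolH : symbol R := Symbol facesH_connected.

Lemma symbolH_gset : @picard_gset R symbolH actH.
Proof. by split; [exact: actH_right|exact: actH_transitive|exact: actH_induced]. Qed.

Lemma symbolH_valid : valid symbolH.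
Proof. by apply/validP; split; [exact: cell_finite|exists actH; exact: symbolH_gset]. Qed.

Lemma symbolH_iso : gset_iso (@cell_act R symbolH) (@coset_act _ H) cell_coset.
Proof.
split; first exact: cell_coset_bij.
move=> c g; rewrite (picard_gset_uniq (cell_actP symbolH_valid) symbolH_gset).
exact: cell_coset_act.
Qed.

Lemma base_cell_exists : exists c : cell symbolH, val (cell_coset c) = H.
Proof.
have hA : H \in rcosets H [set: psl2].
  by apply/mem_set; exists 1; rewrite // rcoset1.
have [c ec] := cell_coset_surj (exist (fun A => A \in rcosets H [set: psl2]) _ hA).
by exists c; rewrite ec.
Qed.

Lemma placeH_bij : set_bij [set: occ symbolH] (dcosets H K) (fun x => dcoset H (place x) K).
Proof.
split=> [x _|x y _ _|A hA].
- by exists (placeH x).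
- by rewrite /= !placeH_dcoset => e; apply: val_inj.
- have hin : A \in fset_set (dcosets H K) by rewrite in_fset_set ?inE //; exact: dcosets_finite.
  by exists (FSetSub hin) => //; exact: (placeH_dcoset (FSetSub hin)).
Qed.

End SymbolOfSubgroup.

(** * The correspondences *)

Section SubgroupSymbols.
Variable R : realType.

Lemma subgroup_symbol (H : set psl2) (r : set psl2 -> psl2) :
    finite_index_subgroup H ->
    (forall A, dcosets H (octa_stab R) A -> dcoset H (r A) (octa_stab R) = A) ->
  exists Sg : marked_symbol R,
    [/\ valid Sg,
        set_bij [set: occ Sg] (dcosets H (octa_stab R))
          (fun x => dcoset H (place x) (octa_stab R)),
        forall x : occ Sg, place x = r (dcoset H (place x) (octa_stab R)),
        forall x : occ Sg, loc x = conj_set H (place x) `&` octa_stab R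
      & exists f : cell Sg -> coset_space H,
          [/\ forall (c : cell Sg) (x : occ Sg) k, octa_stab R k ->
                val c = (x, rcoset (loc x) k) ->
                val (f c) = rcoset H (place x * k),
              gset_iso (@cell_act R Sg) (@coset_act _ H) f
            & val (f (mark Sg)) = H]].
Proof.
move=> Hfin rP; have [c0 c0H] := base_cell_exists Hfin rP.
exists (@MarkedSymbol R (symbolH Hfin rP) (val c0).1 c0 erefl); split.
- exact: symbolH_valid.
- exact: placeH_bij.
- by move=> x; rewrite /= (placeH_dcoset Hfin rP).
- by move=> x; exact: loc_dataH.
- exists (@cell_coset R H r Hfin); split=> //; last exact: symbolH_iso.
  by move=> c x k Kk; exact: cell_cosetE.
Qed.

Lemma subgroup_symbol_exists (H : set psl2) : finite_index_subgroup H ->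
  exists2 Sg : marked_symbol R, valid Sg & symbol_group Sg = H.
Proof.
move=> Hfin.
have rex (A : set psl2) : exists g, dcosets H (octa_stab R) A -> dcoset H g (octa_stab R) = A.
  have [[g _ gA]|nA] := pselect (dcosets H (octa_stab R) A); first by exists g.
  by exists 1.
have [r rP] := choice rex.
have [Sg [v _ _ _ [f [_ iso fH]]]] := subgroup_symbol Hfin rP.
exists Sg => //; rewrite /symbol_group -(gset_iso_stabilizer _ iso).
by apply: stabilizer_base_coset; first exact: Hfin.1.
Qed.

Lemma valid_stabilizer_iso (Sg Sg' : symbol R) c c' : valid Sg -> valid Sg' ->
  stabilizer (@cell_act R Sg) c = stabilizer (@cell_act R Sg') c' ->
  exists f, gset_iso (@cell_act R Sg) (@cell_act R Sg') f /\ f c = c'.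
Proof.
move=> /cell_actP[aR tr _] /cell_actP[aR' tr' _].
exact: stabilizer_gset_iso.
Qed.

End SubgroupSymbols.

Theorem theoremA (R : realType) :
  (* the local and face data determine at most one transition system *)
  (forall (L : local_data R) (D D' : face_data L), same_face_data D D' ->
     (forall s c c1 c2, induced D s c c1 -> induced D' s c c2 -> c1 = c2) /\
     (forall t t', transition_system D t -> transition_system D' t' -> t = t'))
  /\
  (* validity *)
  (forall Sg : symbol R,
     valid Sg <->
     finite_set [set: cell Sg] /\ exists act, @picard_gset R Sg act)
  /\
  (* the index formula *)
  (forall Sg : marked_symbol R, valid Sg ->
     let H := symbol_group Sg in
     [/\ finite_index_subgroup H,
         ncard (rcosets H [set: psl2]) = ncard [set: cell Sg]
       & ncard [set: cell Sg] =
           (\sum_(x : occ Sg) ncard (rcosets (loc x) (octa_stab R)))%N])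
  /\
  (* every marked finite-index subgroup yields a valid marked symbol, for any
     choice r of representatives of the double cosets *)
  (forall H : set psl2, finite_index_subgroup H ->
     let K := octa_stab R in
     forall r : set psl2 -> psl2,
       (forall A, dcosets H K A -> dcoset H (r A) K = A) ->
       exists Sg : marked_symbol R,
         [/\ valid Sg,
             set_bij [set: occ Sg] (dcosets H K)
               (fun x => dcoset H (place x) K),
             forall x : occ Sg, place x = r (dcoset H (place x) K),
             forall x : occ Sg, loc x = conj_set H (place x) `&` K
           & exists f : cell Sg -> coset_space H,
               [/\ forall (c : cell Sg) (x : occ Sg) k, K k ->
                     val c = (x, rcoset (loc x) k) ->
                     val (f c) = rcoset H (place x * k),
                   gset_iso (@cell_act R Sg) (@coset_act _ H) f
                 & val (f (mark Sg)) = H]])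
  /\
  (* the two correspondences *)
  bijective_modulo (fun Sg : marked_symbol R => valid Sg) (@marked_equiv R)
    (@symbol_group R) (@finite_index_subgroup psl2)
  /\
  bijective_modulo (@valid R) (@unmarked_equiv R)
    (@symbol_class R)
    (fun C => exists2 H, finite_index_subgroup H & C = conj_class H).
Proof.
split; last split; last split; last split; last split.
- move=> L D D' sD; split=> [s c c1 c2|t t' tr tr']; first exact: induced_uniq.
  by apply/funext => s; apply/funext => c; exact: induced_uniq sD (tr s c) (tr' s c).
- exact: validP.
- move=> Sg v H; have [Hfin eH] := symbol_index (mark Sg) v.
  by split=> //; exact: ncard_cell.
- by move=> H Hfin K r rP; exact: subgroup_symbol.
- split=> [Sg v|Sg Sg' v v'|H Hfin].
  + by have [] := symbol_index (mark Sg) v.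
  + split=> [[f [iso fm]]|e]; last exact: valid_stabilizer_iso.
    by rewrite /symbol_group -fm (gset_iso_stabilizer _ iso).
  + exact: subgroup_symbol_exists.
- split=> [Sg v|Sg Sg' v v'|C [H Hfin ->]].
  + have [c _] := symbol_cell Sg; exists (stabilizer (@cell_act R Sg) c).
      by have [] := symbol_index c v.
    exact: symbol_class_conj.
  + split=> [[f iso]|e].
      have [[h fK hK] _] := iso; apply/seteqP; split=> _ [c _ <-].
        by exists (f c); rewrite // (gset_iso_stabilizer _ iso).
      by exists (h c); rewrite // -(gset_iso_stabilizer _ iso) hK.
    have [c _] := symbol_cell Sg.
    have : symbol_class Sg (stabilizer (@cell_act R Sg) c) by exists c.
    rewrite e => -[c' _ e']; have [f [iso _]] := valid_stabilizer_iso v v' (esym e').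
    by exists f.
  + have [Sg v <-] := subgroup_symbol_exists R Hfin.
    by exists Sg => //; exact: symbol_class_conj.
Qed.
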